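(* Let $m$, $k$, $t$ be positive integers. Each of the following classes of graphs is Pollyanna: (i) the class of $mK_t$-free graphs; (ii) the class of $(t,k)$-pineapple-free graphs; (iii) the class of $t$-lollipop-free graphs; (iv) the class of bowtie-free graphs; (v) the class of bull-free graphs.
   Context: All graphs are finite and simple. For a graph $H$, a graph $G$ is $H$-free if no induced subgraph of $G$ is isomorphic to $H$. $\chi(G)$ is the chromatic number and $\omega(G)$ the clique number. A class $\mathcal F$ of graphs (not necessarily closed under induced subgraphs) is $\chi$-bounded if there is a function $f$ with $\chi(H)\le f(\omega(H))$ for every induced subgraph $H$ of every graph in $\mathcal F$; it is polynomially $\chi$-bounded if $f$ can be chosen to be a polynomial. A class $\mathcal C$ of graphs is Pollyanna if $\mathcal C\cap\mathcal F$ is polynomially $\chi$-bounded for every $\chi$-bounded class $\mathcal F$ of graphs. $mK_t$ is the disjoint union of $m$ copies of the complete graph $K_t$. A $(t,k)$-pineapple is the graph obtained from $K_t$ by attaching $k$ pendant edges (to $k$ new vertices) at a single vertex of $K_t$. A $t$-lollipop is the graph obtained from the disjoint union of $K_t$ and a path $P_2$ on two vertices by adding one edge between a vertex of the $K_t$ and a vertex of the $P_2$. A bowtie is the 5-vertex graph obtained from two disjoint copies of $K_2$ by adding a new vertex adjacent to all four other vertices. A bull is the 5-vertex graph consisting of a triangle $abc$ together with two further vertices $d,e$, where $d$ is adjacent only to $a$ and $e$ is adjacent only to $b$. *)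

(* Defs.v *)
From HB Require Import structures.
From mathcomp Require Import all_boot all_order all_algebra.

Set Implicit Arguments.
Unset Strict Implicit.
Unset Printing Implicit Defensive.

Record sgraph := SGraph {
  vertex :> finType;
  adj : rel vertex;
  adj_sym : symmetric adj;
  adj_irrefl : irreflexive adj
}.

(* The simple graph whose edges are the pairs of distinct vertices related, in *)
(* at least one direction, by r.                                               *)
Section GraphOfRel.
Variables (T : finType) (r : rel T).
Definition rel_adj : rel T := fun x y => (x != y) && (r x y || r y x).
Lemma rel_adj_sym : symmetric rel_adj.
Proof. by move=> x y; rewrite /rel_adj eq_sym orbC. Qed.
Lemma rel_adj_irrefl : irreflexive rel_adj.
Proof. by move=> x; rewrite /rel_adj eqxx. Qed.
Definition graph_of_rel : sgraph := SGraph rel_adj_sym rel_adj_irrefl.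
End GraphOfRel.

Definition graph_iso (G H : sgraph) : Prop :=
  exists2 f : G -> H, bijective f & forall x y, adj (f x) (f y) = adj x y.

Section Induced.
Variables (G : sgraph) (S : {set G}).
Definition induced_adj : rel {x : G | x \in S} :=
  fun x y => adj (val x) (val y).
Lemma induced_adj_sym : symmetric induced_adj.
Proof. by move=> x y; apply: adj_sym. Qed.
Lemma induced_adj_irrefl : irreflexive induced_adj.
Proof. by move=> x; apply: adj_irrefl. Qed.
Definition induced : sgraph := SGraph induced_adj_sym induced_adj_irrefl.
End Induced.

Definition graph_class := sgraph -> Prop.

Definition graph_free (H : sgraph) : graph_class :=
  fun G => forall S : {set G}, ~ graph_iso (induced S) H.

Definition colorable (G : sgraph) (k : nat) : bool :=
  [exists c : {ffun G -> 'I_k},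
    [forall x, forall y, adj x y ==> (c x != c y)]].

Lemma colorable_card (G : sgraph) : exists k, colorable G k.
Proof.
exists #|G|; apply/existsP; exists [ffun x => enum_rank x].
apply/forallP=> x; apply/forallP=> y; apply/implyP; rewrite !ffunE.
by apply: contraTneq => /enum_rank_inj->; rewrite adj_irrefl.
Qed.

Definition chi (G : sgraph) : nat := ex_minn (colorable_card G).

Definition clique (G : sgraph) (S : {set G}) : bool :=
  [forall x in S, forall y in S, (x != y) ==> adj x y].

Definition omega (G : sgraph) : nat := \max_(S : {set G} | clique S) #|S|.

Definition chi_binding (F : graph_class) (f : nat -> nat) : Prop :=
  forall (G : sgraph) (S : {set G}),
    F G -> chi (induced S) <= f (omega (induced S)).

Definition chi_bounded (F : graph_class) : Prop :=
  exists f : nat -> nat, chi_binding F f.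

Definition polynomial_fun (f : nat -> nat) : Prop :=
  exists p : {poly rat}, forall n : nat, ((f n)%:R = p.[n%:R])%R.

Definition poly_chi_bounded (F : graph_class) : Prop :=
  exists2 f : nat -> nat, polynomial_fun f & chi_binding F f.

Definition pollyanna (C : graph_class) : Prop :=
  forall F : graph_class,
    chi_bounded F -> poly_chi_bounded (fun G => C G /\ F G).

(* Vertex (i, a) is vertex a of the i-th copy of K_t. *)
Definition mK (m t : nat) : sgraph :=
  graph_of_rel (fun u v : 'I_m * 'I_t => u.1 == v.1).

(* Left summand: K_t; right summand: the k pendant vertices, attached at       *)
(* vertex 0 of K_t.                                                            *)
Definition pineapple (t k : nat) : sgraph :=
  graph_of_rel (fun u v : 'I_t + 'I_k =>
    match u, v with
    | inl _, inl _ => true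
    | inl a, inr _ => a == 0 :> nat
    | _, _ => false
    end).

(* Left summand: K_t; right summand: P_2; the extra edge joins vertex 0 of     *)
(* K_t to vertex 0 of P_2.                                                     *)
Definition lollipop (t : nat) : sgraph :=
  graph_of_rel (fun u v : 'I_t + 'I_2 =>
    match u, v with
    | inl _, inl _ => true
    | inr _, inr _ => true
    | inl a, inr b => (a == 0 :> nat) && (b == 0 :> nat)
    | _, _ => false
    end).

(* Some (i, a) is vertex a of the i-th copy of K_2; None is the new vertex. *)
Definition bowtie : sgraph :=
  graph_of_rel (fun u v : option ('I_2 * 'I_2) =>
    match u, v with
    | Some x, Some y => x.1 == y.1
    | _, _ => true
    end).

(* The vertices a, b, c, d, e are numbered 0, 1, 2, 3, 4. *)
Definition bull : sgraph :=
  graph_of_rel (fun u v : 'I_5 =>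
    (val u, val v) \in [:: (0, 1); (1, 2); (0, 2); (0, 3); (1, 4)]).

(* Main.v *)
Require Import Defs.
From mathcomp Require Import all_boot all_order all_algebra.
From mathcomp Require Import zify ring.

(** All classes are treated by comparing the vertices of an induced subgraph
    with a maximum clique K.  The vertices with few non-neighbours in K split
    into polynomially many groups, one for each set of non-neighbours, and each
    group has bounded clique number, hence bounded chromatic number.

    - mK_t: a vertex with t non-neighbours in K is handled by induction on m.
    - Pineapple: a vertex that sees K but has many non-neighbours in K is a
      pendant vertex of a clique, so by Ramsey every dense vertex has few
      neighbours outside the dense part; peel off dense parts one by one.
    - Lollipop: vertices that see K but have many non-neighbours are adjacent
      only if they have the same neighbours in K or almost cover K together;
      this makes the bound recursive in the clique number.
    - Bowtie: peel off the vertices with two neighbours in K.  They have stable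
      outside neighbourhoods, so a product colouring leaves triangle-free parts.
    - Bull: call C splittable if it is the disjoint union of nonempty P and Q,
      where adjacent vertices of P have the same neighbours in Q and non-adjacent
      vertices of Q have the same neighbours in P.  If no subset is unsplittable,
      the chromatic number equals the clique number.  In a prime
      bull-free graph no unsplittable set has both a center and an anticenter,
      and for each vertex either its neighbours or its non-neighbours contain no unsplittable set.  The vertices of the second
      kind are coloured through a maximum clique, those of the first kind through
      breadth-first levels.  A weighted substitution argument passes from prime
      graphs to all bull-free graphs. *)

Set Implicit Arguments.
Unset Strict Implicit.
Unset Printing Implicit Defensive.

(** * Colourings of vertex sets *)

(** The binding function of the given class may grow arbitrarily fast, so it is evaluated only at
    arguments fixed by the forbidden graph, never at the clique number. Whatever depends on the
    clique number is paid for by counting labels in a maximum clique, with constants chosen before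
    the graph.

    For bulls, total splittability takes the place of perfection: it is hereditary and yields chi =
    omega by direct recolouring, without any appeal to odd holes and antiholes. The other obstacle
    is nesting of modules: multiplying a colouring of the quotient by colourings of the modules
    would raise the degree at every level. The induction must therefore return the exponent d that
    it received. If [A * omega ^ 4] colours suffice for prime quotients, any d with
    [A * d <= 2 ^ (d - 5)] works: the factor [A] is absorbed by the room that modules with at most
    half of the clique number leave in the palette. *)

Lemma free_embedding (H G : sgraph) (h : H -> G) : graph_free H G ->
  injective h -> ~ (forall x y, adj (h x) (h y) = adj x y).
Proof.
move=> free h_inj h_adj; apply: (free [set h x | x : H]).
have hS x : h x \in [set h x | x : H] by apply: imset_f.
pose g (x : H) : induced [set h x | x : H] := exist _ (h x) (hS x).
have g_bij : bijective g.
  apply: inj_card_bij => [x y /(congr1 val)/h_inj //|].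
  rewrite card_sig -(card_imset _ h_inj); apply: subset_leq_card.
  by apply/subsetP => x; rewrite inE.
case: g_bij => g' gK g'K; exists g'; first by exists g.
by move=> x y; rewrite -[x in RHS]g'K -[y in RHS]g'K -h_adj.
Qed.

Lemma cliqueP (G : sgraph) (K : {set G}) : reflect {in K &, forall x y, x != y ->
  adj x y} (clique K).
Proof.
apply: (iffP forall_inP) => [cK x y xK yK xy|cK x xK].
  by have /forall_inP/(_ y yK)/implyP := cK x xK; apply.
by apply/forall_inP => y yK; apply/implyP; apply: cK.
Qed.

Section SetColoring.
Variable G : sgraph.
Implicit Types (x y : G) (S A B K : {set G}).

(** Colourings are total functions constrained on [S] only, so that subsets, unions and fibres can
    be recoloured without the dependent type [induced S]. *)
Definition scol S (k : nat) : Prop :=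
  exists2 c : G -> nat, {in S, forall x, c x < k}
    & {in S &, forall x y, adj x y -> c x != c y}.

Definition om S : nat := \max_(K : {set G} | (K \subset S) && clique K) #|K|.

Definition stable S : bool := [forall x in S, forall y in S, ~~ adj x y].

Lemma adj_neq x y : adj x y -> x != y.
Proof. by apply: contraTneq => ->; rewrite adj_irrefl. Qed.

Lemma stableP S : reflect {in S &, forall x y, ~~ adj x y} (stable S).
Proof.
apply: (iffP forall_inP) => [sS x y xS yS|sS x xS].
  by have /forall_inP/(_ y yS) := sS x xS.
by apply/forall_inP => y yS; apply: sS.
Qed.

Lemma sub_clique A B : A \subset B -> clique B -> clique A.
Proof.
move=> /subsetP sAB /cliqueP cB; apply/cliqueP => x y /sAB xB /sAB yB.
exact: cB.
Qed.

Lemma om_max S K : K \subset S -> clique K -> #|K| <= om S.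
Proof. by move=> sK cK; apply: leq_bigmax_cond; rewrite sK. Qed.

Lemma om_leP S n :
  reflect (forall K, K \subset S -> clique K -> #|K| <= n) (om S <= n).
Proof.
apply: (iffP (bigmax_leqP _ _ _)) => le_n K; first by move=> sK cK; apply: le_n; rewrite sK.
by case/andP; apply: le_n.
Qed.

Lemma om_ex S : exists K : {set G}, [/\ K \subset S, clique K & #|K| = om S].
Proof.
have c0 : clique (set0 : {set G}) by apply/cliqueP => x y; rewrite inE.
have P0 : ((set0 : {set G}) \subset S) && clique (set0 : {set G}) by rewrite sub0set.
rewrite /om (@bigop.bigmax_eq_arg _ set0 (fun K => (K \subset S) && clique K) _ P0).
by case: arg_maxnP => // K /andP[sK cK] _; exists K.
Qed.

Lemma omS A B : A \subset B -> om A <= om B.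
Proof. by move=> sAB; apply/om_leP => K sK; apply: om_max; apply: subset_trans sAB. Qed.

Lemma om_gt0 S : (0 < om S) = (S != set0).
Proof.
apply/idP/idP => [|/set0Pn[x xS]].
  case: (om_ex S) => K [sK _ <-]; apply: contraTneq => S0.
  by move: sK; rewrite S0 subset0 => /eqP ->; rewrite cards0.
rewrite -(cards1 x); apply: om_max; first by rewrite sub1set.
by apply/cliqueP => y z /set1P -> /set1P ->; rewrite eqxx.
Qed.

Lemma clique_join A B : clique A -> clique B ->
  {in A & B, forall x y, adj x y} ->
  clique (A :|: B) /\ #|A :|: B| = #|A| + #|B|.
Proof.
move=> /cliqueP cA /cliqueP cB AB; split.
  apply/cliqueP => x y /setUP[xA|xB] /setUP[yA|yB] xy; try by [apply: cA|apply: cB].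
    exact: AB.
  by rewrite adj_sym; apply: AB.
rewrite cardsU; have -> : A :&: B = set0; last by rewrite cards0 subn0.
apply/setP => x; rewrite !inE; apply/negP => /andP[xA xB].
by have := AB x x xA xB; rewrite adj_irrefl.
Qed.

Lemma om_join A B S : A \subset S -> B \subset S ->
  {in A & B, forall x y, adj x y} -> om A + om B <= om S.
Proof.
move=> sA sB AB; case: (om_ex A) => K [sK cK <-]; case: (om_ex B) => L [sL cL <-].
have [x y xK yL|cKL <-] := clique_join cK cL; first by apply: AB;
  [apply: (subsetP sK)|apply: (subsetP sL)].
by apply: om_max => //; rewrite subUset (subset_trans sK) // (subset_trans sL).
Qed.

Lemma om_add_clique A K : clique K -> {in A & K, forall x y, adj x y} ->
  om A + #|K| <= om (A :|: K).
Proof.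
move=> cK AK; apply: leq_trans (om_join (subsetUl A K) (subsetUr A K) AK).
by rewrite leq_add2l om_max.
Qed.

Lemma scolW A B k l : scol B k -> A \subset B -> k <= l -> scol A l.
Proof.
move=> [c cB pB] /subsetP sAB le_kl; exists c => [x /sAB xB|x y /sAB xB /sAB yB].
  by apply: leq_trans le_kl; apply: cB.
exact: pB.
Qed.

Lemma scol0 k : scol set0 k.
Proof. by exists (fun=> 0) => x; rewrite inE. Qed.

Lemma scol_stable S : stable S -> scol S 1.
Proof. by move=> /stableP sS; exists (fun=> 0) => // x y xS yS;
  rewrite (negPf (sS x y xS yS)). Qed.

Lemma scol_to (C : finType) (A : {set C}) (a : C) S k : scol S k -> k <= #|A| ->
  exists2 c : G -> C, {in S, forall x, c x \in A}
    & {in S &, forall x y, adj x y -> c x != c y}.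
Proof.
move=> [c cS pS] kA; exists (fun x => nth a (enum A) (c x)) => [x xS|x y xS yS xy].
  by rewrite -mem_enum mem_nth // -cardE (leq_trans (cS x xS)).
rewrite nth_uniq ?enum_uniq ?pS // -cardE.
  by rewrite (leq_trans (cS x xS)).
by rewrite (leq_trans (cS y yS)).
Qed.

Lemma scol_from (C : finType) (A : {set C}) S (c : G -> C) :
  {in S, forall x, c x \in A} -> {in S &, forall x y, adj x y -> c x != c y} ->
  scol S #|A|.
Proof.
move=> cS pS; have [->|[x0 x0S]] := set_0Vmem S; first exact: scol0.
have a0A := cS x0 x0S; exists (fun x => val (enum_rank_in a0A (c x))) => [x _|x y xS yS xy].
  exact: ltn_ord.
apply: contraNneq (pS x y xS yS xy) => /ord_inj/(enum_rank_in_inj (cS x xS) (cS y yS)) ->.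
exact: eqxx.
Qed.

Lemma scol_card S : scol S #|S|.
Proof. by apply: (@scol_from _ _ _ id) => // x y _ _; apply: adj_neq. Qed.

Lemma scol_fiber (C : finType) (A : {set C}) S (g : G -> C) k :
  {in S, forall x, g x \in A} ->
  (forall a, a \in A -> scol [set x in S | g x == a] k) -> scol S (#|A| * k).
Proof.
move=> gS gA.
have: forall a : C, exists c : G -> nat, a \in A ->
    {in [set x in S | g x == a], forall x, c x < k} /\
    {in [set x in S | g x == a] &, forall x y, adj x y -> c x != c y}.
  move=> a; case: (boolP (a \in A)) => [/gA[c c1 c2]|]; first by exists c.
  by exists (fun=> 0).
case/fin_all_exists => c cP.
case: (posnP k) => [k0|k_gt0].
  exists (fun=> 0) => [x xS|x y xS]; have [/(_ x)] := cP _ (gS x xS);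
    rewrite inE xS eqxx k0 => /(_ isT) //.
have -> : #|A| * k = #|setX A [set: 'I_k]| by rewrite cardsX cardsT card_ord.
have fib x : x \in S -> x \in [set y in S | g y == g x] by rewrite inE eqxx andbT.
apply: (@scol_from _ _ _ (fun x => (g x, insubd (Ordinal k_gt0) (c (g x) x)))) => [x xS|x y xS
  yS xy].
  by rewrite !inE andbT; apply: gS.
rewrite xpair_eqE negb_and -implyNb negbK; apply/implyP => gxy.
have [c1 c2] := cP _ (gS x xS).
have yx : y \in [set z in S | g z == g x] by rewrite inE yS eq_sym.
rewrite -(eqP gxy) -val_eqE /= !val_insubd.
by rewrite !c1 ?fib //; apply: c2; rewrite ?fib.
Qed.

(** No edge joins two classes of [g], so all classes share one palette; in [scol_fiber], by
    contrast, the label becomes part of the colour. *)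
Lemma scol_local (C : finType) S (g : G -> C) k :
  {in S &, forall x y, adj x y -> g x = g y} ->
  (forall a, scol [set x in S | g x == a] k) -> scol S k.
Proof.
move=> gS gA.
have /fin_all_exists[c cP]: forall a : C, exists c : G -> nat,
    {in [set x in S | g x == a], forall x, c x < k} /\
    {in [set x in S | g x == a] &, forall x y, adj x y -> c x != c y}.
  by move=> a; case: (gA a) => c; exists c.
exists (fun x => c (g x) x) => [x xS|x y xS yS xy].
  by have [+ _] := cP (g x); apply; rewrite inE xS eqxx.
have gxy := gS x y xS yS xy; have [_] := cP (g x); rewrite -gxy; apply=> //.
  by rewrite inE xS eqxx.
by rewrite inE yS gxy eqxx.
Qed.

Lemma scolU A B k l : scol A k -> scol B l -> scol (A :|: B) (k + l).
Proof.
move=> [c cA pA] [d dB pB].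
exists (fun x => if x \in A then c x else k + d x) => [x|x y]; rewrite !inE.
  case: ifP => [xA _|_ /= xB]; first by apply: ltn_addr; apply: cA.
  by rewrite ltn_add2l; apply: dB.
case: ifP => [xA _|_ /= xB]; case: ifP => [yA _|_ /= yB] xy.
- exact: pA.
- by rewrite neq_ltn ltn_addr ?cA.
- by rewrite neq_ltn orbC ltn_addr ?cA.
- by rewrite eqn_add2l pB.
Qed.

Lemma scol_anti A B k : {in A & B, forall x y, ~~ adj x y} ->
  scol A k -> scol B k -> scol (A :|: B) k.
Proof.
move=> AB cA cB; apply: (@scol_local _ _ (fun x => x \in A)) => [x y|b].
  rewrite !inE; case: (boolP (x \in A)) => xA /=; case: (boolP (y \in A)) => yA //=.
    by move=> _ yB; rewrite (negPf (AB x y xA yB)).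
  by move=> xB _; rewrite adj_sym (negPf (AB y x yA xB)).
case: b; [apply: (scolW cA)|apply: (scolW cB)] => //; apply/subsetP => x; rewrite !inE.
  by case/andP => _ /eqP.
by case/andP => /orP[->|].
Qed.

Lemma chi_le_scol S k : scol S k -> chi (induced S) <= k.
Proof.
move=> [c cS pS]; rewrite /chi; case: ex_minnP => n _; apply.
case: (posnP k) => [k0|k_gt0].
  subst k; apply/existsP.
  have S0 : induced S -> False by move=> x; have := cS _ (valP x).
  have f : {ffun induced S -> 'I_0} by apply: finfun => x; case: (S0 x).
  by exists f; apply/forallP => x; case: (S0 x).
apply/existsP; exists [ffun x => insubd (Ordinal k_gt0) (c (val x))].
apply/forallP => x; apply/forallP => y; apply/implyP => xy; rewrite !ffunE.
rewrite -val_eqE /= !val_insubd !cS ?(valP x) ?(valP y) //.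
by apply: pS; rewrite ?(valP x) ?(valP y).
Qed.

Lemma scol_chi S : scol S (chi (induced S)).
Proof.
rewrite /chi; case: ex_minnP => k /existsP[c /forallP cP] _.
exists (fun x => if insub x is Some u then val (c u) else 0) => [x xS|x y xS yS xy].
  by rewrite (insubT (fun x => x \in S) xS); apply: ltn_ord.
rewrite (insubT (fun x => x \in S) xS) (insubT (fun x => x \in S) yS).
have /forallP/(_ (Sub y yS))/implyP := cP (Sub x xS); rewrite val_eqE; apply.
by rewrite /= /induced_adj !SubK.
Qed.

Lemma omega_induced S : omega (induced S) = om S.
Proof.
apply/eqP; rewrite eqn_leq; apply/andP; split.
  apply/bigmax_leqP => K /cliqueP cK; rewrite -(card_imset _ val_inj); apply: om_max.
    by apply/subsetP => _ /imsetP[u _ ->]; apply: valP.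
  by apply/cliqueP => _ _ /imsetP[u uK ->] /imsetP[w wK ->]; rewrite (inj_eq val_inj); apply: cK.
apply/om_leP => K /subsetP sK /cliqueP cK.
have -> : K = val @: [set u : induced S | val u \in K].
  apply/setP => x; apply/idP/imsetP => [xK|[u]]; last by rewrite inE => uK ->.
  by exists (Sub x (sK x xK)); rewrite ?inE SubK.
rewrite card_imset; last exact: val_inj.
apply: (@leq_bigmax_cond _ (@clique (induced S)) (fun K : {set induced S} => #|K|));
  apply/cliqueP => u w; rewrite !inE => uK wK; rewrite -(inj_eq val_inj).
exact: cK.
Qed.

End SetColoring.

Lemma card_small_subsets (T : finType) (K : {set T}) t :
  #|[set A : {set T} | (A \subset K) && (#|A| <= t)]| <= #|K|.+1 ^ t.
Proof.
elim: t => [|t IHt].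
  rewrite expn0 -(cards1 (set0 : {set T})); apply: subset_leq_card.
  by apply/subsetP => A; rewrite !inE leqn0 cards_eq0 => /andP[].
set X := [set A | _]; move: IHt; set Y := [set A | _] => IHt.
have sXY : X \subset Y :|: [set A : {set T} | A \subset K & #|A| == t.+1].
  by apply/subsetP => A; rewrite !inE leq_eqVlt ltnS -andb_orr orbC.
apply: leq_trans (subset_leq_card sXY) _; apply: leq_trans (leq_card_setU _ _) _.
rewrite cards_draws expnS mulSn leq_add // (leq_trans _ (leq_mul (leqnn _) IHt)) //.
have: 'C(#|K|, t.+1) <= #|K| * 'C(#|K|, t).
  have := mul_bin_left #|K| t; nia.
move/leq_trans; apply; rewrite leq_mul2l; apply/orP; right.
rewrite -(cards_draws K t); apply: subset_leq_card.
by apply/subsetP => A; rewrite !inE => /andP[-> /eqP ->] /=.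
Qed.

(** * Disjoint cliques *)

Lemma leq_expl m n a : m <= n -> m ^ a <= n ^ a.
Proof. by case: a => [//|a]; rewrite leq_exp2r. Qed.

Definition om_bounded (G : sgraph) (F : nat -> nat) : Prop :=
  forall (S : {set G}) n, om S <= n -> scol S (F n).

Lemma polynomial_fun_power A a : polynomial_fun (fun n => A * n.+1 ^ a).
Proof.
exists ((A%:R)%:P * ('X + 1) ^+ a)%R => n.
by rewrite !hornerE GRing.natrM GRing.natrX -GRing.natr1.
Qed.

Lemma pollyanna_of_power_bound (C : graph_class) :
  (forall F : nat -> nat, exists A a,
     forall G, C G -> om_bounded G F ->
     forall S : {set G}, scol S (A * (om S).+1 ^ a)) ->
  pollyanna C.
Proof.
(* A binding function need not be monotone. Its running maximum also serves every [n] above the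
   clique number, as [om_bounded] demands. *)
move=> bound F [f bf]; pose F' n := \max_(i < n.+1) f i.
have [A [a cA]] := bound F'.
exists (fun n => A * n.+1 ^ a); first exact: polynomial_fun_power.
move=> G S [CG FG]; rewrite omega_induced; apply: chi_le_scol; apply: cA => // {}S n Sn.
apply: scolW (scol_chi S) (subxx S) _; apply: leq_trans (bf G S FG) _.
rewrite omega_induced.
have le_n : om S < n.+1 by rewrite ltnS.
exact: (@leq_bigmax_cond _ xpredT (fun i : 'I_n.+1 => f i) (Ordinal le_n)).
Qed.

Lemma subset_of_card (T : finType) (A : {set T}) n :
  n <= #|A| -> exists2 B : {set T}, B \subset A & #|B| = n.
Proof.
rewrite -bin_gt0 -(cards_draws A n) card_gt0 => /set0Pn[B].
by rewrite inE => /andP[sB /eqP cB]; exists B.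
Qed.

(** * Vertices compared with a maximum clique *)

Section MaxClique.
Variable G : sgraph.
Implicit Types (x y v : G) (S X K T : {set G}).

Definition nonnbr K v : {set G} := [set x in K | ~~ adj x v].

Lemma nonnbr_sub K v : nonnbr K v \subset K.
Proof. by apply/subsetP => x; rewrite inE => /andP[]. Qed.

(** A group with non-neighbours [R] in [K] is complete to [K :\: R]. As [K] is maximum, the clique
    number of the group is at most [#|R|], so [F t] colours suffice for it. *)
Lemma scol_dense F S K X t : om_bounded G F ->
  K \subset S -> clique K -> #|K| = om S -> X \subset S ->
  {in X, forall v, #|nonnbr K v| <= t} -> scol X (#|K|.+1 ^ t * F t).
Proof.
move=> HF sK cK mK sX Xt.
apply: (scolW _ (subxx X) (leq_mul (card_small_subsets K t) (leqnn _))).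
apply: (@scol_fiber _ _ _ _ (nonnbr K)) => [v vX|R]; first by rewrite inE nonnbr_sub Xt.
rewrite inE => /andP[sR tR]; apply: HF; set Y := [set x in X | _].
have: om Y + #|K :\: R| <= om S.
  apply: leq_trans (om_add_clique _ _) (omS _).
  - by apply: sub_clique cK; apply: subsetDl.
  - move=> v x; rewrite !inE => /andP[_ /eqP <-] /andP[]; rewrite inE => + xK.
    by rewrite xK negbK adj_sym.
  - rewrite subUset; apply/andP; split; last exact: subset_trans (subsetDl _ _) sK.
    by apply: subset_trans sX; apply/subsetP => v; rewrite inE => /andP[].
have := cardsID R K; rewrite (setIidPr sR); lia.
Qed.

Lemma max_clique_nonnbr S K v : K \subset S -> clique K -> #|K| = om S ->
  v \in S -> v \notin K -> nonnbr K v != set0.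
Proof.
move=> sK cK mK vS vK; apply/negP => /eqP n0.
have: om [set v] + #|K| <= om S.
  apply: leq_trans (om_add_clique cK _) (omS _) => [_ x /set1P -> xK|].
    by apply: contraTT isT => nvx; have := in_set0 x; rewrite -n0 inE xK adj_sym nvx.
  by rewrite subUset sub1set vS.
have: 0 < om [set v] by rewrite om_gt0; apply/set0Pn; exists v; rewrite inE.
rewrite mK; lia.
Qed.

End MaxClique.

Section DisjointCliques.
Variable G : sgraph.
Implicit Types (x y v : G) (S X K T : {set G}).

Definition has_mK m t S : Prop :=
  exists h : 'I_m -> {set G},
    (forall i, [/\ h i \subset S, clique (h i) & #|h i| = t]) /\
    (forall i j x y, i != j -> x \in h i -> y \in h j -> (x != y) && ~~ adj x y).

Lemma mK_free_has_mK m t S : 0 < m -> 0 < t ->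
  graph_free (mK m t) G -> ~ has_mK m t S.
Proof.
move=> m_gt0 t_gt0 free [h [hP hN]].
have [x0 _] : exists x0, x0 \in h (Ordinal m_gt0).
  by apply/set0Pn; rewrite -card_gt0; case: (hP (Ordinal m_gt0)) => _ _ ->.
pose f (u : mK m t) := nth x0 (enum (h u.1)) u.2.
have sz i : size (enum (h i)) = t by rewrite -cardE; case: (hP i).
have fh (u : mK m t) : f u \in h u.1 by rewrite -mem_enum mem_nth // sz.
have f_eq (u v : mK m t) : (f u == f v) = (u == v).
  case: u v => [i a] [j b]; rewrite xpair_eqE; case: (eqVneq i j) => [<-|ij] /=.
    by rewrite /f /= nth_uniq ?enum_uniq ?sz.
  by have /andP[/negPf ->] := hN _ _ _ _ ij (fh (i, a)) (fh (j, b)).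
apply: (free_embedding (h := f) free) => [u v /eqP|u v]; first by rewrite f_eq => /eqP.
rewrite /= /rel_adj [v.1 == _]eq_sym orbb; case: (eqVneq u.1 v.1) => [uv|uv].
  rewrite andbT; case: (eqVneq u v) => [->|nuv]; first exact: adj_irrefl.
  by have [_ /cliqueP cu _] := hP u.1; apply: cu; rewrite ?fh ?f_eq // uv fh.
by rewrite andbF; apply/negbTE; have /andP[_ ->] := hN _ _ _ _ uv (fh u) (fh v).
Qed.

End DisjointCliques.

Lemma scol_no_mK F m t : exists A a, forall (G : sgraph) (S : {set G}), om_bounded G F ->
  ~ has_mK m t S -> scol S (A * (om S).+1 ^ a).
Proof.
elim: m => [|m [A [a IH]]].
  exists 0, 0 => G S _ []; exists (fun=> set0).
  by split=> [[]|[]].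
exists (1 + A + F t), (1 + t + a) => G S HF noS.
have [K [sK cK mK]] := om_ex S.
pose S1 := [set v in S | t <= #|nonnbr K v|] :\: K.
pose S2 := [set v in S | #|nonnbr K v| < t].
have covS : S \subset K :|: (S1 :|: S2).
  by apply/subsetP => v vS; rewrite !inE vS /=; case: (v \in K) => //=; case: ltnP.
have colS2 : scol S2 ((om S).+1 ^ t * F t).
  rewrite -mK; apply: (scol_dense HF sK cK mK).
    by apply/subsetP => v; rewrite inE => /andP[].
  by move=> v; rewrite inE => /andP[_ /ltnW].
have colS1 : scol S1 ((om S).+1 ^ t * (A * (om S).+1 ^ a)).
  (* Each vertex is labelled by [t] of its non-neighbours in [K]. The vertices with label [R] see
     nothing of the clique [R], so [m] disjoint cliques among them would extend by [R] to [m.+1]. *)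
  pose g v := odflt set0 [pick T : {set G} | (T \subset nonnbr K v) && (#|T| == t)].
  have gP v : v \in S1 -> (g v \subset nonnbr K v) /\ #|g v| = t.
    rewrite !inE => /and3P[_ _ /subset_of_card[T sT cT]].
    rewrite /g; case: pickP => [U /andP[sU /eqP ->] //|/(_ T)].
    by rewrite sT cT eqxx.
  have := card_small_subsets K t; rewrite mK => leK.
  apply: (scolW _ (subxx S1) (leq_mul leK (leqnn _))).
  apply: (@scol_fiber _ _ _ _ g) => [v vX|R]; rewrite inE.
    have [sg ->] := gP v vX; rewrite leqnn andbT.
    exact: subset_trans sg (nonnbr_sub _ _).
  move=> /andP[sR _]; set X := [set x in S1 | _].
  have sXS : X \subset S by apply/subsetP => v; rewrite !inE -!andbA => /and3P[].
  apply: (scolW _ (subxx X) (leq_mul (leqnn A) (leq_expl a (_ : (om X).+1 <= _))));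
    last by rewrite ltnS omS.
  have [->|[v0 v0X]] := set_0Vmem X; first exact: scol0.
  apply: IH => // -[h [hP hN]]; apply: noS.
  have RX v : v \in X -> [/\ v \in S1, R \subset nonnbr K v & #|R| = t].
    by rewrite inE => /andP[vS1 /eqP <-]; have [? ?] := gP v vS1.
  have RN v x : v \in X -> x \in R -> (v != x) && ~~ adj v x.
    move=> /RX[vS1 /subsetP sRv _] /sRv; rewrite inE adj_sym => /andP[xK ->].
    by rewrite andbT; apply: contraTneq vS1 => ->; rewrite !inE xK.
  have hX i x : x \in h i -> x \in X by have [/subsetP sh _ _] := hP i; apply: sh.
  exists (fun i => if unlift ord0 i is Some j then h j else R); split=> [i|i j x y].
    case: unliftP => [j _|_].
      by have [sh ch eh] := hP j; split=> //; apply: subset_trans sXS.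
    have [_ _ cR] := RX v0 v0X; split=> //; first exact: subset_trans sK.
    exact: sub_clique cK.
  case: unliftP => [i' ->|->]; case: unliftP => [j' ->|->] ij xi yj.
  - by apply: (hN i' j'); rewrite // (inj_eq lift_inj) in ij.
  - by apply: RN => //; apply: hX xi.
  - by rewrite eq_sym adj_sym; apply: RN => //; apply: hX yj.
  - by rewrite eqxx in ij.
have colK : scol K (om S) by rewrite -mK; apply: scol_card.
apply: (scolW (scolU colK (scolU colS1 colS2)) covS).
rewrite !expnD expn1.
have := expn_gt0 (om S).+1 t; have := expn_gt0 (om S).+1 a.
move: (_ ^ t) (_ ^ a) => x y; move: (om S) (F t) => n f /= y_gt0 x_gt0.
have xy : 0 < x * y by rewrite muln_gt0 x_gt0 y_gt0.
have h1 : n <= n.+1 * x * y by nia.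
have h2 : x * (A * y) <= A * (n.+1 * x * y) by nia.
have h3 : x * f <= f * (n.+1 * x * y) by nia.
lia.
Qed.


Lemma mK_pollyanna m t : 0 < m -> 0 < t -> pollyanna (graph_free (mK m t)).
Proof.
move=> m_gt0 t_gt0; apply: pollyanna_of_power_bound => F.
have [A [a cA]] := scol_no_mK F m t; exists A, a => G free HF S.
by apply: cA => //; apply: mK_free_has_mK.
Qed.

(** * Pineapples *)

Lemma leq_card_fibers (T C : finType) (X : {set T}) (A : {set C}) (g : T -> C) m :
  {in X, forall x, g x \in A} ->
  (forall a, a \in A -> #|[set x in X | g x == a]| <= m) -> #|X| <= #|A| * m.
Proof.
move=> gX gA; rewrite -sum1_card (partition_big g (mem A)) //= -sum_nat_const.
apply: leq_sum => a aA; apply: leq_trans (gA a aA).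
by rewrite sum1dep_card; apply: subset_leq_card; apply/subsetP => x; rewrite !inE.
Qed.

Lemma clique_nth (G : sgraph) (K : {set G}) (s : seq G) x i j :
  clique K -> {subset s <= K} -> uniq s -> i < size s -> j < size s ->
  adj (nth x s i) (nth x s j) = (i != j).
Proof.
move=> /cliqueP cK sK us lti ltj; case: (eqVneq i j) => [->|ij]; first exact: adj_irrefl.
by apply: cK; rewrite ?sK ?mem_nth // nth_uniq.
Qed.

Lemma cliqueU1 (G : sgraph) (x : G) (T : {set G}) :
  clique T -> {in T, forall y, adj x y} -> clique (x |: T).
Proof.
move=> cT xT; have c1 : clique [set x].
  by apply/cliqueP => y z /set1P -> /set1P ->; rewrite eqxx.
by have [] := clique_join c1 cT; first by move=> y z /set1P ->; apply: xT.
Qed.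

Section PineappleFree.
Variable G : sgraph.
Implicit Types (x y u v w : G) (S D P K T : {set G}).

(** For bounded stable sets the Ramsey bound is polynomial in the clique number: each vertex lies in
    a maximum clique or misses one of its vertices, and among the non-neighbours of a fixed vertex
    the size of stable sets drops by one. *)
Lemma card_ramsey k S n : om S <= n ->
  (forall T, T \subset S -> stable T -> #|T| < k) -> #|S| <= n.+1 ^ k.
Proof.
elim: k S => [|k IHk] S Sn noT.
  have st0 : stable (set0 : {set G}) by apply/stableP => x y; rewrite inE.
  by have := noT set0 (sub0set _) st0; rewrite cards0.
have [->|[x0 x0S]] := set_0Vmem S; first by rewrite cards0.
have k_gt0 : 0 < k.
  have := noT [set x0]; rewrite sub1set cards1 ltnS; apply=> //.
  by apply/stableP => x y /set1P -> /set1P ->; rewrite adj_irrefl.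
have [K [sK cK mK]] := om_ex S.
pose M x := [set y in S | (y != x) && ~~ adj x y].
have leM x : x \in S -> #|M x| <= n.+1 ^ k.
  move=> xS; have sMS : M x \subset S by apply/subsetP => y; rewrite inE => /andP[].
  apply: IHk => [|T sT stT]; first exact: leq_trans (omS sMS) Sn.
  have xT : x \notin T by apply/negP => /(subsetP sT); rewrite !inE eqxx andbF.
  suff : #|x |: T| < k.+1 by rewrite cardsU1 xT.
  apply: noT.
    by rewrite subUset sub1set xS (subset_trans sT).
  have Tx y : y \in T -> ~~ adj x y by move=> /(subsetP sT); rewrite inE => /and3P[].
  apply/stableP => y z /setU1P[->|yT] /setU1P[->|zT]; rewrite ?adj_irrefl ?Tx //.
    by rewrite adj_sym Tx.
  by move/stableP: stT; apply.
have covS : S \subset \bigcup_(x in K) (x |: M x).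
  apply/subsetP => y yS; case: (boolP (y \in K)) => yK.
    by apply/bigcupP; exists y; rewrite // setU11.
  have /set0Pn[x] := max_clique_nonnbr sK cK mK yS yK; rewrite inE => /andP[xK nxy].
  apply/bigcupP; exists x => //; rewrite !inE yS nxy andbT /=.
  by rewrite orbN.
apply: leq_trans (subset_leq_card covS) _.
have : #|\bigcup_(x in K) (x |: M x)| <= \sum_(x in K) (n.+1 ^ k).+1.
  elim/big_rec2: _ => [|x m A xK IH]; first by rewrite cards0.
  apply: leq_trans (leq_card_setU _ _) (leq_add _ IH).
  apply: leq_trans (leq_card_setU _ _) _; rewrite cards1 add1n ltnS.
  by apply: leM; apply: (subsetP sK).
move/leq_trans; apply; rewrite sum_nat_const mK expnS mulnS mulSn addnC.
have : n.+1 ^ 1 <= n.+1 ^ k by apply: leq_pexp2l.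
rewrite expn1; move: (n.+1 ^ k) => e; nia.
Qed.

(* Colour the sets D in the reverse of the order in which they are peeled off:
   a vertex of D keeps its colour inside D and avoids, in the second coordinate,
   the at most q values already used on its later neighbours. *)
Lemma scol_peel S p q :
  (forall S', S' \subset S -> S' != set0 -> exists D,
     [/\ D \subset S', D != set0, scol D p
       & {in D, forall u, #|[set w in S' :\: D | adj u w]| <= q}]) ->
  scol S (p * q.+1).
Proof.
move=> peel.
suff [c [d [cp cdS]]] : exists c : G -> nat, exists d : G -> 'I_q.+1,
    {in S, forall x, c x < p} /\
      {in S &, forall x y, adj x y -> (c x, d x) != (c y, d y)}.
  exists (fun x => c x * q.+1 + d x) => [x xS|x y xS yS xy].
    by have := cp x xS; have := ltn_ord (d x); nia.
  apply: contraNneq (cdS x y xS yS xy) => cd; apply/eqP.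
  have ec : c x = c y by have := ltn_ord (d x); have := ltn_ord (d y); nia.
  by congr pair; [exact: ec|apply: val_inj => /=; move: cd; rewrite ec => /addnI].
move: {2}#|S| (leqnn #|S|) peel => m; elim: m S => [|m IHm] S.
  rewrite leqn0 cards_eq0 => /eqP -> _; exists (fun=> 0), (fun=> ord0).
  by split=> // x; rewrite inE.
move=> Sm peel; have [->|S0] := eqVneq S set0.
  by exists (fun=> 0), (fun=> ord0); split=> // x; rewrite inE.
have [D [sD D0 [b bD pD] Dq]] := peel S (subxx S) S0.
have [||c [d [cp cdS]]] := IHm (S :\: D).
- have := cardsID D S; rewrite (setIidPr sD); move: D0; rewrite -card_gt0; lia.
- by move=> S' sS'; apply: peel; apply: subset_trans sS' (subsetDl _ _).
pose forb u := [set d w | w in [set w in S :\: D | adj u w]].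
pose e u := odflt ord0 [pick i | i \notin forb u].
have eP u : u \in D -> e u \notin forb u.
  move=> uD; rewrite /e; case: pickP => //= allf.
  have : #|'I_q.+1| <= q.
    apply: leq_trans (Dq u uD); apply: leq_trans (leq_imset_card d _).
    by apply: subset_leq_card; apply/subsetP => i _; have := allf i; rewrite /= => /negbFE.
  by rewrite card_ord ltnn.
exists (fun x => if x \in D then b x else c x), (fun x => if x \in D then e x else d x).
have cross x y : x \in D -> y \in S -> y \notin D -> adj x y -> e x != d y.
  move=> xD yS yD xy; apply: contraNneq (eP x xD) => ->.
  by apply/imsetP; exists y; rewrite // !inE yD yS.
split=> // [x xS|x y xS yS xy].
  by case: ifP => xD; [apply: bD|apply: cp; rewrite inE xD].
case: (boolP (x \in D)) => xD; case: (boolP (y \in D)) => yD.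
- by rewrite xpair_eqE negb_and pD.
- by rewrite xpair_eqE negb_and cross ?orbT.
- by rewrite xpair_eqE negb_and eq_sym [_ == e y]eq_sym (cross y x) ?orbT // adj_sym.
- by apply: cdS => //; rewrite inE ?xD ?yD.
Qed.

Lemma pineapple_free_pendants t k x T P : graph_free (pineapple t.+1 k) G ->
  clique T -> #|T| = t -> {in T, forall y, adj x y} ->
  {in P, forall w, adj x w} -> {in T & P, forall y w, (y != w) && ~~ adj y w} ->
  stable P -> #|P| < k.
Proof.
move=> free cT tT xT xP TP /stableP stP; rewrite ltnNge; apply/negP.
move=> /subset_of_card[Q /subsetP sQ cQ].
(* The hub comes first because [pineapple] attaches its pendant edges at vertex 0. *)
pose s := x :: enum T.
have ss : size s = t.+1 by rewrite /= -cardE tT.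
have us : uniq s.
  rewrite /= enum_uniq mem_enum andbT; apply/negP => /xT; rewrite adj_irrefl //.
have sK : {subset s <= x |: T} by move=> y; rewrite !inE mem_enum.
have cK := cliqueU1 cT xT.
have sQk : size (enum Q) = k by rewrite -cardE.
pose f (u : pineapple t.+1 k) : G :=
  match u with inl a => nth x s a | inr b => nth x (enum Q) b end.
have fl (a : 'I_t.+1) : (val a == 0) && (nth x s a == x) || (val a != 0) && (nth x s a \in T).
  case: a => [[|a] lta]; apply/orP; [left|right]; first by rewrite /= !eqxx.
  apply/andP; split=> //; rewrite -[_ \in T]mem_enum; apply: mem_nth.
  by move: ss lta => /= [->].
have fr (b : 'I_k) : nth x (enum Q) b \in P by apply: sQ; rewrite -mem_enum mem_nth ?sQk.
have lr (a : 'I_t.+1) (b : 'I_k) :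
    (nth x s a != nth x (enum Q) b) && (adj (nth x s a) (nth x (enum Q) b) == (val a == 0)).
  have wP := fr b; case/orP: (fl a) => /andP[a0].
    by move/eqP ->; rewrite a0 (xP _ wP) adj_neq ?xP.
  by move=> yT; have /andP[-> /negPf ->] := TP _ _ yT wP; rewrite (negPf a0).
apply: (free_embedding (h := f) free) => [[a|b] [a'|b']|[a|b] [a'|b']] /=.
- by move/eqP; rewrite nth_uniq ?ss // => /eqP/val_inj ->.
- by move=> e; have /andP[] := lr a b'; rewrite e eqxx.
- by move=> e; have /andP[] := lr a' b; rewrite e eqxx.
- by move/eqP; rewrite nth_uniq ?enum_uniq ?sQk // => /eqP/val_inj ->.
- by rewrite /rel_adj (clique_nth x cK sK us) ?ss // orbT andbT.
- by have /andP[_ /eqP ->] := lr a b'; rewrite /rel_adj /= orbF.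
- by rewrite adj_sym; have /andP[_ /eqP ->] := lr a' b; rewrite /rel_adj /=.
- by rewrite /rel_adj andbF; apply/negbTE/stP.
Qed.

Lemma scol_pineapple_free F t k S : 0 < k ->
  om_bounded G F -> graph_free (pineapple t.+1 k) G ->
  scol S (((om S).+1 + (om S).+1 ^ t * F t + F (2 * t))
          * ((om S).+1 * (om S).+1 ^ t * (om S).+1 ^ k).+1).
Proof.
move=> k_gt0 HF free; set N := (om S).+1.
apply: scol_peel => S' sS' S'0.
have le_om : om S' <= om S by apply: omS.
have N_gt0 : 0 < N by [].
(* Below [2 * t] everything is peeled at once. From [2 * t] on, a vertex with at most [t]
   non-neighbours in [K] also has [t] neighbours there. *)
case: (ltnP (om S') (2 * t)) => [lt_om|ge_om].
  exists S'; split=> //.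
    apply: (scolW (HF S' (2 * t) (ltnW lt_om)) (subxx _)); exact: leq_addl.
  move=> u _; rewrite setDv; have -> : [set w in set0 | adj u w] = set0; last by rewrite cards0.
  by apply/setP => w; rewrite !inE.
have [K [sK cK mK]] := om_ex S'.
have le_K : #|K|.+1 <= N by rewrite mK.
pose D := K :|: [set v in S' | #|nonnbr K v| <= t].
have sD : D \subset S'.
  by rewrite subUset sK; apply/subsetP => v; rewrite inE => /andP[].
exists D; split=> //.
- rewrite -card_gt0; apply: leq_trans (subset_leq_card (subsetUl K _)).
  by rewrite mK om_gt0.
- apply: (scolW (scolU (scol_card K) (_ : scol _ (#|K|.+1 ^ t * F t))) (subxx D) _).
    apply: (scol_dense HF sK cK mK); first by apply/subsetP => v; rewrite inE => /andP[].
    by move=> v; rewrite inE => /andP[].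
  by rewrite -addnA leq_add ?(ltnW le_K) // (leq_trans (leq_mul (leq_expl t le_K) (leqnn _)))
    ?leq_addr.
move=> u uD; set X := [set w in _ | _].
have XP w : w \in X -> [/\ w \in S', w \notin K, t < #|nonnbr K w| & adj u w].
  rewrite !inE negb_or -!andbA => /and4P[wK]; rewrite negb_and -ltnNge => + wS' uw.
  by rewrite wS' /=.
(* The label of an outside neighbour [w] of [u] is a hub [z.1] adjacent to [w] and a [t]-clique
   [z.2] of neighbours of the hub that [w] misses. Vertices with the same label are pendants at the
   same hub, so no [k] of them are pairwise non-adjacent and Ramsey bounds their number. *)
pose good w (z : G * {set G}) := [&& z.1 \in u |: K, z.2 \subset K, #|z.2| == t,
   [forall y in z.2, adj z.1 y], adj z.1 w & z.2 \subset nonnbr K w].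
have goodE w : w \in X -> exists z, good w z.
  move=> /XP[wS' wK tw uw].
  have [x xw|wnK] := pickP [pred x in K | adj x w].
    case/andP: xw => /= xK xw.
    have [T sT cT] := subset_of_card (ltnW tw).
    exists (x, T); rewrite /good /= !inE xK orbT cT eqxx xw sT (subset_trans sT) ?nonnbr_sub //=.
    rewrite andbT; apply/forall_inP => y yT.
    have := subsetP sT y yT; rewrite inE => /andP[yK nyw].
    by move/cliqueP: cK; apply=> //; apply: contraNneq nyw => <-.
  (* Here [w] sees nothing of [K], so [u], being adjacent to [w], lies outside [K] and is itself the
     hub. *)
  have wN y : y \in K -> ~~ adj y w by move=> yK; have := wnK y; rewrite /= yK /= => ->.
  have uK : u \notin K by apply: contraTN uw; apply: wN.
  have tu : #|nonnbr K u| <= t by move: uD; rewrite !inE (negPf uK) /= => /andP[].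
  have [|T sT cT] := @subset_of_card _ (K :\: nonnbr K u) t.
    have := cardsID (nonnbr K u) K; rewrite (setIidPr (nonnbr_sub K u)); lia.
  exists (u, T); rewrite /good /= !inE eqxx uw cT eqxx (subset_trans sT) ?subsetDl //=.
  apply/andP; split.
    apply/forall_inP => y /(subsetP sT); rewrite !inE => /andP[+ yK].
    by rewrite yK /= negbK adj_sym.
  apply/subsetP => y /(subsetP sT); rewrite !inE => /andP[_ yK].
  by rewrite yK wN.
pose g w := odflt (u, set0) [pick z | good w z].
have gP w : w \in X -> good w (g w).
  by move=> /goodE[z zw]; rewrite /g; case: pickP => [//|/(_ z)]; rewrite zw.
pose C := setX (u |: K) [set T : {set G} | (T \subset K) && (#|T| <= t)].
have leC : #|C| <= N * N ^ t.
  rewrite cardsX; apply: leq_mul.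
    by apply: leq_trans (leq_card_setU _ _) _; rewrite cards1 add1n.
  by apply: leq_trans (card_small_subsets K t) (leq_expl _ le_K).
apply: leq_trans (leq_mul leC (leqnn _)).
apply: (@leq_card_fibers _ _ _ _ g) => [w wX|[x T] _].
  by have /and5P[gx gT /eqP gt _ _] := gP w wX; rewrite !inE in gx *; rewrite gx gT gt /=.
apply: card_ramsey => [|P sP stP].
  apply: leq_trans le_om; apply: omS; apply/subsetP => w; rewrite inE.
  by case/andP => /XP[].
have [->|[w0 w0P]] := set_0Vmem P.
  by rewrite cards0.
have PP w : w \in P -> w \in X /\ good w (x, T).
  by move=> /(subsetP sP); rewrite inE => /andP[wX /eqP <-]; split=> //; apply: gP.
have [_ /and5P[_ /= sTK /eqP cT /forall_inP xT _]] := PP w0 w0P.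
apply: (pineapple_free_pendants free (sub_clique sTK cK) cT xT) => // [w /PP[_ /and5P[_ _ _ _
  /andP[]//]]|y w yT /PP[/XP[_ wK _ _] /and5P[_ _ _ _ /andP[_ /= sTw]]]].
have := subsetP sTw y yT; rewrite inE => /andP[yK ->]; rewrite andbT.
by apply: contraNneq wK => <-.
Qed.

End PineappleFree.

Lemma pineapple_pollyanna t k : 0 < t -> 0 < k -> pollyanna (graph_free (pineapple t k)).
Proof.
case: t => [//|t] _ k_gt0; apply: pollyanna_of_power_bound => F.
exists (2 * (1 + F t + F (2 * t))), (1 + t + (1 + t + k)) => G free HF S.
apply: (scolW (scol_pineapple_free S k_gt0 HF free) (subxx S)).
rewrite !expnD expn1; set N := (om S).+1.
have := expn_gt0 N t; have := expn_gt0 N k; move: (F t) (F (2 * t)) => f f' /=.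
move: (N ^ t) (N ^ k) => x y y_gt0 x_gt0.
have h1 : N + x * f + f' <= (1 + f + f') * (N * x) by nia.
have h2 : (N * x * y).+1 <= 2 * (N * x * y) by nia.
apply: leq_trans (leq_mul h1 h2) _; apply: eq_leq; ring.
Qed.

(** * Lollipops *)

(* The factor 'C(n, t) counts the t-subsets T of a maximum clique K that label
   the colours: the vertices whose neighbourhood in K is X only use labels T
   disjoint from X, so the recursion merely replaces the second factor at n by
   its value at n - 1, and the growth of that factor pays for the rest. *)
Definition lollipop_bound (t B n : nat) : nat := 'C(n, t) * (n.+1 * (B * n.+1 ^ t.+1)).

Lemma lollipop_bound_mono t B m n : m <= n -> lollipop_bound t B m <= lollipop_bound t B n.
Proof.
move=> le_mn; rewrite leq_mul ?leq_bin2l // leq_mul ?ltnS //.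
by rewrite leq_mul ?leq_expl ?ltnS.
Qed.

Section LollipopFree.
Variable G : sgraph.
Implicit Types (x y u v w a b z : G) (S D A Z K T R : {set G}).

Lemma lollipop_free_path t x T a z : graph_free (lollipop t.+1) G ->
  clique T -> #|T| = t -> {in T, forall y, adj x y} ->
  adj x a -> adj a z -> ~~ adj x z -> x != z ->
  {in T, forall y, ~~ adj y a} -> {in T, forall y, ~~ adj y z} -> False.
Proof.
move=> free cT tT xT xa az xz x_z Ta Tz.
pose s := x :: enum T.
have ss : size s = t.+1 by rewrite /= -cardE tT.
have us : uniq s.
  by rewrite /= enum_uniq mem_enum andbT; apply/negP => /xT; rewrite adj_irrefl.
have sK : {subset s <= x |: T} by move=> y; rewrite !inE mem_enum.
have cK := cliqueU1 cT xT.
pose r (b : 'I_2) := if val b == 0 then a else z.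
pose f (u : lollipop t.+1) : G :=
  match u with inl i => nth x s i | inr b => r b end.
have lr (i : 'I_t.+1) (b : 'I_2) :
    (nth x s i != r b) && (adj (nth x s i) (r b) == (val i == 0) && (val b == 0)).
  rewrite /r; case: i => [[|i] lti] /=.
    by case: ifP => _; rewrite ?xa ?(negPf xz) ?x_z ?andbT // adj_neq.
  have yT : nth x (enum T) i \in T.
    by rewrite -[_ \in T]mem_enum mem_nth //; move: ss lti => /= [->].
  case: ifP => _; rewrite ?(negPf (Ta _ yT)) ?(negPf (Tz _ yT)) andbT.
    by apply: contraTneq az => <-; apply: Tz.
  by apply: contraTneq (xT _ yT) => ->.
have aNz : a != z by apply: adj_neq.
have rr (b b' : 'I_2) : adj (r b) (r b') = (b != b').
  by rewrite /r; case: b b' => [[|[|?]] ?] [[|[|?]] ?] //=; rewrite ?adj_irrefl // adj_sym.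
apply: (free_embedding (h := f) free) => [[i|b] [i'|b']|[i|b] [i'|b']] /=.
- by move/eqP; rewrite nth_uniq ?ss // => /eqP/val_inj ->.
- by move=> e; have /andP[] := lr i b'; rewrite e eqxx.
- by move=> e; have /andP[] := lr i' b; rewrite e eqxx.
- move=> e; congr inr; apply: contraTeq isT => nb.
  by have := rr b b'; rewrite e adj_irrefl nb.
- by rewrite /rel_adj (clique_nth x cK sK us) ?ss // orbT andbT.
- by have /andP[_ /eqP ->] := lr i b'; rewrite /rel_adj /= orbF.
- by rewrite adj_sym; have /andP[_ /eqP ->] := lr i' b; rewrite /rel_adj /=.
- by rewrite rr /rel_adj orbT andbT.
Qed.

Lemma scol_lollipop_free F t : om_bounded G F ->
  graph_free (lollipop t.+1) G -> forall S n, t <= n -> om S <= n ->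
  scol S (lollipop_bound t (1 + F t + F (2 * t + 2)) n).
Proof.
move=> HF free S; set B := 1 + _ + _; pose p := lollipop_bound t B.
move: {2}#|S| (leqnn #|S|) => m; elim: m S => [|m IHm] S.
  by rewrite leqn0 cards_eq0 => /eqP -> n _ _; apply: scol0.
move=> Sm n tn Sn.
case: (ltnP (om S) (2 * t + 2)) => [lt_om|ge_om].
  apply: (scolW (HF S _ (ltnW lt_om)) (subxx S)); rewrite /lollipop_bound.
  have : 0 < 'C(n, t) by rewrite bin_gt0.
  have := expn_gt0 n.+1 t.+1; move: (_ ^ _) ('C(_, _)) => e c /= e_gt0 c_gt0.
  have : 0 < c * (n.+1 * e) by rewrite !muln_gt0 c_gt0.
  have -> : c * (n.+1 * (B * e)) = B * (c * (n.+1 * e)) by ring.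
  have : F (2 * t + 2) <= B by rewrite leq_addl.
  nia.
(* From here on [n] is the clique number itself, so that the maximum clique has exactly [n]
   vertices. *)
apply: scolW (subxx S) (lollipop_bound_mono t B Sn); move: ge_om {n tn Sn}.
set n := om S => ge_om.
have [K [sK cK mK]] := om_ex S; rewrite -/n in mK.
pose X v := [set x in K | adj x v].
have XC v : #|X v| + #|nonnbr K v| = n.
  rewrite -mK -(cardsID (X v) K); congr (_ + _).
    by rewrite (setIidPr _) //; apply/subsetP => x; rewrite inE => /andP[].
  by apply: eq_card => x; rewrite !inE; case: (x \in K); rewrite ?andbT ?andbF.
pose D := K :|: [set v in S | #|nonnbr K v| <= t].
pose A := [set v in S | [&& v \notin K, t < #|nonnbr K v| & X v != set0]].
pose Z := [set v in S | X v == set0].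
have XK v : v \in K -> X v != set0.
  move=> vK; have : 0 < #|K :\ v| by have := cardsD1 v K; rewrite vK mK; lia.
  rewrite card_gt0 => /set0Pn[y]; rewrite !inE => /andP[yv yK].
  by apply/set0Pn; exists y; rewrite inE yK; move/cliqueP: cK; apply.
have ZN z : z \in Z -> [/\ z \in S, z \notin K & {in K, forall x, ~~ adj x z}].
  rewrite inE => /andP[zS /eqP Xz]; split=> //.
    by apply/negP => /XK; rewrite Xz eqxx.
  by move=> x xK; apply/negP => xz; have := in_set0 x; rewrite -Xz inE xK xz.
have sDS : D \subset S by rewrite subUset sK; apply/subsetP => v; rewrite inE => /andP[].
have colD : scol D (B * n.+1 ^ t.+1).
  apply: (scolW (scolU (scol_card K) (_ : scol _ (#|K|.+1 ^ t * F t))) (subxx D) _).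
    apply: (scol_dense HF sK cK mK); first by apply/subsetP => v; rewrite inE => /andP[].
    by move=> v; rewrite inE => /andP[].
  rewrite mK expnS; have := expn_gt0 n.+1 t; move: (_ ^ t) => e /= e_gt0.
  by rewrite /B; nia.
have smaller (Y : {set G}) : Y \subset S -> {in Y, forall v, v \notin K} -> #|Y| <= m.
  move=> sY YK; have [x xK] : exists x, x \in K.
    by apply/set0Pn; rewrite -card_gt0 mK; lia.
  have : #|Y| < #|S|; last by lia.
  apply: proper_card; apply/properP; split=> //; exists x; first exact: (subsetP sK).
  by apply/negP => /YK; rewrite xK.
(* Otherwise a neighbour of [a] in [K] as hub, [t] non-neighbours of [a] in [K], and the path [a],
   [z] form a lollipop. *)
have AZ : {in A & Z, forall a z, ~~ adj a z}.
  move=> a z; rewrite inE => /and4P[aS aK ta /set0Pn[x]]; rewrite inE => /andP[xK xa].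
  move=> /ZN[zS zK zN]; apply/negP => az.
  have [T sT cT] := subset_of_card (ltnW ta).
  have sTK := subset_trans sT (nonnbr_sub K a).
  have Ta y : y \in T -> ~~ adj y a by move/(subsetP sT); rewrite inE => /andP[].
  apply: (lollipop_free_path free (sub_clique sTK cK) cT _ xa az (zN x xK) _ Ta).
  - move=> y yT; move/cliqueP: cK; apply=> //; first exact: (subsetP sTK).
    by apply: contraNneq (Ta y yT) => <-.
  - by apply: contraNneq zK => <-.
  - by move=> y /(subsetP sTK)/zN.
(* A dense vertex [d] has [t] neighbours in [K]; with [d] as hub and the path [z], [z'] they would
   form a lollipop. So [d] is complete to every component of [Z] that it touches. *)
have DZZ d z z' : d \in D -> z \in Z -> z' \in Z -> adj d z -> adj z z' -> adj d z'.
  move=> dD /ZN[zS zK zN] /ZN[zS' zK' zN'] dz zz'; apply/negPn/negP => dz'.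
  have dK : d \notin K by apply: contraTN dz; apply: zN.
  have td : #|nonnbr K d| <= t by move: dD; rewrite !inE (negPf dK) /= => /andP[].
  have [|T sT cT] := @subset_of_card _ (X d) t; first by move: (XC d) ge_om td; clear; lia.
  have TX y : y \in T -> (y \in K) && adj y d by move/(subsetP sT); rewrite inE.
  apply: (lollipop_free_path free _ cT _ dz zz' dz').
  - by apply: sub_clique cK; apply/subsetP => y /TX/andP[].
  - by move=> y /TX/andP[_]; rewrite adj_sym.
  - have : 0 < #|X d| by move: (XC d) ge_om td; clear; lia.
    rewrite card_gt0 => /set0Pn[y]; rewrite inE => /andP[yK].
    by apply: contraTneq => ->; apply: zN'.
  - by move=> y /TX/andP[/zN].
  - by move=> y /TX/andP[/zN'].
(* A vertex of [X a] missed by [b] would be the hub of a lollipop with clique part [T] and path [a],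
   [b]. *)
have AA a b T : a \in A -> b \in A -> adj a b -> T \subset nonnbr K a -> T \subset nonnbr K b ->
    #|T| = t -> X a \subset X b.
  move=> aA bA ab sTa sTb cT; apply/subsetP => x; rewrite !inE => /andP[xK xa].
  rewrite xK /=; apply/negPn/negP => xb.
  have sTK := subset_trans sTa (nonnbr_sub K a).
  have Ta y : y \in T -> ~~ adj y a by move/(subsetP sTa); rewrite inE => /andP[].
  have Tb y : y \in T -> ~~ adj y b by move/(subsetP sTb); rewrite inE => /andP[].
  apply: (lollipop_free_path free (sub_clique sTK cK) cT _ xa ab xb _ Ta Tb).
  - move=> y yT; move/cliqueP: cK; apply=> //; first exact: (subsetP sTK).
    by apply: contraNneq (Ta y yT) => <-.
  - by apply: contraTneq xK => ->; move: bA; rewrite inE => /and3P[].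
pose Z1 := [set z in Z | [exists d in D, adj d z]].
pose g := n * (B * n ^ t.+1).
have colZ1 : scol Z1 ('C(n, t) * g).
  (* By [DZZ] a clique of [Z1] extends by a dense vertex, so the recursion may use [n.-1]. *)
  have omZ1 : om Z1 <= n.-1.
    have : om Z1 < n; last by case: (n).
    have [L [sL cL <-]] := om_ex Z1; have [->|[z zL]] := set_0Vmem L; first by rewrite cards0;
      lia.
    have : z \in Z1 by apply: (subsetP sL).
    rewrite inE => /andP[zZ /exists_inP[d dD dz]].
    have dL : {in L, forall y, adj d y}.
      move=> y yL; case: (eqVneq z y) => [<- //|zy].
      have yZ : y \in Z by have := subsetP sL y yL; rewrite inE => /andP[].
      by apply: (DZZ d z y) => //; move/cliqueP: cL; apply.
    have dNL : d \notin L by apply/negP => /dL; rewrite adj_irrefl.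
    have : #|d |: L| <= n; last by rewrite cardsU1 dNL.
    apply: om_max (cliqueU1 cL dL); rewrite subUset sub1set (subsetP sDS) //.
    by apply: subset_trans sL _; apply/subsetP => y; rewrite !inE => /andP[/andP[]].
  have := IHm Z1 _ n.-1 _ omZ1; rewrite /lollipop_bound prednK; last by lia.
  move=> c1; apply: (scolW (c1 _ _)) => //.
  - apply: smaller; first by apply/subsetP => y; rewrite !inE => /andP[/andP[]].
    by move=> y; rewrite inE => /andP[/ZN[]].
  - lia.
  - by rewrite leq_mul // leq_bin2l // leq_pred.
have colZ2 : scol (Z :\: Z1) (p n).
  apply: IHm => //; try lia.
    apply: smaller; first by apply/subsetP => y; rewrite !inE => /andP[_ /andP[]].
    by move=> y /setDP[/ZN[]].
  by apply: omS; apply/subsetP => y; rewrite !inE => /andP[_ /andP[]].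
(* The colour of [a] contains [t] non-neighbours of [a] in [K]. Adjacent vertices of equal colour
   have these in common, so [AA], used in both directions, gives them the same neighbours in [K],
   and they lie in one class, which is properly coloured. *)
have colA : scol A ('C(n, t) * g).
  have g_gt0 : 0 < g by rewrite !muln_gt0 expn_gt0 /B; lia.
  pose Pal R := setX [set T : {set G} | T \subset K :\: R & #|T| == t] [set: 'I_g].
  have cPal R : #|Pal R| = 'C(#|K :\: R|, t) * g by rewrite cardsX cards_draws cardsT card_ord.
  have : forall R, exists c : G -> {set G} * 'I_g,
      {in [set a in A | X a == R], forall a, c a \in Pal R} /\
      {in [set a in A | X a == R] &, forall a b, adj a b -> c a != c b}.
    move=> R; set AR := [set a in A | _].
    have [->|[a0 a0A]] := set_0Vmem AR.
      by exists (fun=> (set0, Ordinal g_gt0)); split=> a; rewrite inE.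
    have sARS : AR \subset S by apply/subsetP => a; rewrite !inE => /andP[/andP[]].
    have ARK : {in AR, forall a, a \notin K} by move=> a; rewrite !inE => /andP[/and4P[]].
    have : scol AR #|Pal R|; last first.
      by case/(scol_to (set0, Ordinal g_gt0))/(_ (leqnn _)) => c c1 c2; exists c.
    move: (a0A); rewrite !inE => /andP[/and4P[_ _ ta /set0Pn Xa0] /eqP XR].
    have sRK : R \subset K by rewrite -XR; apply/subsetP => x; rewrite inE => /andP[].
    have cKR : #|K :\: R| = n - #|R| by rewrite cardsD (setIidPr sRK) mK.
    (* [R] is nonempty because vertices of [A] see [K]; hence [(n - #|R|).+1 <= n], and the second
       factor of the bound drops to [g]. *)
    have R_gt0 : 0 < #|R| by rewrite card_gt0 -XR; apply/set0Pn.
    have nn := XC a0; rewrite XR in nn.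
    have omAR : om AR <= n - #|R|.
      have : om AR + #|R| <= n; last by lia.
      apply: leq_trans (om_add_clique (sub_clique sRK cK) _) (omS _).
        by move=> a x; rewrite inE => /andP[_ /eqP <-]; rewrite inE adj_sym => /andP[].
      by rewrite subUset sARS (subset_trans sRK).
    rewrite cPal cKR.
    apply: (scolW (IHm AR (smaller _ sARS ARK) (n - #|R|) _ omAR) (subxx _)); first by lia.
    rewrite leq_mul // /g leq_mul ?leq_mul ?leq_expl //; lia.
  case/fin_all_exists => c cP.
  have -> : 'C(n, t) * g = #|Pal set0| by rewrite cPal setD0 mK.
  have inA a : a \in A -> a \in [set b in A | X b == X a] by rewrite inE => ->; rewrite eqxx.
  have cA a : a \in A -> c (X a) a \in Pal (X a).
    by move=> /inA; have [+ _] := cP (X a); apply.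
  have XD a : K :\: X a = nonnbr K a.
    by apply/setP => x; rewrite !inE; case: (x \in K) => //=; rewrite ?andbF ?andbT.
  apply: (@scol_from _ _ _ _ (fun a => c (X a) a)) => [a /cA|a b aA bA ab].
    by rewrite !inE => /andP[/andP[sT ->]]; rewrite setD0 (subset_trans sT) ?subsetDl.
  have [Xab|Xab] := eqVneq (X a) (X b).
    by rewrite -Xab; have [_] := cP (X a); apply=> //; rewrite inE ?aA ?bA ?Xab eqxx.
  apply: contraNneq Xab => cab.
  have := cA b bA; rewrite -cab; move: (cA a aA); rewrite !inE !XD => /andP[/andP[sTa /eqP cT] _].
  move=> /andP[/andP[sTb _] _]; rewrite eqEsubset.
  rewrite (AA a b _ aA bA ab sTa sTb cT) (AA b a _ bA aA _ sTb sTa cT) // adj_sym //.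
have colAZ : scol (A :|: Z1) ('C(n, t) * g).
  apply: scol_anti colA colZ1 => a z aA; rewrite inE => /andP[zZ _]; exact: AZ.
have colDAZ : scol (D :|: (A :|: Z1)) (p n).
  apply: (scolW (scolU colD colAZ) (subxx _)); rewrite /p /lollipop_bound /g.
  have c_gt0 : 0 < 'C(n, t) by rewrite bin_gt0; lia.
  have : n ^ t.+1 <= n.+1 ^ t.+1 by apply: leq_expl.
  move: ('C(_, _)) (n ^ t.+1) (n.+1 ^ t.+1) c_gt0 => c e e' c_gt0 ee'.
  have h1 : c * (n * (B * e)) <= c * (n * (B * e')) by rewrite !leq_mul.
  have h2 : B * e' <= c * (B * e') by rewrite leq_pmull.
  have -> : c * (n.+1 * (B * e')) = c * (B * e') + c * (n * (B * e')) by ring.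
  by rewrite leq_add.
(* The rest of [Z] reuses the whole palette: it is anticomplete to [D] by definition, to [A] by [AZ]
   and to [Z1] by [DZZ]. *)
apply: (scolW (scol_anti _ colDAZ colZ2)) => //.
- move=> v z vS /setDP[zZ]; rewrite inE zZ negb_exists_in => /forall_inP zD.
  case/setUP: vS => [/zD //|/setUP[vA|]]; first exact: AZ.
  rewrite inE => /andP[vZ /exists_inP[d dD dv]]; apply/negP => vz.
  by have := zD d dD; rewrite (DZZ d v z).
- apply/subsetP => v vS; rewrite !inE vS /=.
  case: (v \in K) => //=; case: leqP => //= _; case: (X v == set0) => //=.
  by case: [exists d in D, adj d v].
Qed.

End LollipopFree.

Lemma lollipop_pollyanna t : 0 < t -> pollyanna (graph_free (lollipop t)).
Proof.
case: t => [//|t] _; apply: pollyanna_of_power_bound => F.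
set B := 1 + F t + F (2 * t + 2).
exists (B * t.+1 ^ (t + t.+2)), (t + t.+2) => G free HF S.
(* The argument [om S + t] meets the side condition [t <= n] even when the clique number is
   small. *)
have := scol_lollipop_free HF free (leq_addl (om S) t) (leq_addr t (om S)).
move/scolW; apply=> //; rewrite /lollipop_bound -/B.
set n := om S + t; have le_n : n.+1 <= t.+1 * (om S).+1 by rewrite /n; nia.
have: 'C(n, t) <= n.+1 ^ t.
  have := card_small_subsets [set: 'I_n] t; rewrite cardsT card_ord; apply: leq_trans.
  have := cards_draws [set: 'I_n] t; rewrite cardsT card_ord => <-; apply: subset_leq_card.
  by apply/subsetP => A; rewrite !inE => /andP[-> /eqP ->] /=.
move=> le_C; apply: leq_trans (leq_mul le_C (leqnn _)) _.
apply: (@leq_trans (B * n.+1 ^ (t + t.+2))); first by rewrite !expnD !expnS; apply: eq_leq; ring.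
by rewrite -mulnA -expnMn leq_mul ?leq_expl.
Qed.

(** * Bowties *)

(** When distinct vertices of [H] have distinct neighbourhoods, as in the bowtie and the bull, a map
    that preserves adjacency both ways is automatically injective. *)
Lemma free_embedding_no_twins (H G : sgraph) (h : H -> G) : graph_free H G ->
  (forall u v : H, adj u =1 adj v -> u = v) ->
  ~ (forall x y, adj (h x) (h y) = adj x y).
Proof.
move=> free tw hadj; apply: (free_embedding free _ hadj) => u v huv.
by apply: tw => z; rewrite -!hadj huv.
Qed.

Section BowtieFree.
Variable G : sgraph.
Implicit Types (x y u v w a b : G) (S B K T U : {set G}).

Lemma om_le2 S : (forall x y z, x \in S -> y \in S -> z \in S ->
  adj x y -> adj y z -> adj x z -> False) -> om S <= 2.
Proof.
move=> noS; apply/om_leP => K /subsetP sK /cliqueP cK; rewrite leqNgt; apply/negP.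
case/card_gt2P => x [y [z [[xK yK zK] [xy yz zx]]]].
by apply: (noS x y z); rewrite ?sK ?cK // eq_sym.
Qed.

(** Every peeled set reuses the same [p] colours. Consider the vertices of a triangle that are
    peeled first: two of them get different colours, and a single one would have an edge in its
    outside neighbourhood. So the colour classes are triangle-free. *)
Lemma scol_peel_stable S p k :
  (forall S', S' \subset S -> S' != set0 -> exists B,
     [/\ B \subset S', B != set0, scol B p
       & {in B, forall u, stable [set w in S' :\: B | adj u w]}]) ->
  (forall U, U \subset S -> om U <= 2 -> scol U k) ->
  scol S (p * k).
Proof.
move=> peel tri.
suff [g gp gS] : exists2 g : G -> nat, {in S, forall x, g x < p} &
    forall x y z, x \in S -> y \in S -> z \in S -> g x = g y -> g y = g z ->
    adj x y -> adj y z -> adj x z -> False.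
  have [->|[x0 x0S]] := set_0Vmem S; first exact: scol0.
  have p_gt0 : 0 < p by apply: leq_ltn_trans (gp x0 x0S).
  have -> : p = #|[set: 'I_p]| by rewrite cardsT card_ord.
  apply: (@scol_fiber _ _ _ _ (fun x => insubd (Ordinal p_gt0) (g x))) => [x _|i _].
    by rewrite inE.
  apply: tri; first by apply/subsetP => x; rewrite inE => /andP[].
  have gi x : x \in [set x in S | insubd (Ordinal p_gt0) (g x) == i] -> x \in S /\ g x = i.
    rewrite inE => /andP[xS /eqP <-]; split=> //; rewrite val_insubd gp //.
  apply: om_le2 => x y z /gi[xS gx] /gi[yS gy] /gi[zS gz]; apply: gS => //.
    by rewrite gx gy.
  by rewrite gy gz.
move: {2}#|S| (leqnn #|S|) peel => m {tri}; elim: m S => [|m IHm] S.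
  by rewrite leqn0 cards_eq0 => /eqP -> _; exists (fun=> 0) => [x|x y z]; rewrite inE.
move=> Sm peel; have [->|S0] := eqVneq S set0.
  by exists (fun=> 0) => [x|x y z]; rewrite inE.
have [B [sB B0 [b bB pB] Bst]] := peel S (subxx S) S0.
have [||g gp gS] := IHm (S :\: B).
- have := cardsID B S; rewrite (setIidPr sB); move: B0; rewrite -card_gt0; lia.
- by move=> S' sS'; apply: peel; apply: subset_trans sS' (subsetDl _ _).
pose h x := if x \in B then b x else g x.
exists h => [x xS|].
  by rewrite /h; case: ifP => xB; [apply: bB|apply: gp; rewrite inE xB].
have cross x y z : x \in B -> y \in S -> z \in S -> h x = h y -> h x = h z ->
    adj x y -> adj y z -> adj x z -> False.
  rewrite /h => xB yS zS; rewrite xB.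
  case: (boolP (y \in B)) => [yB e _ xy|yB _]; first by have := pB x y xB yB xy; rewrite e eqxx.
  case: (boolP (z \in B)) => [zB e _ _ xz|zB _ xy yz xz].
    by have := pB x z xB zB xz; rewrite e eqxx.
  move/stableP: (Bst x xB) => /(_ y z); rewrite !inE yB yS xy zB zS xz yz.
  by move=> /(_ isT isT).
move=> x y z xS yS zS hxy hyz xy yz xz.
case: (boolP (x \in B)) => [xB|xB]; first by apply: (cross x y z); rewrite // hxy.
case: (boolP (y \in B)) => [yB|yB].
  by apply: (cross y x z); rewrite // 1?adj_sym.
case: (boolP (z \in B)) => [zB|zB].
  by apply: (cross z x y); rewrite -?hyz -?hxy // 1?adj_sym.
apply: (gS x y z); rewrite ?inE ?xB ?yB ?zB //.
  by move: hxy; rewrite /h (negPf xB) (negPf yB).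
by move: hyz; rewrite /h (negPf yB) (negPf zB).
Qed.

Lemma bowtie_free_center x a b c d : graph_free bowtie G ->
  adj x a -> adj x b -> adj x c -> adj x d -> adj a b -> adj c d ->
  ~~ adj a c -> ~~ adj a d -> ~~ adj b c -> ~~ adj b d -> False.
Proof.
move=> free xa xb xc xd ab cd ac ad bc bd.
pose f (u : bowtie) : G := if u is Some (i, j) then
  (if val i == 0 then if val j == 0 then a else b else if val j == 0 then c else d) else x.
apply: (free_embedding_no_twins (h := f) free).
  move=> [[i j]|] [[i' j']|] //= tw.
  - case: (eqVneq i i') tw => [<-|ii'] tw.
      have := tw (Some (i, j)); rewrite /= /rel_adj /= !eqxx /= andbT.
      by move/esym/negbFE/eqP => ->.
    have := tw (Some (i, rev_ord j)); rewrite /= /rel_adj /= !eqxx /=.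
    rewrite !(inj_eq Some_inj) !xpair_eqE eqxx /= (eq_sym i' i) (negPf ii') /= andbT.
    by case: j {tw} => [[|[|?]] ?].
  - by have := tw None.
  - by have := tw None.
move=> [[[[|[|?]] ?] [[|[|?]] ?]]|] [[[[|[|?]] ?] [[|[|?]] ?]]|] //=;
 rewrite /rel_adj /= ?adj_irrefl //.
all: by [apply/negbTE|rewrite adj_sym|rewrite adj_sym; apply/negbTE].
Qed.

Lemma scol_bowtie_free F S :
  om_bounded G F -> graph_free bowtie G ->
  scol S (((om S).+1 + (om S).+1 ^ 2 * F 2 + (om S).+1 * (om S).+1 ^ 2 + F 6) * F 2).
Proof.
move=> HF free; set N := (om S).+1.
apply: scol_peel_stable => [S' sS' S'0|U _]; last exact: HF.
have le_om : om S' <= om S by apply: omS.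
case: (ltnP (om S') 6) => [lt_om|ge_om].
  exists S'; split=> //.
    apply: (scolW (HF S' 6 (ltnW lt_om)) (subxx _)); exact: leq_addl.
  by move=> u _; apply/stableP => w; rewrite setDv !inE.
have [K [sK cK mK]] := om_ex S'.
have le_K : #|K|.+1 <= N by rewrite mK.
pose X v := [set x in K | adj x v].
have XC v : #|X v| + #|nonnbr K v| = #|K|.
  rewrite -(cardsID (X v) K); congr (_ + _).
    by rewrite (setIidPr _) //; apply/subsetP => x; rewrite inE => /andP[].
  by apply: eq_card => x; rewrite !inE; case: (x \in K); rewrite ?andbT ?andbF.
have XK v : v \in K -> K :\ v \subset X v.
  move=> vK; apply/subsetP => x; rewrite !inE => /andP[xv xK]; rewrite xK.
  by move/cliqueP: cK; apply.
pose B := [set v in S' | 1 < #|X v|].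
have sKB : K \subset B.
  apply/subsetP => v vK; rewrite inE (subsetP sK) //=.
  apply: leq_trans (subset_leq_card (XK v vK)).
  by have := cardsD1 v K; rewrite vK mK; lia.
have sB : B \subset S' by apply/subsetP => v; rewrite inE => /andP[].
exists B; split=> //.
- by rewrite -card_gt0; apply: leq_trans (subset_leq_card sKB); rewrite mK; lia.
- pose D := [set v in S' | #|nonnbr K v| <= 2].
  pose A := [set v in B | (v \notin K) && (2 < #|nonnbr K v|)].
  have colD : scol D (N ^ 2 * F 2).
    apply: (scolW (scol_dense HF sK cK mK _ _) (subxx D) (leq_mul (leq_expl 2 le_K) (leqnn _))).
      by apply/subsetP => v; rewrite inE => /andP[].
    by move=> v; rewrite inE => /andP[].
  have colA : scol A (N * N ^ 2).
    (* The label is a neighbour [x] of [v] in [K] with two non-neighbours of [v] in [K]. Adjacent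
       vertices with the same label would complete a bowtie centred at [x]. *)
    pose good v (z : G * {set G}) :=
      [&& z.1 \in X v, z.2 \subset nonnbr K v & #|z.2| == 2].
    have goodE v : v \in A -> exists z, good v z.
      rewrite !inE => /andP[/andP[vS' vX] /andP[vK /ltnW/subset_of_card[T sT cT]]].
      have /set0Pn[x xX] : X v != set0 by rewrite -card_gt0 (ltnW vX).
      by exists (x, T); rewrite /good /= xX sT cT.
    have [->|[v0 v0A]] := set_0Vmem A; first exact: scol0.
    pose g v := odflt (v0, set0) [pick z | good v z].
    have gP v : v \in A -> good v (g v).
      by move=> /goodE[z zw]; rewrite /g; case: pickP => [//|/(_ z)]; rewrite zw.
    pose C := setX K [set T : {set G} | (T \subset K) && (#|T| <= 2)].
    have leC : #|C| <= N * N ^ 2.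
      rewrite cardsX; apply: leq_mul; first exact: ltnW.
      by apply: leq_trans (card_small_subsets K 2) (leq_expl _ le_K).
    apply: (scolW _ (subxx A) leC); rewrite -[#|C|]muln1.
    apply: (@scol_fiber _ _ _ _ g) => [v /gP/and3P[gx gT /eqP gt]|[x T] _].
      rewrite !inE in gx *; rewrite gt (subset_trans gT (nonnbr_sub K v)) /= andbT.
      by case/andP: gx.
    apply: scol_stable; apply/stableP => v w.
    have fib u : u \in [set x0 in A | g x0 == (x, T)] -> good u (x, T).
      by rewrite inE => /andP[/gP + /eqP <-].
    move=> /fib/and3P[/= xv sTv cT] /fib/and3P[/= xw sTw _].
    move: xv xw; rewrite !inE => /andP[xK xv] /andP[_ xw]; apply/negP => vw.
    have /card_gt1P[y [y' [yT y'T yy']]] : 1 < #|T| by rewrite (eqP cT).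
    have nn z u : z \in T -> T \subset nonnbr K u -> (z \in K) && ~~ adj z u.
      by move=> zT /subsetP/(_ z zT); rewrite inE.
    have /andP[yK yv] := nn y v yT sTv; have /andP[y'K y'v] := nn y' v y'T sTv.
    have /andP[_ yw] := nn y w yT sTw; have /andP[_ y'w] := nn y' w y'T sTw.
    move/cliqueP: cK => cK.
    apply: (bowtie_free_center free xv xw (_ : adj x y) (_ : adj x y') vw (cK _ _ yK y'K yy'));
      rewrite 1?adj_sym //.
      by rewrite adj_sym; apply: cK => //; apply: contraNneq yv => <-.
    by rewrite adj_sym; apply: cK => //; apply: contraNneq y'v => <-.
  have cov : B \subset K :|: D :|: A.
    apply/subsetP => v vB; have vS' := subsetP sB v vB.
    by move: vB; rewrite !inE vS' /= => ->; case: (v \in K) => //=; case: leqP.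
  apply: (scolW (scolU (scolU (scol_card K) colD) colA) cov).
  by apply: leq_trans (leq_addr _ _); rewrite !leq_add2r ltnW.
move=> u; rewrite inE => /andP[uS' uX].
apply/stableP => w w'; rewrite !inE => /andP[/andP[wB wS'] uw] /andP[/andP[w'B w'S'] uw'].
apply/negP => ww'; move: wB w'B; rewrite wS' w'S' /= -!leqNgt => wX w'X.
move/cliqueP: (cK) => cKP.
have center y y' : y \in X u -> y' \in X u -> y != y' ->
    y \notin X w -> y' \notin X w -> y \notin X w' -> y' \notin X w' -> False.
  rewrite !inE => /andP[yK yu] /andP[y'K y'u] yy'; rewrite yK y'K /= => n1 n2 n3 n4.
  apply: (bowtie_free_center free uw uw' (_ : adj u y) (_ : adj u y') ww' (cKP _ _ yK y'K yy'));
    by rewrite 1?adj_sym.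
(* Two neighbours of [u] in [K] missed by both [w] and [w'] give a bowtie centred at [u]. Four
   neighbours always leave two such, since [w] and [w'] have at most one neighbour each in [K]. *)
have far : 1 < #|X u :\: (X w :|: X w')| -> False.
  case/card_gt1P => y [y' [/setDP[yY]]]; rewrite inE negb_or => /andP[n1 n2].
  by case/setDP=> y'Y; rewrite inE negb_or => /andP[n3 n4] yy'; apply: (center y y').
case: (leqP 4 #|X u|) => [Xu4|Xu3].
  apply: far.
  have c1 : #|X w :|: X w'| <= #|X w| + #|X w'| by apply: leq_card_setU.
  move: (cardsID (X w :|: X w') (X u)) (subset_leq_card (subsetIr (X u) (X w :|: X w'))).
  by move: c1 Xu4 wX w'X; clear; lia.
(* Now [u] misses at least three vertices of [K]. If [X z] met [X u] in [x], then [x] would be the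
   only neighbour of [z] in [K], and the edge [u z] with two of the missed vertices would form a
   bowtie centred at [x]. *)
have private (z : G) : adj u z -> #|X z| <= 1 -> {in X u, forall x, x \notin X z}.
  move=> uz zX x xu; apply/negP => xz.
  have Xz : X z \subset X u.
    apply/subsetP => y yz; case: (eqVneq x y) => [<- //|xy].
    suff : 1 < #|X z| by rewrite ltnNge zX.
    by apply/card_gt1P; exists x, y.
  have : 1 < #|K :\: X u|.
    move: (cardsID (X u) K) (subset_leq_card (subsetIr K (X u))); rewrite mK.
    by move: ge_om Xu3; clear; lia.
  case/card_gt1P => y [y' []]; rewrite !inE => /andP[nyu yK] /andP[ny'u y'K] yy'.
  have nz q : q \in K -> q \notin X u -> ~~ adj q z.
    by move=> qK; apply: contra => qz; apply: (subsetP Xz); rewrite inE qK.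
  rewrite yK in nyu; rewrite y'K in ny'u.
  have yz := nz y yK; have y'z := nz y' y'K; rewrite !inE yK y'K /= in yz y'z;
    rewrite /= in nyu ny'u.
  move: (xu) (xz); rewrite !inE => /andP[xK xu'] /andP[_ xz'].
  apply: (bowtie_free_center free xu' xz' (_ : adj x y) (_ : adj x y') uz (cKP _ _ yK y'K yy')).
  - by apply: cKP => //; apply: contraNneq nyu => <-.
  - by apply: cKP => //; apply: contraNneq ny'u => <-.
  - by rewrite adj_sym.
  - by rewrite adj_sym.
  - by rewrite adj_sym yz.
  - by rewrite adj_sym y'z.
apply: far; suff -> : X u :\: (X w :|: X w') = X u by [].
apply/setDidPl; rewrite disjoint_subset; apply/subsetP => x xu.
by rewrite inE inE negb_or (private w) ?(private w').
Qed.

End BowtieFree.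

Lemma bowtie_pollyanna : pollyanna (graph_free bowtie).
Proof.
apply: pollyanna_of_power_bound => F.
exists ((2 + F 2 + F 6) * F 2), 3 => G free HF S.
apply: (scolW (scol_bowtie_free S HF free) (subxx S)).
rewrite mulnAC leq_mul //; move: (F 2) (F 6) (om S) => f f' n.
rewrite !expnS expn0 muln1; nia.
Qed.

(** * Splittable sets in bull-free graphs *)

Lemma connect_invariant (V : finType) (r : rel V) (Q : pred V) x :
  Q x -> (forall a b, Q a -> r a b -> Q b) -> forall y, connect r x y -> Q y.
Proof.
move=> Qx Qr y /connectP[p + ->]; elim: p x Qx => [//|z p IHp] x Qx /= /andP[xz].
by apply: IHp; apply: Qr xz.
Qed.

Section Relation.
Variables (V : finType) (e : rel V).
Implicit Types (C P Q M T A B : {set V}) (a b c d f p q u v w x y z : V).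

(** This part is stated for a relation instead of a graph so that it also applies to the complement:
    being bull-free, unsplittable or prime is preserved by complementation. *)
Definition cpl : rel V := fun x y => (x != y) && ~~ e x y.

(* Triangle a b c, pendant d at a, pendant f at b; the adjacencies force the
   five vertices to be distinct. *)
Definition bullfree : Prop := forall a b c d f,
  e a b -> e b c -> e a c -> e a d -> e b f ->
  ~~ e d b -> ~~ e d c -> ~~ e f a -> ~~ e f c -> ~~ e d f -> False.

Definition splits C P : bool :=
  [&& P \subset C, P != set0, C :\: P != set0,
     [forall p in P, forall p' in P, forall q in C :\: P, e p p' ==> (e p q == e p' q)]
   & [forall q in C :\: P, forall q' in C :\: P, forall p in P,
        (q != q') && ~~ e q q' ==> (e q p == e q' p)]].

Definition unsplittable C : bool := (1 < #|C|) && [forall P, ~~ splits C P].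

Definition ismod T M : bool := (M \subset T) &&
  [forall x in M, forall y in M, forall z in T :\: M, e x z == e y z].

Definition prime_set T : bool :=
  [forall M, ismod T M ==> (#|M| <= 1) || (M == T)].

Lemma splitsP C P : reflect
  [/\ P \subset C, P != set0, C :\: P != set0,
      forall p p' q, p \in P -> p' \in P -> q \in C :\: P -> e p p' -> e p q = e p' q
    & forall q q' p, q \in C :\: P -> q' \in C :\: P -> p \in P ->
        q != q' -> ~~ e q q' -> e q p = e q' p] (splits C P).
Proof.
apply: (iffP and5P) => -[s1 s2 s3 s4 s5]; split=> //.
- move=> p p' q pP p'P qQ pp'.
  by move/forall_inP/(_ p pP)/forall_inP/(_ p' p'P)/forall_inP/(_ q qQ): s4; rewrite pp' => /eqP.
- move=> q q' p qQ q'Q pP n1 n2.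
  by move/forall_inP/(_ q qQ)/forall_inP/(_ q' q'Q)/forall_inP/(_ p pP): s5;
    rewrite n1 n2 => /eqP.
- apply/forall_inP => p pP; apply/forall_inP => p' p'P; apply/forall_inP => q qQ.
  by apply/implyP => pp'; apply/eqP; apply: s4.
- apply/forall_inP => q qQ; apply/forall_inP => q' q'Q; apply/forall_inP => p pP.
  by apply/implyP => /andP[n1 n2]; apply/eqP; apply: s5.
Qed.

Lemma unsplit_split C P : unsplittable C -> splits C P -> False.
Proof. by case/andP=> _ /forallP/(_ P)/negP. Qed.

Lemma ismodP T M : reflect
  (M \subset T /\ forall x y z, x \in M -> y \in M -> z \in T -> z \notin M -> e x z = e y z)
  (ismod T M).
Proof.
apply: (iffP andP) => -[s1 s2]; split=> //.
  move=> x y z xM yM zT zM.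
  move/forall_inP/(_ x xM)/forall_inP/(_ y yM)/forall_inP/(_ z): s2.
  by rewrite inE zM zT => /(_ isT)/eqP.
apply/forall_inP => x xM; apply/forall_inP => y yM; apply/forall_inP => z /setDP[zT zM].
by apply/eqP; apply: s2.
Qed.

Lemma prime_setP T M : prime_set T -> ismod T M -> 1 < #|M| -> M = T.
Proof. by move=> /forallP/(_ M)/implyP pT /pT/orP[|/eqP //]; rewrite leqNgt => /negbTE ->. Qed.

End Relation.

Section BullFreeRelation.
Variables (V : finType) (e : rel V).
Hypothesis esym : symmetric e.
Hypothesis eirr : irreflexive e.
Implicit Types (C P Q M T A B : {set V}) (a b c d f p q u v w x y z : V).

Lemma cpl_sym : symmetric (cpl e).
Proof. by move=> x y; rewrite /cpl eq_sym esym. Qed.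

Lemma cpl_irr : irreflexive (cpl e).
Proof. by move=> x; rewrite /cpl eqxx. Qed.

Lemma e_neq x y : e x y -> x != y.
Proof. by apply: contraTneq => ->; rewrite eirr. Qed.

Lemma cplN x y : x != y -> cpl e x y = ~~ e x y.
Proof. by rewrite /cpl => ->. Qed.

(** The bull is self-complementary: the pendants [d], [f] and the apex [c] become the triangle, with
    [b] pendant at [d] and [a] pendant at [f]. *)
Lemma bullfree_cpl : bullfree e -> bullfree (cpl e).
Proof.
move=> bf a b c d f ab bc ac ad bf' db dc fa fc df.
have N x y : x != y -> ~~ cpl e x y -> e x y by move=> xy; rewrite cplN // negbK.
have S x y : cpl e x y -> cpl e y x by rewrite cpl_sym.
have D x y : cpl e x y -> ~~ e x y by case/andP.
have d_b : d != b by apply: contraNneq dc => ->.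
have d_c : d != c by apply: contraNneq db => ->; apply: S.
have f_a : f != a by apply: contraNneq fc => ->.
have f_c : f != c by apply: contraNneq fa => ->; apply: S.
have d_f : d != f by apply: contraNneq fa => <-; apply: S.
apply: (bf d f c b a); first [exact: N|exact: D|by apply: D; apply: S].
Qed.

(** Complementation exchanges the two sides of a split. *)
Lemma splits_cpl C P : splits (cpl e) C P -> splits e C (C :\: P).
Proof.
case/splitsP => sP P0 Q0 s4 s5; rewrite setDE; apply/splitsP.
have QP : C :\: (C :&: ~: P) = P by apply/setP => x; rewrite !inE; move/subsetP/(_ x): sP;
  case: (x \in P) => [->|_] //; rewrite andbT andNb.
rewrite QP -setDE; split=> // [|p p' q pQ p'Q qP pp'|q q' p qP q'P pQ qq' n].
- exact: subsetDl.
- have pq : p != q by apply: contraTneq pQ => ->; rewrite !inE qP.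
  have p'q : p' != q by apply: contraTneq p'Q => ->; rewrite !inE qP.
  have npp' : ~~ cpl e p p' by rewrite /cpl pp' andbF.
  have := s5 p p' q pQ p'Q qP (e_neq pp') npp'; rewrite !cplN //.
  exact: negb_inj.
have qp : q != p by apply: contraTneq pQ => <-; rewrite !inE qP.
have q'p : q' != p by apply: contraTneq pQ => <-; rewrite !inE q'P.
have nqq' : cpl e q q' by rewrite cplN.
by have := s4 q q' p qP q'P pQ nqq'; rewrite !cplN //; apply: negb_inj.
Qed.

Lemma unsplittable_cpl C : unsplittable e C -> unsplittable (cpl e) C.
Proof.
case/andP => C1 /forallP nsp; rewrite /unsplittable C1; apply/forallP => P.
by apply: contra (nsp (C :\: P)); apply: splits_cpl.
Qed.

Lemma prime_set_cpl T : prime_set e T -> prime_set (cpl e) T.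
Proof.
move=> /forallP pT; apply/forallP => M; apply/implyP => /ismodP[sM mM].
apply: (implyP (pT M)); apply/ismodP; split=> // x y z xM yM zT zM.
have xz : x != z by apply: contraNneq zM => <-.
have yz : y != z by apply: contraNneq zM => <-.
by have := mM x y z xM yM zT zM; rewrite !cplN //; apply: negb_inj.
Qed.

Lemma splits_anticomplete C A : A \subset C -> A != set0 -> C :\: A != set0 ->
  {in A & C :\: A, forall x y, ~~ e x y} -> splits e C A.
Proof.
move=> sA A0 B0 AB; apply/splitsP; split=> // [p p' q pA p'A qB _|q q' p qB q'B pA _ _].
  by rewrite !(negPf (AB _ _ _ _)).
by rewrite !(esym _ p) !(negPf (AB _ _ _ _)).
Qed.

Lemma splits_complete C A : A \subset C -> A != set0 -> C :\: A != set0 ->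
  {in A & C :\: A, forall x y, e x y} -> splits e C A.
Proof.
move=> sA A0 B0 AB; apply/splitsP; split=> // [p p' q pA p'A qB _|q q' p qB q'B pA _ _].
  by rewrite !AB.
by rewrite !(esym _ p) !AB.
Qed.

Lemma unsplittable_nbr C c : unsplittable e C -> c \in C -> exists2 c', c' \in C & e c c'.
Proof.
move=> uC cC; have [/exists_inP[c' c'C cc']|nc] := boolP [exists c' in C, e c c'].
  by exists c'.
exfalso; apply: (unsplit_split uC (splits_anticomplete (A := [set c]) _ _ _ _)).
- by rewrite sub1set.
- by apply/set0Pn; exists c; rewrite inE.
- rewrite -card_gt0; case/andP: uC => C1 _; have := cardsD1 c C; rewrite cC; move: C1; clear; lia.
- move=> x y /set1P -> /setDP[yC _]; apply: contra nc => cy; apply/exists_inP; by exists y.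
Qed.

(** If [x] missed [w], the neighbours of [x] in [C] would split [C]: every violation of a splitting
    condition completes to a bull by [x] together with [w], [u] or both. *)
Lemma unsplittable_breaker C w u x : bullfree e -> unsplittable e C ->
  {in C, forall c, e w c} -> {in C, forall c, ~~ e u c} -> e w u ->
  (exists2 c, c \in C & e x c) -> (exists2 c, c \in C & ~~ e x c) -> e x w.
Proof.
move=> bf uC wC uC' wu [c1 c1C xc1] [c2 c2C xc2]; apply/negPn/negP => xw.
pose P := [set c in C | e x c]; apply: (unsplit_split (P := P) uC).
have PP p : p \in P -> (p \in C) * e x p by rewrite inE => /andP[].
have QQ q : q \in C :\: P -> (q \in C) * ~~ e x q.
  by rewrite !inE negb_and andbC => /andP[qC]; rewrite qC.
have two p p' q : p \in P -> p' \in P -> q \in C :\: P -> e p p' -> e p q -> e p' q.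
  move=> /PP[pC xp] /PP[p'C xp'] /QQ[qC xq] pp' pq; apply/negPn/negP => p'q.
  have [xu|xu] := boolP (e x u).
    by apply: (bf x p p' u q) => //; by [apply: uC'|rewrite esym].
  by apply: (bf w p q u x) => //; by [apply: wC|rewrite esym|apply: uC'|rewrite esym; apply: uC'].
have one q q' p : q \in C :\: P -> q' \in C :\: P -> p \in P -> ~~ e q q' -> e q p -> e q' p.
  move=> /QQ[qC xq] /QQ[q'C xq'] /PP[pC xp] qq' qp; apply/negPn/negP => q'p.
  by apply: (bf w p q q' x) => //; by [apply: wC|rewrite esym].
apply/splitsP; split.
- by apply/subsetP => c /PP[].
- by apply/set0Pn; exists c1; rewrite inE c1C.
- by apply/set0Pn; exists c2; rewrite !inE c2C andbT.
- by move=> p p' q pP p'P qQ pp'; apply/idP/idP; apply: two; rewrite // esym.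
- by move=> q q' p qQ q'Q pP _ qq'; apply/idP/idP; apply: one; rewrite // esym.
Qed.

End BullFreeRelation.

(** * Centers and anticenters of unsplittable sets *)

Section PrimeBullFree.
Variables (V : finType).
Implicit Types (e : rel V) (C P Q M T A B : {set V}).
Implicit Types (a b c d f p q u v w x y z : V).

Definition centers e T C := [set w in T | [forall c in C, e w c]].
Definition anticenters e T C := [set u in T :\: C | [forall c in C, ~~ e u c]].

(* The module is the component, containing C, of the set M of all vertices
   complete to the centers. A vertex z outside M and the centers is an
   anticenter that misses some center w; if z saw m' but not its neighbour m in
   the component, then m', m, w with z and a vertex of C would be a bull. *)
Lemma unsplittable_module e T C : symmetric e -> irreflexive e -> bullfree e ->
  C \subset T -> unsplittable e C ->
  centers e T C != set0 ->
  {in centers e T C, forall w, exists2 u, u \in anticenters e T C & e w u} ->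
  ~~ prime_set e T.
Proof.
move=> esym eirr bf sCT uC; set W := centers e T C; set U := anticenters e T C.
move=> /set0Pn[w0 w0W] WU; apply/negP => pT.
have WP w : w \in W -> w \in T /\ {in C, forall c, e w c}.
  by rewrite inE => /andP[wT /forall_inP].
have UP u : u \in U -> [/\ u \in T, u \notin C & {in C, forall c, ~~ e u c}].
  by rewrite !inE => /andP[/andP[uC' uT] /forall_inP].
have [c0 c0C] : exists c, c \in C.
  by apply/set0Pn; rewrite -card_gt0; case/andP: uC => /ltnW.
have break_W x w : w \in W -> (exists2 c, c \in C & e x c) ->
    (exists2 c, c \in C & ~~ e x c) -> e x w.
  move=> wW x1 x2; have [u uU wu] := WU w wW; have [_ wC] := WP w wW; have [_ _ uC'] := UP u uU.
  exact: (unsplittable_breaker esym bf uC wC uC' wu).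
(* This is [unsplittable_breaker] in the complement, where [z] becomes the center and [w] the
   anticenter. *)
have break_U x w z : w \in W -> z \in U -> ~~ e w z -> x \notin C ->
    (exists2 c, c \in C & e x c) -> (exists2 c, c \in C & ~~ e x c) -> ~~ e x z.
  move=> wW zU wz xC x1 [c2 c2C xc2]; have [_ wC] := WP w wW; have [_ zC zC'] := UP z zU.
  have : cpl e x z; last by case/andP.
  apply: (unsplittable_breaker (cpl_sym esym) (bullfree_cpl esym bf)
     (unsplittable_cpl eirr uC) (w := z) (u := w)).
  - move=> c cC; rewrite cplN ?zC' //; by apply: contraNneq zC => ->.
  - by move=> c cC; rewrite /cpl wC ?andbF.
  - rewrite (cpl_sym esym) cplN //; apply: contraNneq zC => zw.
    by have := zC' c0 c0C; rewrite -zw wC.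
  - by exists c2; rewrite // cplN //; apply: contraNneq xC => ->.
  - by case: x1 => c1 c1C xc1; exists c1; rewrite // /cpl xc1 andbF.
pose M := [set x in T | [forall w in W, e w x]].
have MP x : x \in M -> x \in T /\ {in W, forall w, e w x}.
  by rewrite inE => /andP[xT /forall_inP].
have CM c : c \in C -> c \in M.
  move=> cC; rewrite inE (subsetP sCT) //; apply/forall_inP => w wW.
  by have [_ ->] := WP w wW.
pose r := [rel x y | [&& x \in M, y \in M & e x y]].
pose M1 := [set x | connect r c0 x].
have M1M x : x \in M1 -> x \in M.
  rewrite inE; apply: connect_invariant; first exact: CM.
  by move=> a b _ /and3P[].
have M1r x y : x \in M1 -> y \in M -> e x y -> y \in M1.
  move=> xM1 yM xy; move: (xM1); rewrite !inE => c0x; apply: connect_trans c0x (connect1 _).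
  by rewrite /= M1M ?yM.
have sM1T : M1 \subset T by apply/subsetP => x /M1M/MP[].
have [c1 c1C c01] := unsplittable_nbr esym uC c0C.
have c0M1 : c0 \in M1 by rewrite inE.
have c1M1 : c1 \in M1 by apply: M1r c01 => //; apply: CM.
have : M1 = T; last first.
  move=> M1T; have [w0T w0C] := WP w0 w0W.
  have /M1M/MP[_ /(_ w0 w0W)] : w0 \in M1 by rewrite M1T.
  by rewrite eirr.
apply: (prime_setP pT); last by apply/card_gt1P; exists c0, c1; split=> //;
  apply: (e_neq eirr c01).
apply/ismodP; split=> // x y z xM1 yM1 zT zM1.
suff uni m : m \in M1 -> e m z = e c0 z by rewrite !uni.
move=> mM1; have [zW|zW] := boolP (z \in W).
  by have [_ mW] := MP _ (M1M _ mM1); have [_ cW] := MP _ (M1M _ c0M1);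
    rewrite !(esym _ z) mW ?cW.
have [zM|zM] := boolP (z \in M).
  have nm m' : m' \in M1 -> e m' z = false.
    by move=> m'M1; apply: contraNF zM1; apply: M1r.
  by rewrite !nm.
have zC : z \notin C by apply: contra zM; apply: CM.
have [w wW wz] : exists2 w, w \in W & ~~ e w z.
  by move: zM; rewrite inE zT /= negb_forall_in => /exists_inP.
have zU : z \in U.
  rewrite !inE zC zT; apply/forall_inP => c cC; apply/negP => zc.
  have [|] := boolP [forall c in C, e z c].
    by move=> zC'; move: zW; rewrite inE zT zC'.
  rewrite negb_forall_in => /exists_inP z2.
  have z1 : exists2 c, c \in C & e z c by exists c.
  by have := break_W z w wW z1 z2; rewrite esym (negPf wz).
have [_ _ zC'] := UP z zU; have [_ wC] := WP w wW.
suff nz m' : m' \in M1 -> (m' \in M) && ~~ e m' z.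
  by have /andP[_ /negPf ->] := nz m mM1; have /andP[_ /negPf ->] := nz c0 c0M1.
rewrite inE; apply: (connect_invariant (Q := fun m' => (m' \in M) && ~~ e m' z)) => [|a b
  /andP[aM az] /and3P[_ bM ab]].
  by rewrite CM // esym zC'.
rewrite bM; apply/negP => bz.
have bC : b \notin C by apply: contraL bz => bC; rewrite esym zC'.
have [aT aW] := MP a aM; have [bT bW] := MP b bM.
have bU : {in C, forall c, ~~ e b c}.
  move=> c cC; apply/negP => bc; have [|] := boolP [forall c in C, e b c].
    move=> bC'; have : b \in W by rewrite inE bT bC'.
    by move/bW; rewrite eirr.
  rewrite negb_forall_in => /exists_inP b2; have b1 : exists2 c, c \in C & e b c by exists c.
  by have := break_U b w z wW zU wz bC b1 b2; rewrite bz.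
have [c cC ac] : exists2 c, c \in C & ~~ e a c.
  case: (boolP [exists c in C, ~~ e a c]) => [/exists_inP //|].
  rewrite negb_exists_in => /forall_inP aC.
  have : a \in W by rewrite inE aT; apply/forall_inP => c /aC/negPn.
  by move/aW; rewrite eirr.
apply: (bf b w a z c) => //.
- by rewrite esym bW.
- by rewrite aW.
- by rewrite esym.
- by rewrite wC.
- by rewrite esym.
- by rewrite esym.
- by rewrite esym bU.
- by rewrite esym.
- by rewrite zC'.
Qed.

(** If every center sees some anticenter, [unsplittable_module] applies directly. Otherwise some
    center sees no anticenter; in the complement the anticenters are the centers, and all of them
    see this vertex, so the same lemma applies there. *)
Lemma prime_no_center_anticenter e T C w u : symmetric e -> irreflexive e -> bullfree e ->
  prime_set e T -> C \subset T -> unsplittable e C -> w \in T -> u \in T ->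
  {in C, forall c, e w c} -> {in C, forall c, ~~ e u c} -> False.
Proof.
move=> esym eirr bf pT sCT uC wT uT wC uC'.
have uNC : u \notin C.
  by apply/negP => /(unsplittable_nbr esym uC)[c cC]; rewrite (negPf (uC' c cC)).
have wNC : w \notin C by apply/negP => /wC; rewrite eirr.
have wW : w \in centers e T C by rewrite inE wT; apply/forall_inP.
have uU : u \in anticenters e T C by rewrite !inE uNC uT; apply/forall_inP.
have [allW|] := boolP [forall w in centers e T C, exists u in anticenters e T C, e w u].
  have W0 : centers e T C != set0 by apply/set0Pn; exists w.
  suff : ~~ prime_set e T by rewrite pT.
  apply: (unsplittable_module esym eirr bf sCT uC W0) => w' w'W.
  by move/forall_inP/(_ w' w'W)/exists_inP: allW.
rewrite negb_forall_in => /exists_inP[w' w'W]; rewrite negb_exists_in => /forall_inP w'U.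
have cW x : (x \in centers (cpl e) T C) = (x \in anticenters e T C).
  rewrite !inE; apply/idP/idP => [/andP[xT /forall_inP xC]|/andP[/andP[xC' xT] /forall_inP xC]].
    rewrite xT andbT; apply/andP; split; first by apply/negP => /xC; rewrite cpl_irr.
    by apply/forall_inP => c /xC/andP[].
  rewrite xT; apply/forall_inP => c cC; rewrite cplN ?xC //.
  by apply: contraNneq xC' => ->.
have cU : w' \in anticenters (cpl e) T C.
  move: w'W; rewrite !inE => /andP[-> /forall_inP w'C]; rewrite andbT; apply/andP; split.
    by apply/negP => /w'C; rewrite eirr.
  by apply/forall_inP => c /w'C w'c; rewrite /cpl w'c andbF.
have U0 : centers (cpl e) T C != set0 by apply/set0Pn; exists u; rewrite cW.
suff : ~~ prime_set (cpl e) T by rewrite prime_set_cpl.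
apply: (unsplittable_module (cpl_sym esym) (cpl_irr e) (bullfree_cpl esym bf) sCT
  (unsplittable_cpl eirr uC) U0).
move=> x; rewrite cW => xU; exists w' => //; rewrite (cpl_sym esym) cplN ?w'U //.
apply: contraTneq xU => <-; rewrite !inE; apply/negP => /andP[_ /forall_inP w'C].
case/andP: uC => /ltnW; rewrite card_gt0 => /set0Pn[c cC] _; have := w'C c cC.
by move: w'W; rewrite inE => /andP[_ /forall_inP ->].
Qed.

End PrimeBullFree.

(** * Neighbours versus non-neighbours of a vertex in a prime bull-free graph *)

Section LocalDichotomy.
Variables (V : finType).
Implicit Types (e : rel V) (C P Q M T A B : {set V}).
Implicit Types (a b c d f p q u v w x y z : V).

(** A split of the contraction pulls back along [phi]: all of [M] falls on one side, and vertices of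
    [M] agree on everything outside [M]. *)
Lemma unsplittable_contract e C M d : symmetric e -> unsplittable e C ->
  ismod e C M -> M != C -> d \in M -> unsplittable e (d |: (C :\: M)).
Proof.
move=> esym uC /ismodP[sM mM] MC dM; set C' := d |: _.
have dC : d \in C by apply: (subsetP sM).
pose phi x := if x \in M then d else x.
have phiC x : x \in C -> phi x \in C'.
  by rewrite /phi !inE; case: (boolP (x \in M)) => [_|xM] xC; rewrite ?eqxx ?(negPf xM) ?xC ?orbT.
have phiK x : x \in C' -> phi x = x.
  by rewrite /phi !inE => /orP[/eqP ->|/andP[/negPf ->]]; rewrite ?dM.
have sC' : C' \subset C by rewrite subUset sub1set dC subsetDl.
have phiE x y : x \in C -> y \in C -> ~~ ((x \in M) && (y \in M)) -> e (phi x) (phi y) = e x y.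
  rewrite /phi => xC yC; case: (boolP (x \in M)) => xM; case: (boolP (y \in M)) => yM //= _.
    exact: mM.
  by rewrite esym [RHS]esym; apply: mM.
apply/andP; split.
  have [x xC xM] : exists2 x, x \in C & x \notin M.
    by apply/subsetPn; apply: contra MC => sCM; rewrite eqEsubset sM.
  apply/card_gt1P; exists d, x; split; rewrite ?setU11 //; first by rewrite !inE xC xM orbT.
  by apply: contraNneq xM => <-.
apply/forallP => P; apply/negP => /splitsP[sP P0 Q0 s4 s5].
pose P' := [set x in C | phi x \in P].
apply: (unsplit_split (P := P') uC).
have P'P x : x \in P' -> (x \in C) * (phi x \in P) by rewrite inE => /andP[].
have Q'P x : x \in C :\: P' -> (x \in C) * (phi x \in C' :\: P) * (phi x \notin P).
  move=> /setDP[xC]; rewrite inE xC /= => xP.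
  by split=> //; split=> //; rewrite inE xP phiC.
have cross p q : p \in P' -> q \in C :\: P' -> e (phi p) (phi q) = e p q.
  move=> /P'P[pC pP] /Q'P[[qC _] qP]; apply: phiE => //; apply/negP => /andP[pM qM].
  by move: pP qP; rewrite /phi pM qM => ->.
apply/splitsP; split.
- by apply/subsetP => x /P'P[].
- case/set0Pn: P0 => x xP; apply/set0Pn; exists x; have xC' := subsetP sP x xP.
  by rewrite inE (subsetP sC') // phiK.
- case/set0Pn: Q0 => x /setDP[xC' xP]; apply/set0Pn; exists x.
  by rewrite !inE (subsetP sC') // phiK // (negPf xP).
- move=> p p' q pP p'P qQ pp'; have [pC pP'] := P'P p pP; have [p'C p'P'] := P'P p' p'P.
  have [/andP[pM p'M]|nM] := boolP ((p \in M) && (p' \in M)).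
    have [[qC _] qP] := Q'P q qQ; apply: mM => //.
    by apply: contra qP => qM; move: pP'; rewrite /phi pM qM.
  rewrite -(cross p q) // -(cross p' q) //; apply: s4 => //; first by have [[]] := Q'P q qQ.
  by rewrite phiE.
- move=> q q' p qQ q'Q pP qq' nqq'; have [[qC qQ'] qP] := Q'P q qQ;
  have [[q'C q'Q'] q'P] := Q'P q' q'Q.
  have [/andP[qM q'M]|nM] := boolP ((q \in M) && (q' \in M)).
    have [pC pP'] := P'P p pP; apply: mM => //.
    by apply: contraL pP' => pM; move: qP; rewrite /phi pM qM.
  rewrite (esym q) (esym q') -(cross p q) // -(cross p q') // (esym _ (phi q)) (esym _ (phi
    q')); apply: s5 => //; first by have [] := P'P p pP.
    apply: contraNneq nM; rewrite /phi; case: ifP => qM; case: ifP => q'M //.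
    - by move=> E; rewrite -E dM in q'M.
    - by move=> E; rewrite E dM in qM.
    - by move=> E; rewrite E eqxx in qq'.
  by rewrite phiE.
Qed.

Lemma unsplittable_prime_subset e C : symmetric e -> unsplittable e C ->
  exists C', [/\ C' \subset C, unsplittable e C' & prime_set e C'].
Proof.
move=> esym; move: {2}#|C| (leqnn #|C|) => m; elim: m C => [|m IHm] C Cm uC.
  by case/andP: uC; case: #|C| Cm.
have [pC|] := boolP (prime_set e C); first by exists C.
rewrite negb_forall => /existsP[M]; rewrite negb_imply negb_or -ltnNge => /and3P[mM M1 MC].
have [d dM] : exists d, d \in M by apply/set0Pn; rewrite -card_gt0 ltnW.
have /ismodP[sM _] := mM.
have [|C' [sC' uC' pC']] := IHm _ _ (unsplittable_contract esym uC mM MC dM).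
  have := cardsID M C; rewrite (setIidPr sM).
  by have := cardsU1 d (C :\: M); rewrite inE dM /=; move: Cm M1; clear; lia.
exists C'; split=> //; apply: subset_trans sC' _.
by rewrite subUset sub1set (subsetP sM) // subsetDl.
Qed.

(** A component of non-adjacency inside [Q] is a module of [C]: it is complete to the rest of [Q]
    and, by the hypothesis, uniform towards [C :\: Q]. Primeness reduces it to a single vertex. *)
Lemma prime_clique e C Q : symmetric e -> prime_set e C -> Q \subset C -> Q != C ->
  (forall q q' p, q \in Q -> q' \in Q -> p \in C :\: Q -> q != q' -> ~~ e q q' ->
    e q p = e q' p) ->
  {in Q &, forall q q', q != q' -> e q q'}.
Proof.
move=> esym pC sQ QC uni q q' qQ q'Q qq'; apply/negPn/negP => nqq'.
pose r := [rel a b | [&& a \in Q, b \in Q, a != b & ~~ e a b]].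
pose D := [set y | connect r q y].
have DQ y : y \in D -> y \in Q.
  by rewrite inE; apply: connect_invariant => // a b _ /and4P[].
have qD : q \in D by rewrite inE.
have q'D : q' \in D by rewrite inE; apply: connect1; rewrite /= qQ q'Q qq' nqq'.
have DC : D = C.
  apply: (prime_setP pC); last by apply/card_gt1P; exists q, q'.
  apply/ismodP; split=> [|x y z xD yD zC zD]; first by apply/subsetP => y /DQ/(subsetP sQ).
  suff to_q m : m \in D -> e m z = e q z by rewrite !to_q.
  move=> mD; have [zQ|zQ] := boolP (z \in Q).
    have adjz k : k \in D -> e k z.
      move=> kD; apply: contraNT (zD) => nkz; move: (kD); rewrite !inE => /connect_trans; apply.
      apply: connect1; rewrite /= (DQ k kD) zQ nkz andbT /=.
      by apply: contraNneq nkz => E; move: zD; rewrite -E kD.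
    by rewrite !adjz.
  move: mD; rewrite inE => qm; apply/eqP.
  apply: (connect_invariant (Q := fun m => e m z == e q z) _ _ qm) => // a b /eqP <-.
  case/and4P=> aQ bQ ab nab; rewrite eq_sym; apply/eqP.
  by apply: uni => //; rewrite inE zQ zC.
by move/negP: QC; apply; rewrite eqEsubset sQ -DC; apply/subsetP.
Qed.

Lemma prime_bullfree_local e T v C1 C2 : symmetric e -> irreflexive e -> bullfree e ->
  prime_set e T -> v \in T -> C1 \subset T -> C2 \subset T ->
  {in C1, forall x, e v x} -> {in C2, forall x, ~~ e v x} ->
  unsplittable e C1 -> unsplittable e C2 -> False.
Proof.
move=> esym eirr bf pT vT sC1 sC2 vC1 vC2 uC1 uC2.
have [C1' [sC1' uC1' pC1]] := unsplittable_prime_subset esym uC1.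
have [C2' [sC2' uC2' pC2]] := unsplittable_prime_subset esym uC2.
have {}vC1 : {in C1', forall x, e v x} by move=> x /(subsetP sC1')/vC1.
have {}vC2 : {in C2', forall x, ~~ e v x} by move=> x /(subsetP sC2')/vC2.
have {sC1 sC1'} sC1 := subset_trans sC1' sC1; have {sC2 sC2'} sC2 := subset_trans sC2' sC2.
move: C1' C2' uC1' uC2' pC1 pC2 vC1 vC2 sC1 sC2 => {uC1 uC2} {}C1 {}C2 uC1 uC2 pC1 pC2 vC1 vC2
  sC1 sC2.
(* As [v] is a center of [C1] and an anticenter of [C2], no vertex of [C2] is an anticenter of [C1],
   and no vertex of [C1] is a center of [C2]. *)
have h1 x : x \in C2 -> exists2 c, c \in C1 & e x c.
  move=> xC2; have [/exists_inP //|] := boolP [exists c in C1, e x c].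
  rewrite negb_exists_in => /forall_inP xC1; exfalso.
  exact: (prime_no_center_anticenter esym eirr bf pT sC1 uC1 vT (subsetP sC2 x xC2) vC1 xC1).
have h2 y : y \in C1 -> exists2 c, c \in C2 & ~~ e y c.
  move=> yC1; have [yC2|] := boolP [forall c in C2, e y c].
    exfalso; apply: (prime_no_center_anticenter esym eirr bf pT sC2 uC2 (subsetP sC1 y yC1) vT
      _ vC2).
    exact/forall_inP.
  by rewrite negb_forall_in => /exists_inP.
(* The non-neighbours in [C1] of a vertex of [C2] form a clique; [Q2] is the complementary
   statement, with the roles of [C1] and [C2] exchanged. *)
have Q1 x f f' : x \in C2 -> f \in C1 -> f' \in C1 -> f != f' -> ~~ e x f -> ~~ e x f' -> e f f'.
  move=> xC2 fC1 f'C1 ff' xf xf'.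
  apply: (@prime_clique e C1 [set q in C1 | ~~ e x q]) => //; rewrite ?inE ?fC1 ?f'C1 //.
  - by apply/subsetP => q; rewrite inE => /andP[].
  - have [c cC1 xc] := h1 x xC2; apply: contraTneq cC1 => <-; by rewrite inE xc andbF.
  move=> q q' p; rewrite !inE negb_and negbK => /andP[qC xq] /andP[q'C xq'] /andP[xp pC].
  rewrite pC /= in xp.
  have half k k' : k \in C1 -> k' \in C1 -> ~~ e x k -> ~~ e x k' -> ~~ e k k' -> e k p -> e k' p.
    move=> kC k'C xk xk' kk' kp; apply/negPn/negP => k'p.
    apply: (bf v p k k' x) => //; by [apply: vC1|rewrite esym|rewrite esym; apply: vC2].
  by move=> _ qq'; apply/idP/idP; apply: half => //; rewrite esym.
have Q2 y x x' : y \in C1 -> x \in C2 -> x' \in C2 -> e y x -> e y x' -> ~~ e x x'.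
  move=> yC1 xC2 x'C2 yx yx'; have [->|xx'] := eqVneq x x'; first by rewrite eirr.
  have ysplit k : k \in C2 -> y != k by move=> kC2; apply: contraTneq (vC1 y yC1) => ->;
    apply: vC2.
  have : cpl e x x'; last by case/andP.
  apply: (@prime_clique (cpl e) C2 [set q in C2 | e y q]); rewrite ?inE ?xC2 ?x'C2 //.
  - exact: cpl_sym.
  - exact: prime_set_cpl.
  - by apply/subsetP => q; rewrite inE => /andP[].
  - have [c cC2 yc] := h2 y yC1; apply: contraTneq cC2 => <-; by rewrite inE (negPf yc) andbF.
  move=> q q' p; rewrite !inE negb_and => /andP[qC yq] /andP[q'C yq'] /andP[yp pC].
  rewrite pC /= in yp; move=> qq'; rewrite cplN // negbK => eqq'.
  have qp : q != p by apply: contraNneq yp => <-.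
  have q'p : q' != p by apply: contraNneq yp => <-.
  rewrite !cplN //; congr (~~ _).
  have half k k' : k \in C2 -> k' \in C2 -> e y k -> e y k' -> e k k' -> e k p -> e k' p.
    move=> kC k'C yk yk' kk' kp; apply/negPn/negP => k'p.
    apply: (bf y k k' v p) => //; by [apply: vC2|rewrite esym; apply: vC1|rewrite esym].
  by apply/idP/idP; apply: half => //; rewrite esym.
(* By [Q2], a neighbour [x'] of [x] in [C2] misses every neighbour of [x] in [C1], so [Q1] for [x']
   applies to them. *)
have Pclique x f f' : x \in C2 -> f \in C1 -> f' \in C1 -> f != f' -> e x f -> e x f' -> e f f'.
  move=> xC2 fC1 f'C1 ff' xf xf'; have [x' x'C2 xx'] := unsplittable_nbr esym uC2 xC2.
  by apply: (Q1 x') => //; apply: contraL xx' => x'f; [apply: (Q2 f)|apply: (Q2 f')];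
    rewrite // esym.
have flip x f f' : x \in C2 -> f \in C1 -> f' \in C1 -> f != f' -> ~~ e f f' -> e x f' = ~~ e x f.
  move=> xC2 fC1 f'C1 ff' nff'; have [xf|xf] := boolP (e x f).
    by apply: contraNF nff'; apply: (Pclique x).
  by apply: contraNT nff'; apply: (Q1 x).
(* By [flip] every vertex of [C2] separates each non-adjacent pair of [C1], so agreement of [x1] and
   [x2] spreads along non-edges, and these connect the unsplittable set [C1]. Hence only two traces
   on [C1] occur, complementary to each other. *)
have same x1 x2 f : x1 \in C2 -> x2 \in C2 -> f \in C1 -> e x1 f = e x2 f ->
    {in C1, forall f', e x1 f' = e x2 f'}.
  move=> x1C x2C fC ef f' f'C; apply/eqP/negPn/negP => nf'.
  pose A := [set g in C1 | e x1 g == e x2 g].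
  apply: (unsplit_split uC1 (splits_complete esym (A := A) _ _ _ _)).
  - by apply/subsetP => g; rewrite inE => /andP[].
  - by apply/set0Pn; exists f; rewrite inE fC ef eqxx.
  - by apply/set0Pn; exists f'; rewrite !inE f'C nf'.
  move=> g g'; rewrite !inE => /andP[gC /eqP eg] /andP[ng' g'C].
  rewrite g'C /= in ng'; apply: contraNT (ng') => ngg'.
  have gg' : g != g' by apply: contraNneq ng' => <-; rewrite eg.
  by rewrite (flip x1 g g') // (flip x2 g g') // eg.
have [x0 x0C2] : exists x, x \in C2.
  by apply/set0Pn; rewrite -card_gt0; case/andP: uC2 => /ltnW.
have [u0 u0C2 x0u0] := unsplittable_nbr esym uC2 x0C2.
have [f0 f0C1 x0f0] := h1 x0 x0C2; have [g0 g0C1 u0g0] := h1 u0 u0C2.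
have x0g0 : ~~ e x0 g0.
  by apply: contraL x0u0 => x0g0; apply: (Q2 g0); rewrite // esym.
have [f [g [fC1 gC1 x0f x0g fg]]] :
    exists f g, [/\ f \in C1, g \in C1, e x0 f, ~~ e x0 g & e f g].
  pose P := [set f in C1 | e x0 f].
  have [/exists_inP[f fP /exists_inP[g gQ fg]]|no] := boolP [exists f in P, exists g in C1 :\:
    P, e f g].
    exists f, g; move: fP gQ; rewrite !inE => /andP[fC xf] /andP[+ gC].
    by rewrite gC /= => xg; split.
  exfalso; apply: (unsplit_split uC1 (splits_anticomplete esym (A := P) _ _ _ _)).
  - by apply/subsetP => f; rewrite inE => /andP[].
  - by apply/set0Pn; exists f0; rewrite inE f0C1.
  - by apply/set0Pn; exists g0; rewrite !inE g0C1 andbT.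
  move=> f g fP gQ; apply: contra no => fg; apply/exists_inP; exists f => //.
  by apply/exists_inP; exists g.
(* Members of [A] see [f] but not [g], and the others see [g] but not [f]. A non-adjacent pair
   across would be the pendants of a bull on the triangle [f g v], so [C2] is a join, which
   splits. *)
pose A := [set x in C2 | e x f].
apply: (unsplit_split uC2 (splits_complete esym (A := A) _ _ _ _)).
- by apply/subsetP => x; rewrite inE => /andP[].
- by apply/set0Pn; exists x0; rewrite inE x0C2.
- apply/set0Pn; exists u0; rewrite !inE u0C2 andbT /=.
  by apply: contraL x0u0 => u0f; apply: (Q2 f); rewrite // esym.
move=> a b; rewrite !inE => /andP[aC af] /andP[+ bC]; rewrite bC /= => bf'.
have ag : ~~ e a g by rewrite (same a x0 f aC x0C2 fC1 _ g gC1) // af x0f.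
have bg : e b g.
  apply: contraNT bf' => nbg.
  by rewrite (same b x0 g bC x0C2 gC1 _ f fC1) // (negPf nbg) (negPf x0g).
apply/negPn/negP => nab; apply: (bf f g v a b) => //.
- by rewrite esym vC1.
- by rewrite esym vC1.
- by rewrite esym.
- by rewrite esym.
- by rewrite esym vC2.
- by rewrite esym vC2.
Qed.

End LocalDichotomy.

(** * Colouring totally splittable sets *)

Section TotallySplittable.
Variable G : sgraph.
Implicit Types (x y p q : G) (A J K P Q S X Y : {set G}).

Lemma om_le_card S : om S <= #|S|.
Proof. by apply/om_leP => K sK _; apply: subset_leq_card. Qed.

(** One colouring has to be economical on all joined subsets simultaneously. Splitting [Q] along
    joins achieves this; without a proper join, [J] is empty or all of [Q]. Colours are vertices of
    [Q], so the factors of a join get disjoint palettes. *)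
Lemma scol_join_coloring Q : (forall Y, Y \subset Q -> scol Y (om Y)) ->
  exists c : G -> G, [/\ {in Q, forall x, c x \in Q},
    {in Q &, forall x y, adj x y -> c x != c y} &
    forall J, J \subset Q -> {in J & Q :\: J, forall x y, adj x y} -> #|c @: J| <= om J].
Proof.
move: {2}#|Q| (leqnn #|Q|) => m; elim: m Q => [|m IHm] Q.
  rewrite leqn0 cards_eq0 => /eqP -> _; exists id; split=> // [x y|J]; first by rewrite inE.
  by rewrite subset0 => /eqP -> _; rewrite imset0 cards0.
move=> Qm perfQ.
pose joined A := [&& A \subset Q, A != set0, A != Q & [forall x in A, forall y in Q :\: A, adj
  x y]].
have [/existsP[A /and4P[sA A0 AQ /forall_inP AP]]|noA] := boolP [exists A, joined A].
  have {}AP : {in A & Q :\: A, forall x y, adj x y} by move=> x y /AP/forall_inP; apply.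
  have AltQ : #|A| < #|Q| by apply: proper_card; rewrite properEneq AQ.
  have A_gt0 : 0 < #|A| by rewrite card_gt0.
  have DltQ : #|Q :\: A| < #|Q| by rewrite cardsD (setIidPr sA); move: A_gt0 AltQ; clear; lia.
  have sD : Q :\: A \subset Q by apply: subsetDl.
  have [||c1 [c1A p1 J1]] := IHm A.
  - by move: AltQ Qm; clear; lia.
  - by move=> Y sY; apply: perfQ; apply: subset_trans sA.
  have [||c2 [c2A p2 J2]] := IHm (Q :\: A).
  - by move: DltQ Qm; clear; lia.
  - by move=> Y sY; apply: perfQ; apply: subset_trans sD.
  pose c x := if x \in A then c1 x else c2 x.
  have cA x : x \in A -> c x = c1 x by rewrite /c => ->.
  have cD x : x \notin A -> c x = c2 x by rewrite /c => /negPf ->.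
  have dA x : x \in Q -> x \notin A -> x \in Q :\: A by move=> xQ xA; rewrite inE xA.
  have c2D x : x \in Q -> x \notin A -> c2 x \in Q :\: A by move=> xQ xA; apply/c2A/dA.
  exists c; split.
  - move=> x xQ; have [xA|xA] := boolP (x \in A); first by rewrite cA // (subsetP sA) // c1A.
    by rewrite cD // (subsetP sD) // c2D.
  - move=> x y xQ yQ xy.
    have [xA|xA] := boolP (x \in A); have [yA|yA] := boolP (y \in A).
    + by rewrite !cA // p1.
    + rewrite cA // cD //; apply: contraTneq (c1A x xA) => ->.
      by case/setDP: (c2D y yQ yA).
    + rewrite cD // cA //; apply: contraTneq (c1A y yA) => <-.
      by case/setDP: (c2D x xQ xA).
    + by rewrite !cD // p2 // dA.
  - move=> J sJ JP.
    have -> : c @: J = c1 @: (J :&: A) :|: c2 @: (J :\: A).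
      rewrite -[J in LHS](setID J A) imsetU; congr (_ :|: _); apply: eq_in_imset => x.
        by case/setIP => _ /cA.
      by case/setDP => _ /cD.
    apply: leq_trans (leq_card_setU _ _) _.
    apply: leq_trans (leq_add (J1 (J :&: A) _ _) (J2 (J :\: A) _ _)) _.
    + exact: subsetIr.
    + move=> x y /setIP[xJ xA] /setDP[yA]; rewrite inE yA andbT => yJ.
      by apply: JP => //; rewrite inE yJ (subsetP sA).
    + exact: setSD.
    + move=> x y /setDP[xJ xA] /setDP[/setDP[yQ yA]]; rewrite inE yA => yJ.
      by apply: JP => //; rewrite inE yQ andbT.
    apply: om_join; [exact: subsetIl|exact: subsetDl|].
    move=> x y /setIP[xJ xA] /setDP[yJ yA]; apply: AP => //.
    by apply: dA => //; apply: (subsetP sJ).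
have [A0 sA0 cA0] := subset_of_card (om_le_card Q).
have [->|[x0 _]] := set_0Vmem Q.
  exists id; split=> // [x y|J]; first by rewrite inE.
  by rewrite subset0 => /eqP -> _; rewrite imset0 cards0.
have [|c cQ pQ] := scol_to (A := A0) x0 (perfQ Q (subxx Q)); first by rewrite cA0.
exists c; split=> // [x xQ|J sJ JP]; first by rewrite (subsetP sA0) // cQ.
have [->|J0] := eqVneq J set0; first by rewrite imset0 cards0.
have -> : J = Q.
  apply/eqP; apply: contraNT noA => JQ; apply/existsP; exists J; rewrite /joined sJ J0 JQ /=.
  by apply/forall_inP => x xJ; apply/forall_inP => y yJ; apply: JP.
by rewrite -cA0; apply: subset_leq_card; apply/subsetP => _ /imsetP[x xQ ->]; apply: cQ.
Qed.

Lemma superset_of_card A Y n : A \subset Y -> #|A| <= n <= #|Y| ->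
  exists2 B : {set G}, A \subset B & #|B| = n.
Proof.
move=> sA /andP[An nY]; have [|B sB cB] := @subset_of_card _ (Y :\: A) (n - #|A|).
  by rewrite cardsD (setIidPr sA); apply: leq_sub2r.
exists (A :|: B); first exact: subsetUl.
rewrite cardsU cB; have -> : A :&: B = set0.
  by apply/setP => x; rewrite !inE; apply/negP => /andP[xA /(subsetP sB)]; rewrite inE xA.
by rewrite cards0; lia.
Qed.

(** Let [J] be the neighbourhood in [Q] of a vertex of [P]. Non-adjacent vertices of [Q] agree on
    it, so [J] is joined to [Q :\: J] and the colouring above spends at most [om J] colours on it.
    The vertices of [P] with neighbourhood [J] are complete to [J], so the remaining colours suffice
    for them; different such classes are not adjacent. *)
Lemma scol_totally_splittable X :
  (forall C : {set G}, C \subset X -> ~~ unsplittable (@adj G) C) -> scol X (om X).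
Proof.
move: {2}#|X| (leqnn #|X|) => m; elim: m X => [|m IHm] X.
  by rewrite leqn0 cards_eq0 => /eqP -> _; apply: scol0.
move=> Xm noC; have [X1|X1] := leqP #|X| 1.
  apply: (scolW (scol_card X) (subxx X)); apply: om_max => //; apply/cliqueP => x y xX yX xy.
  have : 1 < #|X| by apply/card_gt1P; exists x, y.
  by rewrite ltnNge X1.
have := noC X (subxx X); rewrite /unsplittable X1 /= negb_forall => /existsP[P].
rewrite negbK => /splitsP[sP P0 Q0 s4 s5]; set Q := X :\: P in Q0 s4 s5.
have P_gt0 : 0 < #|P| by rewrite card_gt0.
have Q_gt0 : 0 < #|Q| by rewrite card_gt0.
have cPQ : #|P| + #|Q| = #|X| by rewrite -(cardsID P X) (setIidPr sP).
have sQ : Q \subset X by apply: subsetDl.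
have perf Y : Y \subset X -> #|Y| < #|X| -> scol Y (om Y).
  move=> sY YX; apply: IHm => [|C sC]; first by move: YX Xm; clear; lia.
  by apply: noC; apply: subset_trans sY.
have perfQ Y : Y \subset Q -> scol Y (om Y).
  move=> sY; apply: perf; first exact: subset_trans sQ.
  by apply: leq_ltn_trans (subset_leq_card sY) _; move: cPQ P_gt0; clear; lia.
have [c [cQ pQ cJ]] := scol_join_coloring perfQ.
have [||A sA cA] := @superset_of_card (c @: Q) X (om X).
- by apply: subset_trans sQ; apply/subsetP => _ /imsetP[x xQ ->]; apply: cQ.
- rewrite om_le_card andbT; apply: leq_trans (omS sQ); apply: cJ => // x y _.
  by rewrite setDv inE.
have [x0 _] : exists x, x \in P by apply/set0Pn.
pose NQ p := [set q in Q | adj q p].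
have : forall J, exists d : G -> G,
    {in [set p in P | NQ p == J], forall p, d p \in A :\: c @: J} /\
    {in [set p in P | NQ p == J] &, forall p p', adj p p' -> d p != d p'}.
  move=> J; set PJ := [set p in P | _].
  have [->|[p0 p0P]] := set_0Vmem PJ; first by exists id; split=> x; rewrite inE.
  have sPJ : PJ \subset P by apply/subsetP => p; rewrite inE => /andP[].
  have PJX : PJ \subset X := subset_trans sPJ sP.
  have PJs : #|PJ| < #|X|.
    by apply: leq_ltn_trans (subset_leq_card sPJ) _; move: cPQ Q_gt0; clear; lia.
  move: (p0P); rewrite inE => /andP[p0P' /eqP NJ].
  have sJ : J \subset Q by rewrite -NJ; apply/subsetP => q; rewrite inE => /andP[].
  have JE q : (q \in J) = (q \in Q) && adj q p0 by rewrite -NJ inE.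
  have le_c : #|c @: J| <= om J.
    apply: cJ => // q q'; rewrite JE => /andP[qQ qp] /setDP[q'Q]; rewrite JE q'Q /= => q'p.
    apply: contraNT (q'p) => nqq'; rewrite -(s5 q q' p0) //.
    by apply: contraNneq q'p => <-.
  have le_om : om PJ + om J <= om X.
    apply: om_join => //; first exact: subset_trans sQ.
    move=> p q; rewrite inE => /andP[_ /eqP <-]; rewrite inE => /andP[_].
    by rewrite adj_sym.
  have [|d d1 d2] := scol_to (A := A :\: c @: J) x0 (perf PJ PJX PJs); last by exists d.
  have := subset_leq_card (subsetIr A (c @: J)); rewrite cardsD cA.
  by move: le_c le_om; clear; lia.
case/fin_all_exists => d dP.
have inP p : p \in P -> p \in [set p' in P | NQ p' == NQ p] by rewrite inE eqxx andbT.
have dA p : p \in P -> d (NQ p) p \in A :\: c @: NQ p.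
  by move=> /inP pP; have [+ _] := dP (NQ p); apply.
have QX x : x \in X -> x \notin P -> x \in Q by move=> xX xP; rewrite inE xP.
have cross p q : p \in P -> q \in Q -> adj p q -> d (NQ p) p != c q.
  move=> pP qQ pq; have /setDP[_] := dA p pP; apply: contraNneq => ->.
  by apply: imset_f; rewrite inE qQ adj_sym.
rewrite -cA; apply: (@scol_from _ _ _ _ (fun x => if x \in P then d (NQ x) x else c x)).
  move=> x xX; have [xP|xP] := boolP (x \in P); first by case/setDP: (dA x xP).
  by apply: (subsetP sA); apply: imset_f; apply: QX.
move=> x y xX yX xy; have [xP|xP] := boolP (x \in P); have [yP|yP] := boolP (y \in P).
- have NE : NQ x = NQ y.
    apply/setP => q; rewrite !inE; case: (boolP (q \in Q)) => qQ; last first.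
      by rewrite inE in qQ; rewrite (negPf qQ).
    by rewrite !(adj_sym q) (s4 x y q).
  by have [_] := dP (NQ x); rewrite -NE; apply=> //; rewrite inE ?xP ?yP ?NE eqxx.
- by apply: cross => //; apply: QX.
- by rewrite eq_sym cross ?QX // adj_sym.
- by apply: pQ => //; apply: QX.
Qed.

End TotallySplittable.

(** * Layers of bull-free graphs *)

Section RedGraph.
Variables (G : sgraph) (L Par : {set G}).
Implicit Types (a b d u w x y z : G) (K U : {set G}).

(** If a colouring is proper on these edges, no two vertices of a monochromatic triangle have a
    common parent. *)
Definition red a b : bool :=
  [&& a \in L, b \in L, adj a b & [exists w in Par, adj w a && adj w b]].

Lemma red_sym : symmetric red.
Proof.
move=> a b; rewrite /red adj_sym andbCA; congr [&& _, _, _ & _].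
by apply: eq_existsb => w; rewrite [adj w a && _]andbC.
Qed.

Lemma red_irrefl : irreflexive red.
Proof. by move=> a; rewrite /red adj_irrefl !andbF. Qed.

Definition red_graph : sgraph := SGraph red_sym red_irrefl.

Hypothesis bf : bullfree (@adj G).
Hypothesis par : forall w, w \in Par -> exists2 u, adj w u & {in L, forall a, ~~ adj u a}.

Definition comp_rel w : rel G :=
  fun a b => [&& a \in L, b \in L, adj w a, adj w b & adj a b].

Definition comp w a : {set G} := [set b | connect (comp_rel w) a b].

Lemma comp_rel_sym w : connect_sym (comp_rel w).
Proof.
apply: sym_connect_sym => a b; rewrite /comp_rel (adj_sym a).
by rewrite andbCA; congr [&& _, _ & _]; rewrite andbCA.
Qed.

Lemma comp_sub w a b : a \in L -> adj w a -> b \in comp w a -> (b \in L) && adj w b.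
Proof.
move=> aL wa; rewrite inE; apply: (connect_invariant (Q := fun b => (b \in L) && adj w b)).
  by rewrite aL.
by move=> x y _ /and5P[_ -> _ ->].
Qed.

Lemma comp_eq w a b : b \in comp w a -> comp w b = comp w a.
Proof.
rewrite inE => ab; apply/setP => z; rewrite !inE; apply/idP/idP; apply: connect_trans => //.
by rewrite comp_rel_sym.
Qed.

(** A vertex [x] that misses [w] and separates an edge [y z] of the component gives a bull: the
    triangle [w y z], with [u] at [w] and [x] at [y]. *)
Lemma comp_module w a b x : w \in Par -> a \in L -> adj w a -> b \in comp w a ->
  x \in L -> x \notin comp w a -> adj x b = adj x a.
Proof.
move=> wP aL wa ab xL xC; have [xw|xw] := boolP (adj w x).
  have nx z : z \in comp w a -> adj x z = false.
    move=> zC; apply: contraNF xC => xz; move: (zC); rewrite !inE => /connect_trans; apply.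
    apply: connect1; have /andP[zL wz] := comp_sub aL wa zC.
    by rewrite /comp_rel zL xL wz xw adj_sym.
  by rewrite !nx // inE.
have [u wu uL] := par wP.
have half y z : comp_rel w y z -> adj x y -> adj x z.
  case/and5P => yL zL wy wz yz xy; apply/negPn/negP => xz.
  apply: (bf wy yz wz wu (_ : adj y x)); rewrite ?uL //; first by rewrite adj_sym.
  by rewrite adj_sym.
move: ab; rewrite inE => ab; apply/eqP.
apply: (connect_invariant (Q := fun b => adj x b == adj x a) _ _ ab) => // y z /eqP <- yz.
apply/eqP; apply/idP/idP; apply: half => //.
by move: yz; rewrite /comp_rel (adj_sym y) => /and5P[-> -> -> -> ->].
Qed.

(** Connectivity gives a vertex of the first component outside the second and adjacent to [d]. The
    second component is a module, so this vertex sees [d']; the first one is too, so all of it sees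
    [d']. *)
Lemma comp_overlap w w' a d d' : w \in Par -> w' \in Par -> a \in L -> adj w a ->
  d \in comp w a -> adj w' d -> d' \in comp w' d -> d' \notin comp w a ->
  ~~ (comp w a \subset comp w' d) -> {in comp w a, forall b, adj d' b}.
Proof.
move=> wP w'P aL wa da w'd d'd d'a /subsetPn[y ya yd].
have /andP[dL wd] := comp_sub aL wa da.
have /andP[d'L w'd'] := comp_sub dL w'd d'd.
have [y' [y'a y'd y'd']] : exists y', [/\ y' \in comp w a, y' \notin comp w' d & adj y' d].
  have [/exists_inP[y' y'a /andP[y'd ady]]|no] :=
      boolP [exists y' in comp w a, (y' \notin comp w' d) && adj y' d]; first by exists y'.
  exfalso; move/negP: yd; apply.
  move: ya; rewrite -(comp_eq da) => ya; rewrite inE in ya.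
  suff : (y \in comp w a) && (y \in comp w' d) by case/andP.
  apply: (connect_invariant (Q := fun z => (z \in comp w a) && (z \in comp w' d)) _ _ ya).
    by rewrite da inE connect0.
  move=> p q /andP[pa pd] /and5P[pL qL wp wq pq]; apply/andP; split.
    by rewrite -(comp_eq pa) inE; apply: connect1; apply/and5P.
  have qa : q \in comp w a by rewrite -(comp_eq pa) inE; apply: connect1; apply/and5P.
  apply: contraNT no => qd; apply/exists_inP; exists q => //; rewrite qd /=.
  by rewrite -(comp_module w'P dL w'd pd) // adj_sym.
have /andP[y'L _] := comp_sub aL wa y'a.
have y'd'' : adj y' d' by rewrite (comp_module w'P dL w'd d'd).
move=> b ba; rewrite (comp_module wP aL wa ba) //.
by rewrite -(comp_module wP aL wa y'a) // adj_sym.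
Qed.

Hypothesis parL : {in L, forall a, exists2 w, w \in Par & adj w a}.

Lemma max_comp a : exists w, a \in L -> [/\ w \in Par, adj w a &
  forall w', w' \in Par -> adj w' a -> #|comp w' a| <= #|comp w a|].
Proof.
have [aL|aL] := boolP (a \in L); last by exists a.
have [w0 w0P w0a] := parL aL.
have P0 : (w0 \in Par) && adj w0 a by rewrite w0P.
exists [arg max_(w > w0 | (w \in Par) && adj w a) #|comp w a|] => _.
case: arg_maxnP => // w /andP[wP wa] wmax; split=> // w' w'P w'a.
by apply: wmax; rewrite w'P.
Qed.

(** A vertex red-connected to [a] lies in [C a], a largest component through [a], or is complete to
    it. Hence each vertex of a red component outside a maximum clique of that component misses some
    [q] in the clique and lies in [C q], which is contained in one neighbourhood. *)
Lemma scol_red k : (forall w, w \in Par -> scol [set a in L | adj w a] k) ->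
  @scol red_graph L (om L * k).
Proof.
move=> colN.
have /fin_all_exists[W WP] := max_comp.
pose C a := comp (W a) a.
have CC a : a \in C a by rewrite inE connect0.
have complete a d : a \in L -> connect red a d -> (d \in C a) || [forall b in C a, adj d b].
  move=> aL ad; have [wP wa wmax] := WP a aL.
  suff : (d \in L) && ((d \in C a) || [forall b in C a, adj d b]) by case/andP.
  apply: (connect_invariant
    (Q := fun d => (d \in L) && ((d \in C a) || [forall b in C a, adj d b])) _ _ ad).
    by rewrite aL CC.
  move=> p q /andP[pL pC] /and4P[_ qL pq /exists_inP[w' w'P /andP[w'p w'q]]].
  rewrite qL /=; have [//|qC] := boolP (q \in C a).
  have qp : q \in comp w' p by rewrite inE; apply: connect1; apply/and5P.
  have over d' : d' \in C a -> d' \in comp w' p -> {in C a, forall b, adj q b}.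
    move=> d'a d'p; have /andP[d'L _] := comp_sub pL w'p d'p.
    have /andP[_ w'd'] := comp_sub pL w'p d'p.
    have Ed' := comp_eq d'p.
    apply: (comp_overlap wP w'P aL wa d'a w'd'); rewrite ?Ed' //.
    (* Maximality of [C a] enters here: a component containing [C a] is equal to it. *)
    apply/negP => sub; have ap : a \in comp w' p by apply: (subsetP sub); apply: CC.
    have /andP[_ w'a] := comp_sub pL w'p ap.
    have le := wmax w' w'P w'a; rewrite (comp_eq ap) in le.
    have E : comp (W a) a = comp w' p by apply/eqP; rewrite eqEcard sub le.
    by move/negP: qC; apply; rewrite /C E.
  have [/exists_inP[d' d'a d'p]|no] := boolP [exists d' in C a, d' \in comp w' p].
    by apply/forall_inP; apply: over d'a d'p.
  rewrite negb_exists_in in no; move/forall_inP: no => no.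
  have pCa : p \notin C a by apply: contraL (CC a) => /no; rewrite inE connect0.
  rewrite (negPf pCa) /= in pC; apply/forall_inP => b ba.
  have /andP[bL _] := comp_sub aL wa ba.
  rewrite adj_sym (comp_module w'P pL w'p qp bL (no b ba)) adj_sym.
  by move/forall_inP: pC; apply.
pose g (x : red_graph) : red_graph := fingraph.root red x.
have csym : connect_sym red := sym_connect_sym red_sym.
apply: (@scol_local red_graph _ _ g) => [x y xL yL xy|r].
  by apply/eqP; rewrite (root_connect csym); apply: connect1.
set D := [set x in L | g x == r].
have sD : D \subset L by apply/subsetP => x; rewrite inE => /andP[].
have DD x y : x \in D -> y \in D -> connect red x y.
  rewrite !inE => /andP[_ /eqP gx] /andP[_ /eqP gy]; rewrite -(root_connect csym).
  by apply/eqP; apply: etrans gx (esym gy).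
have [K [sK cK mK]] := @om_ex G D.
have [E|[x0 x0D]] := set_0Vmem D; first by rewrite E; apply: scol0.
pose h x := odflt x0 [pick q in K | x \in C q].
have hP x : x \in D -> (h x \in K) && (x \in C (h x)).
  move=> xD; rewrite /h; case: pickP => [q //|no].
  have xK : x \notin K by apply/negP => xK; have := no x; rewrite /= xK CC.
  have /set0Pn[q] := max_clique_nonnbr sK cK mK xD xK; rewrite inE => /andP[qK].
  have qD := subsetP sK q qK; have qL := subsetP sD q qD.
  have := complete q x qL (DD q x qD xD); have := no q; rewrite /= qK /= => -> /=.
  by move/forall_inP/(_ q (CC q)); rewrite adj_sym => ->.
apply: (@scolW red_graph D D (#|K| * k)) => //; last by rewrite leq_mul // mK omS.
apply: (@scol_fiber red_graph _ K D h) => [x /hP/andP[]|q qK] //.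
have qL := subsetP sD q (subsetP sK q qK); have [wP wq _] := WP q qL.
have [c c1 c2] := colN _ wP.
have inN x : x \in [set x in D | h x == q] -> x \in [set a in L | adj (W q) a].
  rewrite inE => /andP[/hP/andP[_ +] /eqP E]; rewrite E => /(comp_sub qL wq).
  by rewrite inE.
exists c => [x /inN|x y /inN xN /inN yN /and4P[_ _ xy _]]; first exact: c1.
exact: c2.
Qed.

(** In a red colour class the vertices of a triangle have private parents, which bull-freeness makes
    pairwise adjacent. The last hypothesis excludes this prism, so the classes are triangle-free. *)
Lemma scol_layer F k : om_bounded G F ->
  (forall w, w \in Par -> scol [set a in L | adj w a] k) ->
  (forall w1 w2 w3 a1 a2, w1 \in Par -> w2 \in Par -> w3 \in Par -> a1 \in L -> a2 \in L ->
     adj w1 w2 -> adj w2 w3 -> adj w1 w3 -> adj w1 a1 -> adj w2 a2 ->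
     ~~ adj w2 a1 -> ~~ adj w3 a1 -> ~~ adj w1 a2 -> ~~ adj w3 a2 -> False) ->
  scol L (om L * k * F 2).
Proof.
move=> HF colN noprism; have [c c1 c2] := scol_red colN.
have [->|[x0 x0L]] := set_0Vmem L; first exact: scol0.
have k_gt0 : 0 < om L * k by apply: leq_ltn_trans (c1 x0 x0L).
have -> : om L * k = #|[set: 'I_(om L * k)]| by rewrite cardsT card_ord.
pose g x : 'I_(om L * k) := insubd (Ordinal k_gt0) (c x).
apply: (@scol_fiber _ _ _ _ g) => [x _|i _]; first by rewrite inE.
apply: HF; apply: om_le2.
have gi x : x \in [set x in L | g x == i] -> x \in L /\ c x = i.
  by rewrite inE => /andP[xL /eqP <-]; split=> //; rewrite val_insubd c1.
move=> a1 a2 a3 /gi[L1 g1] /gi[L2 g2] /gi[L3 g3] a12 a23 a13.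
have nored x y w : x \in L -> y \in L -> c x = c y -> adj x y -> w \in Par -> adj w x ->
  ~~ adj w y.
  move=> xL yL cxy xy wP wx; apply/negP => wy.
  have : red x y by apply/and4P; split=> //; apply/exists_inP; exists w; rewrite ?wx.
  by move/(c2 x y xL yL); rewrite cxy eqxx.
have [w1 P1 wa1] := parL L1; have [w2 P2 wa2] := parL L2; have [w3 P3 wa3] := parL L3.
have a21 : adj a2 a1 by rewrite adj_sym.
have a31 : adj a3 a1 by rewrite adj_sym.
have a32 : adj a3 a2 by rewrite adj_sym.
have n12 : ~~ adj w1 a2 by apply: (nored a1 a2); rewrite // g1 g2.
have n13 : ~~ adj w1 a3 by apply: (nored a1 a3); rewrite // g1 g3.
have n21 : ~~ adj w2 a1 by apply: (nored a2 a1); rewrite // g1 g2.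
have n23 : ~~ adj w2 a3 by apply: (nored a2 a3); rewrite // g2 g3.
have n31 : ~~ adj w3 a1 by apply: (nored a3 a1); rewrite // g1 g3.
have n32 : ~~ adj w3 a2 by apply: (nored a3 a2); rewrite // g2 g3.
have parents x y z wx wy : adj x y -> adj y z -> adj x z -> adj wx x -> adj wy y ->
    ~~ adj wx y -> ~~ adj wx z -> ~~ adj wy x -> ~~ adj wy z -> adj wx wy.
  move=> xy yz xz xx yy n1 n2 n3 n4; apply/negPn/negP => nw.
  by apply: (bf xy yz xz (_ : adj x wx) (_ : adj y wy) n1 n2 n3 n4 nw); rewrite adj_sym.
apply: (noprism w1 w2 w3 a1 a2) => //.
- exact: (parents a1 a2 a3).
- exact: (parents a2 a3 a1).
- exact: (parents a1 a3 a2).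
Qed.

End RedGraph.

(** * Breadth-first levels and the colouring of prime bull-free graphs *)

Section BreadthFirst.
Variables (G : sgraph).
Implicit Types (a b d u w x y z : G) (K S R T U : {set G}).

Definition ball S K i : {set G} :=
  iter i (fun B : {set G} => B :|: [set y in S | [exists x in B, adj x y]]) K.

Lemma ball_step S K i x y : x \in ball S K i -> y \in S -> adj x y -> y \in ball S K i.+1.
Proof.
move=> xB yS xy; rewrite /= !inE yS; apply/orP; right.
by apply/exists_inP; exists x.
Qed.

Lemma levels S K : K \subset S -> exists R, exists lev : G -> nat,
  [/\ K \subset R, R \subset S,
      forall x y, x \in R -> y \in S -> adj x y -> (y \in R) && (lev y <= (lev x).+1),
      forall x, x \in R -> (lev x == 0) = (x \in K)
    & forall x i, x \in R -> lev x = i.+1 -> exists y, [/\ y \in R, lev y = i & adj y x]].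
Proof.
move=> sK; pose r : rel G := fun a b => [&& a \in S, b \in S & adj a b].
pose R := [set x in S | [exists k in K, connect r k x]].
have RP x : x \in R -> exists i, x \in ball S K i.
  rewrite inE => /andP[_ /exists_inP[k kK /connectP[p rp ->]]].
  have kB : k \in ball S K 0 by [].
  elim: p k 0 kB rp {kK} => [k i kB _|y p IHp k i kB /=]; first by exists i.
  by case/andP=> /and3P[_ yS ky]; apply: IHp (ball_step kB yS ky).
have : forall x, exists i, x \in R -> x \in ball S K i /\ forall j, x \in ball S K j -> i <= j.
  move=> x; have [xR|xR] := boolP (x \in R); last by exists 0.
  by case: (ex_minnP (RP x xR)) => i xi imin; exists i.
case/fin_all_exists => lev levP.
have step x y : x \in R -> y \in S -> adj x y -> (y \in R) && (lev y <= (lev x).+1).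
  move=> xR yS xy; have yR : y \in R.
    move: xR; rewrite !inE yS => /andP[xS /exists_inP[k kK kx]]; apply/exists_inP; exists k => //.
    by apply: connect_trans kx (connect1 _); rewrite /r xS yS.
  rewrite yR /=; have [_] := levP y yR; apply; have [xB _] := levP x xR.
  exact: ball_step xB yS xy.
have sKR : K \subset R.
  apply/subsetP => x xK; rewrite inE (subsetP sK) //; apply/exists_inP.
  by exists x => //; apply: connect0.
have sRS : R \subset S by apply/subsetP => x; rewrite inE => /andP[].
exists R, lev; split=> // [x xR|x i xR xi].
  have [xB xmin] := levP x xR; apply/eqP/idP => [x0|xK]; first by move: xB; rewrite x0.
  by apply/eqP; rewrite -leqn0; apply: xmin.
have [xB xmin] := levP x xR; move: xB; rewrite xi /= !inE => /orP[xB|].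
  by have := xmin i xB; rewrite xi ltnn.
case/andP => xS /exists_inP[y yB yx].
have yR : y \in R.
  have yBS : y \in S.
    move: yB; rewrite -/(ball S K i); elim: i {xi} => [|i IHi] /=; first exact: (subsetP sK).
    by rewrite inE => /orP[/IHi //|]; rewrite inE => /andP[].
  have : (x \in R) && true by rewrite xR.
  rewrite inE xS /= andbT => /exists_inP[k kK kx]; rewrite inE yBS.
  apply/exists_inP; exists k => //; apply: connect_trans kx (connect1 _).
  by rewrite /r xS yBS adj_sym.
exists y; split=> //; have [_ ymin] := levP y yR.
have le1 := ymin i yB; have /andP[_] := step y x yR xS yx; rewrite xi ltnS => le2.
by apply/eqP; rewrite eqn_leq le1.
Qed.

Lemma scol_levels R (lev : G -> nat) k :
  {in R &, forall x y, adj x y -> lev y <= (lev x).+1} ->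
  (forall i, scol [set x in R | lev x == i] k) -> scol R (2 * k).
Proof.
move=> step lk; rewrite -card_bool -cardsT.
apply: (@scol_fiber _ _ _ _ (fun x => odd (lev x))) => [x _|b _]; first by rewrite inE.
pose m := \max_(x : G) lev x.
have le_m x : lev x < m.+1 by rewrite ltnS; apply: (@leq_bigmax_cond _ xpredT lev x).
apply: (@scol_local _ _ _ (fun x => inord (lev x) : 'I_m.+1)) => [x y|i].
  rewrite !inE => /andP[xR /eqP ox] /andP[yR /eqP oy] xy.
  congr inord; have h1 := step x y xR yR xy.
  have h2 : lev x <= (lev y).+1 by apply: step; rewrite // adj_sym.
  have : odd (lev x) = odd (lev y) by rewrite ox oy.
  by move: h1 h2; clear; lia.
apply: (scolW (lk i)) => //; apply/subsetP => x; rewrite !inE => /andP[/andP[-> _] /eqP <-] /=.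
by rewrite inordK.
Qed.

(** Excluding the prism uses an ancestor two levels above the parents, which level 2 lacks. Starting
    from a maximum clique instead of one vertex repairs this: a clique vertex missed by the parents
    takes its place. Level 2 also sets the exponent, with [n ^ 2] pairs from the clique times
    [n ^ 2]. *)
Lemma scol_locally_bounded F n : bullfree (@adj G) -> om_bounded G F ->
  forall S, om S <= n -> {in S, forall x, scol [set y in S | adj x y] n} ->
  scol S (2 * ((F 2).+1 * n ^ 4)).
Proof.
move=> bf HF S; move: {2}#|S| (leqnn #|S|) => m; elim: m S => [|m IHm] S.
  by rewrite leqn0 cards_eq0 => /eqP -> _ _; apply: scol0.
move=> Sm Sn colN.
have [->|[x0 x0S]] := set_0Vmem S; first exact: scol0.
have S_gt0 : 0 < om S by rewrite om_gt0; apply/set0Pn; exists x0.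
have n_gt0 : 0 < n := leq_trans S_gt0 Sn.
have [K [sK cK mK]] := om_ex S.
have Kn : #|K| <= n by rewrite mK.
have [R [lev [sKR sRS step lev0 parent]]] := levels sK.
have colN' w (L : {set G}) : w \in S -> L \subset S -> scol [set a in L | adj w a] n.
  move=> wS sL; apply: (scolW (colN w wS)) => //; apply/subsetP => a; rewrite !inE.
  by case/andP => /(subsetP sL) -> ->.
have far x y : x \in R -> y \in R -> (lev x).+1 < lev y -> ~~ adj x y.
  move=> xR yR; rewrite ltnNge; apply: contra => xy.
  by have /andP[] := step x y xR (subsetP sRS y yR) xy.
have colR : scol R (2 * ((F 2).+1 * n ^ 4)).
  apply: (@scol_levels _ lev) => [x y xR yR xy|i].
    by have /andP[] := step x y xR (subsetP sRS y yR) xy.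
  set L := [set x in R | _].
  have LP a : a \in L -> (a \in R) * (lev a = i) by rewrite inE => /andP[? /eqP].
  have sLS : L \subset S by apply: subset_trans sRS; apply/subsetP => a /LP[].
  have omL : om L <= n := leq_trans (omS sLS) Sn.
  have pw j : j <= 4 -> n ^ j <= (F 2).+1 * n ^ 4.
    by move=> j4; apply: leq_trans (leq_pexp2l n_gt0 j4) _; apply: leq_pmull.
  case: i => [|[|[|i]]] in L LP sLS omL *.
  - apply: (scolW (scol_card K)); last by apply: leq_trans Kn _; rewrite -[n]expn1 pw.
    by apply/subsetP => a /LP[aR a0]; rewrite -lev0 // a0.
  - have nxt a : a \in L -> exists k, (k \in K) && adj k a.
      move=> /LP[aR a1]; have [k [kR k0 ka]] := parent a 0 aR a1.
      by exists k; rewrite -lev0 // k0 eqxx.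
    pose g a := odflt x0 [pick k | (k \in K) && adj k a].
    have gP a : a \in L -> (g a \in K) && adj (g a) a.
      by move=> /nxt[k ka]; rewrite /g; case: pickP => [//|/(_ k)]; rewrite ka.
    apply: (@scolW _ _ L (#|K| * n)) => //; last first.
      apply: leq_trans (leq_mul Kn (leqnn n)) _; by rewrite mulnn pw.
    apply: (@scol_fiber _ _ _ _ g) => [a /gP/andP[]|k kK] //.
    apply: (scolW (colN' k L (subsetP sK k kK) sLS)) => //.
    by apply/subsetP => a /setIdP[aL /eqP <-]; rewrite inE aL; case/andP: (gP a aL).
  - pose good a (z : G * G) := [&& z.1 \in K, z.2 \in K &
      [exists w in R, [&& lev w == 1, adj w a, adj z.1 w & ~~ adj z.2 w]]].
    have nxt a : a \in L -> exists z : G * G, good a z.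
      move=> /LP[aR a2]; have [w [wR w1 wa]] := parent a 1 aR a2.
      have [x [xR x0' xw]] := parent w 0 wR w1.
      have wK : w \notin K by rewrite -lev0 // w1.
      have /set0Pn[y] := max_clique_nonnbr sK cK mK (subsetP sRS w wR) wK.
      rewrite inE => /andP[yK yw]; exists (x, y); rewrite /good /= yK -lev0 // x0' eqxx /=.
      by apply/exists_inP; exists w; rewrite // w1 eqxx wa xw.
    pose g a := odflt (x0, x0) [pick z | good a z].
    have gP a : a \in L -> good a (g a).
      by move=> /nxt[k ka]; rewrite /g; case: pickP => [//|/(_ k)]; rewrite ka.
    apply: (@scolW _ _ L (#|setX K K| * (n * n * F 2))) => //; last first.
      rewrite cardsX; apply: leq_trans (leq_mul (leq_mul Kn Kn) (leqnn _)) _.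
      by rewrite !expnS expn0; nia.
    apply: (@scol_fiber _ _ _ _ g) => [a /gP/and3P[g1 g2 _]|[x y]].
      by rewrite inE g1 g2.
    rewrite inE /= => /andP[xK yK]; set L' := [set a in L | _].
    have L'L a : a \in L' -> a \in L by rewrite inE => /andP[].
    have sL'S : L' \subset S by apply: subset_trans sLS; apply/subsetP.
    pose Par := [set w in R | [&& lev w == 1, adj x w & ~~ adj y w]].
    have ParP w : w \in Par -> [/\ w \in R, lev w = 1, adj x w & ~~ adj y w].
      by rewrite inE => /and4P[? /eqP].
    have xR := subsetP sKR x xK; have yR := subsetP sKR y yK.
    have lx : lev x = 0 by apply/eqP; rewrite lev0.
    have ly : lev y = 0 by apply/eqP; rewrite lev0.
    have far' z a : z \in R -> lev z = 0 -> a \in L' -> ~~ adj z a.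
      by move=> zR z0 /L'L/LP[aR a2]; apply: far; rewrite // z0 a2.
    apply: (@scolW _ _ L' (om L' * n * F 2)) => //; last first.
      by rewrite !leq_mul // (leq_trans (omS sL'S) Sn).
    apply: (@scol_layer _ _ Par) => //.
    + move=> w /ParP[wR w1 xw yw]; exists x; first by rewrite adj_sym.
      by move=> a aL'; apply: far'.
    + move=> a; rewrite inE => /andP[/gP/and3P[_ _ +] /eqP E].
      rewrite E /= => /exists_inP[w wR /and4P[w1 wa xw yw]]; exists w => //.
      by rewrite inE wR w1 xw.
    + by move=> w /ParP[wR _ _ _]; apply: colN' => //; apply: (subsetP sRS).
    move=> w1 w2 w3 a1 a2 /ParP[_ _ xw1 yw1] /ParP[_ _ xw2 yw2] _ a1L _ w12 _ _ wa1 _ n21 _ _ _.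
    apply: (bf x w1 w2 y a1) => //.
    + by move/cliqueP: cK; apply=> //; apply: contraTneq xw1 => ->.
    + by rewrite adj_sym far'.
    + by rewrite adj_sym.
    + by rewrite far'.
  pose Par := [set w in R | lev w == i.+2].
  have ParP w : w \in Par -> (w \in R) * (lev w = i.+2) by rewrite inE => /andP[? /eqP].
  apply: (@scolW _ _ L (om L * n * F 2)) => //; last first.
    apply: leq_trans (leq_mul (leq_mul omL (leqnn n)) (leqnn _)) _.
    by rewrite !expnS expn0; nia.
  apply: (@scol_layer _ _ Par) => //.
  - move=> w /ParP[wR wi]; have [u [uR ui uw]] := parent w i.+1 wR wi.
    exists u; first by rewrite adj_sym.
    by move=> a /LP[aR ai]; apply: far; rewrite // ui ai.
  - move=> a /LP[aR ai]; have [w [wR wi wa]] := parent a i.+2 aR ai.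
    by exists w; rewrite // inE wR wi eqxx.
  - by move=> w /ParP[wR _]; apply: colN' => //; apply: (subsetP sRS).
  move=> w1 w2 w3 a1 a2 /ParP[R1 l1] /ParP[R2 l2] /ParP[R3 l3] /LP[A1 i1] /LP[A2 i2].
  move=> w12 w23 w13 wa1 wa2 n21 n31 n12 n32.
  have [u [uR ui uw1]] := parent w1 i.+1 R1 l1; have [u' [u'R u'i u'u]] := parent u i uR ui.
  (* If [u] also saw [w], the triangle [u w1 w] with [u'] at [u] and [a1] at [w1] would be a bull.
     So [u] is a pendant at [w1] of the triangle of parents, and [a2] is one at [w2]. *)
  have nu w : w \in R -> lev w = i.+2 -> adj w1 w -> ~~ adj w a1 -> ~~ adj u w.
    move=> wR wi w1w na; apply/negP => uw; apply: (bf u w1 w u' a1) => //.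
    - by rewrite adj_sym.
    - by apply: far; rewrite // u'i l1.
    - by apply: far; rewrite // u'i wi.
    - by rewrite adj_sym far // ui i1.
    - by rewrite adj_sym.
    - by apply: far; rewrite // u'i i1.
  have nu2 := nu w2 R2 l2 w12 n21; have nu3 := nu w3 R3 l3 w13 n31.
  apply: (bf w1 w2 w3 u a2) => //.
  - by rewrite adj_sym.
  - by rewrite adj_sym.
  - by rewrite adj_sym.
  - by apply: far; rewrite // ui i2.
have sSR : S :\: R \subset S by apply: subsetDl.
apply: (scolW (scol_anti (A := R) (B := S :\: R) _ colR _)) => //.
- move=> x y xR /setDP[yS]; apply: contra => xy.
  by have /andP[] := step x y xR yS xy.
- apply: IHm.
  + have : 0 < #|R| by apply: leq_trans (subset_leq_card sKR); rewrite mK.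
    by rewrite cardsD (setIidPr sRS); move: Sm (subset_leq_card sRS); clear; lia.
  + exact: leq_trans (omS sSR) Sn.
  + by move=> x /setDP[xS _]; apply: colN'.
- by apply/subsetP => x xS; rewrite !inE xS andbT orbN.
Qed.

Lemma scol_prime_bull_free F T U : bullfree (@adj G) -> om_bounded G F ->
  prime_set (@adj G) T -> U \subset T ->
  scol U ((2 * F 2 + 3) * om U ^ 4).
Proof.
move=> bf HF pT sUT; set n := om U.
pose tot (X : {set G}) := [forall C : {set G}, (C \subset X) ==> ~~ unsplittable (@adj G) C].
have totP (X : {set G}) : tot X -> scol X (om X).
  move=> /forallP tX; apply: scol_totally_splittable => C sC.
  by have := tX C; rewrite sC.
have totS (X Y : {set G}) : X \subset Y -> tot Y -> tot X.
  move=> sXY /forallP tY; apply/forallP => C; apply/implyP => sC.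
  by have := tY C; rewrite (subset_trans sC sXY).
pose N v := [set x in T | adj v x].
pose M v := [set x in T | (x != v) && ~~ adj v x].
have dich v : v \in T -> tot (N v) || tot (M v).
  move=> vT; rewrite -[_ || _]negbK negb_or; apply/negP => /andP[].
  rewrite !negb_forall => /existsP[C1]; rewrite negb_imply negbK => /andP[s1 u1].
  move=> /existsP[C2]; rewrite negb_imply negbK => /andP[s2 u2].
  have C1N c : c \in C1 -> (c \in T) && adj v c by move/(subsetP s1); rewrite inE.
  have C2M c : c \in C2 -> (c \in T) && ~~ adj v c.
    by move/(subsetP s2); rewrite inE => /and3P[-> _ ->].
  apply: (prime_bullfree_local (@adj_sym G) (@adj_irrefl G) bf pT vT _ _ _ _ u1 u2).
  - by apply/subsetP => c /C1N/andP[].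
  - by apply/subsetP => c /C2M/andP[].
  - by move=> c /C1N/andP[].
  - by move=> c /C2M/andP[].
pose Y := [set v in U | tot (M v)]; pose Z := U :\: Y.
have sYU : Y \subset U by apply/subsetP => v; rewrite inE => /andP[].
have sZU : Z \subset U by apply: subsetDl.
have colY : scol Y (n * n).
  have [K [sK cK mK]] := om_ex Y.
  have Kn : #|K| <= n by rewrite mK omS.
  have [->|[x0 x0Y]] := set_0Vmem Y; first exact: scol0.
  (* The group of [k] consists of [k] and non-neighbours of [k], which contain no unsplittable
     set. *)
  pose good v k := [&& k \in K & (v == k) || ~~ adj k v].
  have nxt v : v \in Y -> exists k : G, good v k.
    move=> vY; have [vK|vK] := boolP (v \in K); first by exists v; rewrite /good vK eqxx.
    have /set0Pn[k] := max_clique_nonnbr sK cK mK vY vK; rewrite inE => /andP[kK kv].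
    by exists k; rewrite /good kK kv orbT.
  pose g v := odflt x0 [pick k | good v k].
  have gP v : v \in Y -> good v (g v).
    by move=> /nxt[k ka]; rewrite /g; case: pickP => [//|/(_ k)]; rewrite ka.
  apply: (@scolW _ _ Y (#|K| * n)) => //; last by rewrite leq_mul.
  apply: (@scol_fiber _ _ _ _ g) => [v /gP/andP[]|k kK] //.
  have kY := subsetP sK k kK; have kU := subsetP sYU k kY.
  have n_gt0 : 0 < n by rewrite om_gt0; apply/set0Pn; exists k.
  have sMU : M k :&: U \subset U by apply: subsetIr.
  have colM : scol (M k :&: U) n.
    apply: (scolW (totP _ (totS _ (M k) (subsetIl _ _) _))) => //; last exact: omS.
    by move: kY; rewrite inE => /andP[].
  have col1 : scol [set k] n by apply: (scolW (scol_card [set k])); rewrite ?cards1.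
  apply: (scolW (scol_anti (A := [set k]) _ col1 colM)) => //.
    by move=> _ y /set1P -> /setIP[]; rewrite inE => /and3P[].
  apply/subsetP => v /setIdP[vY /eqP E]; have vU := subsetP sYU v vY.
  have : good v k by rewrite -E; apply: gP.
  rewrite !inE /good kK /= vU (subsetP sUT) // andbT.
  by case: eqVneq => //= _ ->.
have colZ : scol Z (2 * ((F 2).+1 * n ^ 4)).
  apply: scol_locally_bounded => //; first exact: omS.
  move=> x /setDP[xU xY]; have xT := subsetP sUT x xU.
  have tN : tot (N x).
    by have := dich x xT; rewrite inE xU /= in xY; rewrite (negPf xY) orbF.
  set X := [set y in Z | adj x y].
  have sXU : X \subset U by apply: subset_trans sZU; apply/subsetP => y; rewrite inE => /andP[].
  apply: (scolW (totP X _)) => //; last exact: omS.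
  apply: totS tN; apply/subsetP => y yX; rewrite inE (subsetP sUT) ?(subsetP sXU) //.
  by move: yX; rewrite inE => /andP[].
apply: (scolW (scolU colY colZ)).
  by apply/subsetP => v vU; rewrite !inE vU /= andbT orbN.
rewrite !expnS expn0; have : n * n <= n * (n * (n * (n * 1))) by nia.
nia.
Qed.

End BreadthFirst.

(** * Modular decomposition *)

Section ModularPartition.
Variables (V : finType) (e : rel V) (S : {set V}).
Hypothesis esym : symmetric e.
Implicit Types (M N A : {set V}) (x y z : V).

Definition cut (b : bool) A := [&& A \subset S, A != set0, A != S
  & [forall x in A, forall y in S :\: A, e x y == b]].

Lemma module_union M N z : ismod e S M -> ismod e S N -> z \in M -> z \in N ->
  ismod e S (M :|: N).
Proof.
move=> /ismodP[sM mM] /ismodP[sN mN] zM zN; apply/ismodP; split; first by rewrite subUset sM.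
move=> x y u xU yU uS; rewrite inE negb_or => /andP[uM uN].
suff to_z v : v \in M :|: N -> e v u = e z u by rewrite !to_z.
by case/setUP => [vM|vN]; [apply: mM|apply: mN].
Qed.

(** A pair between [S :\: N] and [N] can be moved to [(a, b)]: its second end within the module [N],
    then its first end within the module [M]. *)
Lemma module_union_full M N z : ismod e S M -> ismod e S N -> z \in M -> z \in N ->
  M != S -> N != S -> M :|: N = S -> exists b, exists A, cut b A.
Proof.
move=> /ismodP[sM mM] /ismodP[sN mN] zM zN MS NS MN.
have [a aS aN] : exists2 a, a \in S & a \notin N.
  by apply/subsetPn; apply: contra NS => sSN; rewrite eqEsubset sN.
have [b bS bM] : exists2 b, b \in S & b \notin M.
  by apply/subsetPn; apply: contra MS => sSM; rewrite eqEsubset sM.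
have inM x : x \in S -> x \notin N -> x \in M.
  by move=> xS xN; move: xS; rewrite -MN inE (negPf xN) orbF.
have inN x : x \in S -> x \notin M -> x \in N.
  by move=> xS xM; move: xS; rewrite -MN inE (negPf xM).
exists (e a b), (S :\: N); apply/and4P; split.
- exact: subsetDl.
- by apply/set0Pn; exists a; rewrite inE aN.
- by apply/eqP => E; move: (bS); rewrite -E inE inN.
apply/forall_inP => x /setDP[xS xN]; apply/forall_inP => y /setDP[yS].
rewrite inE yS andbT negbK => yN; apply/eqP.
have -> : e x y = e x b by rewrite ![e x _]esym; apply: mN => //; apply: inN.
by apply: mM => //; apply: inM.
Qed.

(** Without a cut, intersecting proper modules have a proper union, so the maximal proper modules
    partition [S]. A nontrivial module of the set of representatives would pull back to a proper
    module larger than a maximal one. *)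
Lemma modular_partition : 1 < #|S| -> (forall b A, ~~ cut b A) ->
  exists rep : V -> V, [/\ {in S, forall x, rep x \in S},
    {in S, forall x, rep (rep x) = rep x},
    {in S &, forall x y, rep x != rep y -> e x y = e (rep x) (rep y)},
    {in S, forall x, [set y in S | rep y == rep x] \proper S}
    & prime_set e (rep @: S)].
Proof.
move=> S1 nocut.
have exM x : exists M : {set V}, x \in S -> [/\ ismod e S M, M != S, x \in M &
    forall N, ismod e S N -> N != S -> x \in N -> #|N| <= #|M|].
  have [xS|xS] := boolP (x \in S); last by exists set0.
  pose P M := [&& ismod e S M, M != S & x \in M].
  have P1 : P [set x].
    rewrite /P set11 andbT; apply/andP; split.
      apply/ismodP; split; first by rewrite sub1set.
      by move=> y z u /set1P -> /set1P ->.
    by apply: contraTneq S1 => <-; rewrite cards1.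
  exists [arg max_(M > [set x] | P M) #|M|] => _.
  case: arg_maxnP => // M /and3P[mM MS xM] Mmax; split=> // N mN NS xN.
  by apply: Mmax; rewrite /P mN NS.
case/fin_all_exists: exM => M MP.
have absorb x N z : x \in S -> ismod e S N -> N != S -> z \in N -> z \in M x -> N \subset M x.
  move=> xS mN NS zN zM; have [mM MS xM Mmax] := MP x xS.
  have mU := module_union mM mN zM zN.
  have US : M x :|: N != S.
    apply/negP => /eqP E; have [b [A]] := module_union_full mM mN zM zN MS NS E.
    by rewrite (negPf (nocut b A)).
  have := Mmax _ mU US (subsetP (subsetUl _ _) _ xM) => le.
  have /eqP -> : M x == M x :|: N by rewrite eqEcard subsetUl le.
  exact: subsetUr.
have Meq x y z : x \in S -> y \in S -> z \in M x -> z \in M y -> M x = M y.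
  move=> xS yS zx zy; have [mx xnS _ _] := MP x xS; have [my ynS _ _] := MP y yS.
  by apply/eqP; rewrite eqEsubset (absorb y (M x) z) // (absorb x (M y) z).
have MS x : x \in S -> M x \subset S by move=> /MP[/ismodP[]].
have MM x : x \in S -> x \in M x by case/MP.
pose rep x := odflt x [pick y in M x].
have repM x : x \in S -> rep x \in M x.
  by move=> /MM xM; rewrite /rep; case: pickP => [y //|/(_ x)]; rewrite xM.
have repS x : x \in S -> rep x \in S by move=> xS; apply: (subsetP (MS x xS)); apply: repM.
have Mrep x : x \in S -> M (rep x) = M x.
  by move=> xS; apply: (Meq _ _ (rep x)) => //; rewrite ?repS ?MM ?repM ?repS.
have rep_eq x y : x \in S -> y \in S -> M x = M y -> rep x = rep y.
  move=> xS yS E; rewrite /rep E; case: pickP => // /(_ y).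
  by rewrite MM.
have eq_rep x y : x \in S -> y \in S -> rep x = rep y -> M x = M y.
  by move=> xS yS E; rewrite -(Mrep x xS) E Mrep.
have rep_adj x y : x \in S -> y \in S -> rep x != rep y -> e x y = e (rep x) (rep y).
  move=> xS yS xy.
  have nM z t : z \in S -> t \in S -> rep z != rep t -> t \notin M z.
    move=> zS tS; apply: contra => tM; apply/eqP; apply: rep_eq => //.
    by apply: (Meq _ _ t) => //; apply: MM.
  have [/ismodP[_ mx] _ _ _] := MP x xS; have [/ismodP[_ my] _ _ _] := MP y yS.
  have yx : rep y != rep x by rewrite eq_sym.
  have repK z : z \in S -> rep (rep z) = rep z by move=> zS; apply: rep_eq; rewrite ?repS ?Mrep.
  rewrite (mx x (rep x) y) ?MM ?repM ?nM //.
  by rewrite ![e (rep x) _]esym; apply: my; rewrite ?MM ?repM ?repS ?nM ?repK ?repS.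
exists rep; split=> //.
- by move=> x xS; apply: rep_eq; rewrite ?repS ?Mrep.
- move=> x xS; have [_ MnS _ _] := MP x xS.
  apply: (@sub_proper_trans _ _ (M x)); last by rewrite properEneq MnS MS.
  apply/subsetP => y; rewrite inE => /andP[yS /eqP E].
  by rewrite -(eq_rep y x) // MM.
apply/forallP => N; apply/implyP => /ismodP[sN mN]; rewrite leqNgt -implybE.
apply/implyP => /card_gt1P[t1 [t2 [t1N t2N t12]]].
have repT t : t \in rep @: S -> t \in S /\ rep t = t.
  by case/imsetP => x xS ->; split; [apply: repS|apply: rep_eq; rewrite ?repS ?Mrep].
have [t1S r1] := repT t1 (subsetP sN _ t1N); have [t2S r2] := repT t2 (subsetP sN _ t2N).
pose N' := [set x in S | rep x \in N].
have mN' : ismod e S N'.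
  apply/ismodP; split; first by apply/subsetP => x; rewrite inE => /andP[].
  move=> x y z; rewrite !inE => /andP[xS xN] /andP[yS yN] zS; rewrite zS /= => zN.
  have zx t : rep t \in N -> rep t != rep z by apply: contraTneq => ->.
  rewrite (rep_adj x z) ?zx // (rep_adj y z) ?zx //.
  by apply: mN => //; apply: imset_f.
have [N'S|N'S] := eqVneq N' S.
  rewrite eqEsubset sN; apply/subsetP => t /repT[tS rt].
  by move: tS; rewrite -N'S inE rt => /andP[].
have sub := absorb t1 N' t1 t1S mN' N'S; case/negP: t12; apply/eqP.
rewrite -r1 -r2; apply: rep_eq => //; apply: (Meq _ _ t2) => //; last exact: MM.
by apply: (subsetP (sub _ _)); rewrite ?MM // inE ?t1S ?t2S ?r1 ?r2.
Qed.

End ModularPartition.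

Lemma expnS_diff s d : s.+1 ^ d <= s ^ d + d * s.+1 ^ d.-1.
Proof.
case: d => [//|d] /=; elim: d => [|d IHd]; first by rewrite !expn1 !expn0; lia.
have h : s ^ d.+1 <= s.+1 ^ d.+1 by apply: leq_expl.
rewrite [s.+1 ^ d.+2]expnS; apply: leq_trans (leq_mul (leqnn _) IHd) _.
rewrite [s ^ d.+2]expnS mulnDr [s.+1 * (_ * _)]mulnCA -expnS; nia.
Qed.

Lemma expn_superadd a b d : 0 < d -> a ^ d + b ^ d <= (a + b) ^ d.
Proof.
case: d => // d _; rewrite !expnS mulnDl.
by apply: leq_add; rewrite leq_mul // leq_expl // ?leq_addr ?leq_addl.
Qed.

(* block_end w bounds the colours used by the modules of clique number at most w
   that take their colours from the top of the palette: block s holds the colours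
   with rank in [(s-1)^d, s^d), once for each colour of the quotient restricted
   to modules of clique number at least s. *)
Section Blocks.
Variables (A m n : nat).
Hypothesis Am : A * (m + 5) <= 2 ^ m.

Definition block_count s := A * (n %/ s) ^ 4.
Definition block_width s := s ^ (m + 5) - s.-1 ^ (m + 5).
Definition block_end w := \sum_(1 <= s < w.+1) block_width s * block_count s.

Lemma block_endS w : block_end w.+1 = block_end w + block_width w.+1 * block_count w.+1.
Proof. by rewrite /block_end big_nat_recr. Qed.

Lemma block_end_mono v w : v <= w -> block_end v <= block_end w.
Proof.
move=> /subnK <-; elim: (w - v) => [|k IHk]; first by rewrite add0n.
by rewrite addSn block_endS (leq_trans IHk) // leq_addr.
Qed.

Lemma block_term s : 0 < s -> block_width s * block_count s <= A * (m + 5) * s ^ m * n ^ 4.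
Proof.
case: s => // s _; rewrite /block_width /block_count /=.
have h1 : s.+1 ^ (m + 5) - s ^ (m + 5) <= (m + 5) * s.+1 ^ (m + 4).
  have := expnS_diff s (m + 5); rewrite (_ : (m + 5).-1 = m + 4); last by lia.
  by lia.
have h2 : (n %/ s.+1) ^ 4 * s.+1 ^ 4 <= n ^ 4 by rewrite -expnMn leq_expl // leq_trunc_div.
apply: leq_trans (leq_mul h1 (leqnn _)) _; rewrite expnD.
apply: (@leq_trans (A * (m + 5) * s.+1 ^ m * ((n %/ s.+1) ^ 4 * s.+1 ^ 4))).
  by apply: eq_leq; ring.
by rewrite leq_mul.
Qed.

(** The two ends of the palette do not meet: the top serves modules of clique number [w], the bottom
    their neighbours of clique number at most [n - w]. From [2 * w <= n] and [Am],
    [block_end w <= w * n ^ (m + 4)], while [(n - w) ^ (m + 5) <= (n - w) * n ^ (m + 4)]. *)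
Lemma block_end_bound w : 2 * w <= n -> block_end w + (n - w) ^ (m + 5) <= n ^ (m + 5).
Proof.
move=> wn.
have h1 : block_end w <= w * (A * (m + 5) * w ^ m * n ^ 4).
  rewrite /block_end big_add1 /= -[X in _ <= X * _](subn0 w) -sum_nat_const_nat.
  rewrite !big_nat; apply: leq_sum => s /andP[_ sw]; apply: leq_trans (block_term _) _ => //.
  by rewrite !leq_mul // leq_expl.
have h2 : A * (m + 5) * w ^ m <= n ^ m.
  apply: leq_trans (leq_mul Am (leqnn _)) _.
  by rewrite -expnMn leq_expl.
have h3 : block_end w <= w * n ^ (m + 4).
  by apply: leq_trans h1 _; rewrite expnD leq_mul // leq_mul.
have h4 : (n - w) ^ (m + 5) <= (n - w) * n ^ (m + 4).
  rewrite -(addn1 4) addnA addn1 expnS leq_mul // leq_expl // leq_subr //.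
apply: leq_trans (leq_add h3 h4) _; rewrite -mulnDl.
by rewrite -(addn1 4) addnA addn1 expnS leq_mul //; move: wn; clear; lia.
Qed.

End Blocks.

(** * Substitution and bulls *)

Lemma graph_free_bull_bullfree (G : sgraph) : graph_free bull G -> bullfree (@adj G).
Proof.
move=> free a b c d f ab bc ac ad bf db dc fa fc df.
pose h (u : bull) : G := nth a [:: a; b; c; d; f] (val u).
apply: (free_embedding_no_twins (h := h) free) => [u v tw|].
  have := (tw (@Ordinal 5 0 isT), tw (@Ordinal 5 1 isT), tw (@Ordinal 5 2 isT),
           tw (@Ordinal 5 3 isT), tw (@Ordinal 5 4 isT)).
  apply: contraPeq => {tw}.
  by case: u v => [[|[|[|[|[|?]]]]] //= ?] [[|[|[|[|[|?]]]]] //= ?] //= _ [[[[]]]].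
case=> [[|[|[|[|[|?]]]]] //= ?] [[|[|[|[|[|?]]]]] //= ?]; rewrite /h /= /rel_adj /=.
all: rewrite ?adj_irrefl //.
all: by [|apply/negbTE|rewrite adj_sym|rewrite adj_sym; apply/negbTE].
Qed.

Section Substitution.
Variables (G : sgraph) (A m : nat) (S : {set G}) (rep : G -> G).
Implicit Types (x y z : G) (K U : {set G}).
Local Notation n := (om S).
Local Notation D := (m + 5).
Hypothesis Am : A * D <= 2 ^ m.
Hypothesis repS : {in S, forall x, rep x \in S}.
Hypothesis repK : {in S, forall x, rep (rep x) = rep x}.
Hypothesis rep_adj : {in S &, forall x y, rep x != rep y -> adj x y = adj (rep x) (rep y)}.
Hypothesis colT : forall U, U \subset rep @: S -> scol U (A * om U ^ 4).

Definition fiber x : {set G} := [set y in S | rep y == x].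

Hypothesis colF : {in S, forall x, scol (fiber (rep x)) (om (fiber (rep x)) ^ D)}.

Lemma fiber_adj x y : x \in rep @: S -> y \in rep @: S -> adj x y ->
  {in fiber x & fiber y, forall a b, adj a b}.
Proof.
move=> xT yT xy a b; rewrite !inE => /andP[aS /eqP ax] /andP[bS /eqP bY].
by rewrite rep_adj // ax bY // adj_neq.
Qed.

Lemma fiber_sub x : fiber x \subset S.
Proof. by apply/subsetP => y; rewrite inE => /andP[]. Qed.

Lemma clique_weight K s : K \subset rep @: S -> clique K ->
  {in K, forall x, s <= om (fiber x)} -> #|K| * s <= om [set y in S | rep y \in K].
Proof.
move: {2}#|K| (leqnn #|K|) => k; elim: k K => [|k IHk] K.
  by rewrite leqn0 cards_eq0 => /eqP -> _ _ _; rewrite cards0 mul0n.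
move=> Kk sK cK Ks; have [->|[x xK]] := set_0Vmem K; first by rewrite cards0 mul0n.
have sK' : K :\ x \subset K by apply: subsetDl.
have cKx := cardsD1 x K; rewrite xK in cKx.
have le := IHk (K :\ x) _ (subset_trans sK' sK) (sub_clique sK' cK) _.
rewrite cKx mulnDl mul1n; apply: leq_trans (leq_add (Ks x xK) (le _ _)) _.
- by move: Kk cKx; clear; lia.
- by move=> y /(subsetP sK')/Ks.
apply: om_join.
- by apply/subsetP => y; rewrite !inE => /andP[-> /eqP ->].
- by apply/subsetP => y; rewrite !inE => /and3P[-> _ ->].
move=> a b ax; rewrite !inE => /and3P[bS bx bK].
apply: (fiber_adj (x := x) (y := rep b)); rewrite ?(subsetP sK) //; last by rewrite inE bS eqxx.
by move/cliqueP: cK; apply; rewrite // eq_sym.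
Qed.

Lemma om_heavy s : 0 < s -> om [set x in rep @: S | s <= om (fiber x)] <= n %/ s.
Proof.
move=> s_gt0; apply/om_leP => K sK cK; rewrite leq_divRL //.
apply: leq_trans (clique_weight (s := s) _ cK _) (omS _).
- by apply/subsetP => x /(subsetP sK); rewrite inE => /andP[].
- by move=> x /(subsetP sK); rewrite inE => /andP[].
- by apply/subsetP => x; rewrite inE => /andP[].
Qed.

Lemma scol_substitution : scol S (n ^ D).
Proof.
have D_gt0 : 0 < D by rewrite addn_gt0 orbT.
have exk (k : nat) : exists s, k < s ^ D.
  by exists k.+1; rewrite -[k.+1 in X in X <= _]expn1 leq_pexp2l.
pose rk k := ex_minn (exk k).
have rkP k : [/\ 0 < rk k, (rk k).-1 ^ D <= k, k < rk k ^ D & forall s, k < s ^ D -> rk k <= s].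
  rewrite /rk; case: ex_minnP => s ks smin.
  have s_gt0 : 0 < s by case: s ks {smin} => //; rewrite exp0n.
  split=> //; rewrite leqNgt; apply/negP => /smin; rewrite leqNgt => /negP; apply.
  by rewrite prednK.
have exph (s : 'I_n.+1) : exists phi : G -> nat, 0 < s ->
    {in [set x in rep @: S | s <= om (fiber x)], forall x, phi x < block_count A n s} /\
    {in [set x in rep @: S | s <= om (fiber x)] &, forall x y, adj x y -> phi x != phi y}.
  case: (posnP s) => [s0|s_gt0]; first by exists (fun=> 0).
  set U := [set x in _ | _].
  have sU : U \subset rep @: S by apply/subsetP => x; rewrite inE => /andP[].
  have : scol U (block_count A n s).
    apply: (scolW (colT sU)) => //; rewrite leq_mul // leq_expl //; exact: om_heavy.
  by case=> phi p1 p2; exists phi.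
case/fin_all_exists: exph => phi phiP.
have exc (x : G) : exists c : G -> nat, x \in S ->
    {in fiber (rep x), forall y, c y < om (fiber (rep x)) ^ D} /\
    {in fiber (rep x) &, forall y z, adj y z -> c y != c z}.
  have [xS|xS] := boolP (x \in S); last by exists (fun=> 0).
  by have [c c1 c2] := colF xS; exists c.
case/fin_all_exists: exc => c cP.
pose wt y := om (fiber (rep y)).
pose k y := c (rep y) y.
have inF y : y \in S -> y \in fiber (rep y) by rewrite inE eqxx andbT.
have kwt y : y \in S -> k y < wt y ^ D.
  move=> yS; have [+ _] := cP (rep y) (repS yS); rewrite repK //; apply; exact: inF.
have kN y z : y \in S -> z \in S -> rep y = rep z -> adj y z -> k y != k z.
  move=> yS zS E yz; have [_] := cP (rep y) (repS yS); rewrite repK // /k -E; apply=> //.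
    exact: inF.
  by rewrite E; apply: inF.
have wtn y : wt y <= n by apply: omS; apply: fiber_sub.
(* The rank [k y] falls into block [s], and [s <= wt y], so the quotient colouring [phi] of the
   modules of clique number at least [s] covers the module of [y]. The code records the block, this
   quotient colour and the offset of the rank. *)
pose lc y := let s := rk (k y) in block_end A m n s.-1 +
  (phi (inord s) (rep y) * block_width m s + (k y - s.-1 ^ D)).
have lcP y : y \in S -> [/\ rk (k y) <= wt y, phi (inord (rk (k y))) (rep y) < block_count A n
  (rk (k y)),
    k y - (rk (k y)).-1 ^ D < block_width m (rk (k y)) & lc y < block_end A m n (rk (k y))].
  move=> yS; have [s_gt0 k1 k2 smin] := rkP (k y); rewrite /lc;
    set s := rk (k y) in s_gt0 k1 k2 smin *.
  have sw : s <= wt y by apply: smin; apply: kwt.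
  have sn : s < n.+1 by rewrite ltnS (leq_trans sw).
  have pc : phi (inord s) (rep y) < block_count A n s.
    have [] := phiP (inord s); rewrite inordK // => + _; apply.
    by rewrite inE imset_f.
  have kb : k y - s.-1 ^ D < block_width m s by rewrite /block_width; move: k1 k2; clear; lia.
  split=> //; case: (s) s_gt0 pc kb => // s' _ /= pc kb.
  rewrite block_endS ltn_add2l; move: pc kb; clear; nia.
have lcw y : y \in S -> lc y < block_end A m n (wt y).
  by move=> /lcP[sw _ _ l]; exact: (leq_trans l (block_end_mono A m n sw)).
have lc_inj y z : y \in S -> z \in S -> lc y = lc z ->
    [/\ rk (k y) = rk (k z), phi (inord (rk (k y))) (rep y) = phi (inord (rk (k y))) (rep z) &
      k y = k z].
  move=> yS zS E; have [_ py ky ly] := lcP y yS; have [_ pz kz lz] := lcP z zS.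
  have [sy_gt0 y1 _ _] := rkP (k y); have [sz_gt0 z1 _ _] := rkP (k z).
  have ge_lc x : block_end A m n (rk (k x)).-1 <= lc x by apply: leq_addr.
  have srk : rk (k y) = rk (k z).
    apply/eqP; rewrite eqn_leq; apply/andP; split; rewrite leqNgt; apply/negP => lt.
      have le : rk (k z) <= (rk (k y)).-1 by rewrite -ltnS prednK.
      have := leq_trans lz (leq_trans (block_end_mono A m n le) (ge_lc y)).
      by rewrite E ltnn.
    have le : rk (k y) <= (rk (k z)).-1 by rewrite -ltnS prednK.
    have := leq_trans ly (leq_trans (block_end_mono A m n le) (ge_lc z)).
    by rewrite E ltnn.
  move: E; rewrite /lc -srk => /addnI E; rewrite -srk in pz kz z1.
  have pe : phi (inord (rk (k y))) (rep y) = phi (inord (rk (k y))) (rep z).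
    by move: E ky kz; clear; nia.
  split=> //; move: E; rewrite pe => /addnI; move: y1 z1; clear; lia.
have lcn y : y \in S -> 2 * wt y <= n -> lc y + (n - wt y) ^ D < n ^ D.
  move=> yS yn; apply: leq_trans (block_end_bound Am yn).
  by rewrite ltn_add2r lcw.
have adj_wt y z : y \in S -> z \in S -> rep y != rep z -> adj y z -> wt y + wt z <= n.
  move=> yS zS yz ayz; apply: om_join; try exact: fiber_sub.
  by apply: fiber_adj; rewrite ?imset_f // -rep_adj.
(* Adjacent modules have clique numbers of sum at most [n]. So two modules above [n / 2] are never
   adjacent and share the bottom of the palette, while the others count down from the top by their
   code. *)
pose col y := if n < 2 * wt y then k y else n ^ D - (lc y).+1.
have heavy_light y z : y \in S -> z \in S -> adj y z -> n < 2 * wt y -> 2 * wt z <= n ->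
  k y != n ^ D - (lc z).+1.
  move=> yS zS yz hy lz; have [E|yNz] := eqVneq (rep y) (rep z).
    by move: hy lz; rewrite /wt E; clear; lia.
  have le := adj_wt y z yS zS yNz yz; have := lcn z zS lz; have := kwt y yS.
  have : wt y ^ D <= (n - wt z) ^ D by apply: leq_expl; move: le; clear; lia.
  by move: (wt y ^ D) ((n - wt z) ^ D) (n ^ D) (k y) (lc z) => ? ? ? ? ?; clear; lia.
exists col => [y yS|y z yS zS yz].
  rewrite /col; case: (ltnP n (2 * wt y)) => [_|yn];
    first exact: leq_trans (kwt y yS) (leq_expl _ (wtn y)).
  by have := lcn y yS yn; move: (_ ^ D) (n ^ D) (lc y) => ? ? ?; clear; lia.
rewrite /col; case: (ltnP n (2 * wt y)) => [hy|hy]; case: (ltnP n (2 * wt z)) => [hz|hz].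
- have [E|yNz] := eqVneq (rep y) (rep z); first exact: kN.
  by have := adj_wt y z yS zS yNz yz; move: hy hz; clear; lia.
- exact: heavy_light.
- by rewrite eq_sym; apply: heavy_light => //; rewrite adj_sym.
have ly := lcn y yS hy; have lz := lcn z zS hz.
apply/eqP => E; have El : lc y = lc z.
  by move: ly lz E; move: (n ^ D) ((n - wt y) ^ D) ((n - wt z) ^ D) (lc y) (lc z) => ? ? ? ? ?;
    clear; lia.
have [srk pe ke] := lc_inj y z yS zS El.
have [Er|yNz] := eqVneq (rep y) (rep z).
  by have := kN y z yS zS Er yz; rewrite ke eqxx.
have [sy _ _ _] := lcP y yS; have [sz _ _ _] := lcP z zS; rewrite -srk in sz.
have [s_gt0 _ _ _] := rkP (k y).
have sn : rk (k y) < n.+1 by rewrite ltnS (leq_trans sy).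
have := phiP (inord (rk (k y))); rewrite inordK // => /(_ s_gt0)[_ /(_ (rep y) (rep z))].
rewrite !inE !imset_f // sy sz pe eqxx => /(_ isT isT).
by rewrite -rep_adj // yz => /(_ isT).
Qed.

End Substitution.

Lemma scol_bull_free (G : sgraph) F m : bullfree (@adj G) -> om_bounded G F ->
  (2 * F 2 + 3) * (m + 5) <= 2 ^ m -> forall S : {set G}, scol S (om S ^ (m + 5)).
Proof.
move=> bf HF Am S; move: {2}#|S| (leqnn #|S|) => k; elim: k S => [|k IHk] S.
  by rewrite leqn0 cards_eq0 => /eqP ->; apply: scol0.
move=> Sk; have D_gt0 : 0 < m + 5 by rewrite addn_gt0 orbT.
have smaller (A : {set G}) : A \proper S -> scol A (om A ^ (m + 5)).
  by move=> /proper_card AS; apply: IHk; move: AS Sk; clear; lia.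
have [S1|S1] := leqP #|S| 1.
  apply: (scolW (scol_card S)) => //; have [->|S0] := eqVneq S set0; first by rewrite cards0.
  by apply: leq_trans S1 _; rewrite expn_gt0 om_gt0 S0.
have [/existsP[b /existsP[A /and4P[sA A0 AS /forall_inP AP]]]|nocut] :=
    boolP [exists b, exists A, cut (@adj G) S b A].
  have pA : A \proper S by rewrite properEneq AS.
  have pB : S :\: A \proper S.
    rewrite properEneq subsetDl andbT; case/set0Pn: A0 => x xA.
    by apply/eqP => E; have := subsetP sA x xA; rewrite -E inE xA.
  have {}AP x y : x \in A -> y \in S :\: A -> adj x y = b.
    by move=> /AP/forall_inP + yS => /(_ y yS)/eqP.
  have SE : S \subset A :|: (S :\: A) by apply/subsetP => x xS; rewrite !inE xS andbT orbN.
  have sB : S :\: A \subset S by apply: subsetDl.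
  case: b AP => AP.
    apply: (scolW (scolU (smaller _ pA) (smaller _ pB))) => //.
    apply: leq_trans (expn_superadd _ _ D_gt0) (leq_expl _ _).
    by apply: om_join => // x y xA yS; rewrite AP.
  apply: (scolW (scol_anti (k := om S ^ (m + 5)) _ _ _) SE (leqnn _)).
  - by move=> x y xA yS; rewrite AP.
  - by apply: (scolW (smaller _ pA)) => //; rewrite leq_expl // omS.
  - by apply: (scolW (smaller _ pB)) => //; rewrite leq_expl // omS.
have nocut' b A : ~~ cut (@adj G) S b A.
  by apply: contra nocut => cA; apply/existsP; exists b; apply/existsP; exists A.
have [rep [repS repK rep_adj repP repT]] := modular_partition (@adj_sym G) S1 nocut'.
apply: (scol_substitution Am repS repK rep_adj) => [U sU|x xS].
  exact: (scol_prime_bull_free bf HF repT sU).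
by apply: smaller; apply: repP.
Qed.

Lemma bull_pollyanna : pollyanna (graph_free bull).
Proof.
apply: pollyanna_of_power_bound => F; pose A := 2 * F 2 + 3; pose m := (A + 5) * 3.
exists 1, (m + 5) => G free HF S; rewrite mul1n.
(* [2 ^ m] is the cube of [2 ^ (A + 5)], hence at least [(A + 6) ^ 3], which dominates the quadratic
   [A * (m + 5)]. *)
have Am : A * (m + 5) <= 2 ^ m.
  have : A + 5 < 2 ^ (A + 5) by apply: ltn_expl.
  rewrite /m expnM; move: (2 ^ (A + 5)) => e lt_e.
  have : (A + 6) ^ 3 <= e ^ 3 by apply: leq_expl; move: lt_e; clear; lia.
  by apply: leq_trans; rewrite !expnS expn0; clear; nia.
apply: (scolW (scol_bull_free (graph_free_bull_bullfree free) HF Am S)) => //.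
by apply: leq_expl.
Qed.

Theorem theorem1p1 (m k t : nat) (hm : 0 < m) (hk : 0 < k) (ht : 0 < t) :
  [/\ pollyanna (graph_free (mK m t)),
      pollyanna (graph_free (pineapple t k)),
      pollyanna (graph_free (lollipop t)),
      pollyanna (graph_free bowtie)
    & pollyanna (graph_free bull)].
Proof.
split.
- exact: mK_pollyanna.
- exact: pineapple_pollyanna.
- exact: lollipop_pollyanna.
- exact: bowtie_pollyanna.
- exact: bull_pollyanna.
Qed.
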